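(* Let $K$ be a prime knot in $S^3$, let $p(K)$ be its clock number and $c(K)$ its minimal crossing number. Then $p(K)\ge c(K)$.
   Context: A knot diagram $\tilde K$ of a knot $K$ is a regular projection (on the plane, or on the sphere $S^2$) with over/under information; $c(\tilde K)$ is its number of crossings and $c(K)$ is the minimum of $c(\tilde K)$ over all diagrams of $K$. The universe $\hat K$ obtained from $\tilde K$ is the underlying four-valent planar graph, obtained by forgetting over/under information; its vertices are the crossings. It divides the plane (or sphere) into $c(\tilde K)+2$ regions $R_1,\dots,R_{c(\tilde K)+2}$. Two distinct regions are adjacent if they share an edge of $\hat K$. State: fix two adjacent regions $R_i,R_j$ (''starred regions''). A state of $\hat K$ is a choice, at each vertex, of one of the four corners at that vertex (the vertex's ''marker'' is placed in that corner) so that each non-starred region contains exactly one marker and the starred regions contain none. Transposition: suppose that in a state the marker at vertex $v$ lies in region $A$ and the marker at vertex $w\neq v$ lies in region $B\ne A$, that at $v$ the marked corner is next to a corner belonging to $B$, separated from it by an edge shared by $A$ and $B$, and that at $w$ the marked corner is next to a corner belonging to $A$, separated from it by an edge shared by $A$ and $B$ (the same edge or another one). A transposition moves the marker at $v$ across its edge into $B$ and the marker at $w$ across its edge into $A$, both markers rotating a quarter turn about their vertices in the same direction; the result is another state. It is a clockwise (counterclockwise) transposition if both markers rotate clockwise (counterclockwise). A clocked state is a state admitting only clockwise transpositions, and a counterclocked state is one admitting only counterclockwise transpositions. By a theorem of Kauffman, for fixed starred regions there is a unique clocked state and a unique counterclocked state, every state is reached from the clocked state by a series of clockwise transpositions,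 and every state is reached from the counterclocked state by a series of counterclockwise transpositions. The lattice is the directed graph whose vertices are the states and whose arrows are the clockwise transpositions. Let $p(\tilde K;i,j)$ be the height of the lattice with starred regions $R_i,R_j$, i.e. one plus the minimum number of transpositions connecting the clocked state and the counterclocked state. The clock number of $K$ is $$p(K)=\min\{p(\tilde K;i,j)\},$$ the minimum taken over all diagrams $\tilde K$ of $K$ and all pairs of adjacent regions $R_i,R_j$ of $\hat K$. Prime knots are nontrivial. *)

(* Defs.v *)
(* Oriented knots in S^3 are modelled as classes of diagrams on the oriented
   sphere modulo Reidemeister moves; a diagram is a planar signed Gauss code.
   Every diagram of an unoriented knot can be oriented so as to represent either
   given orientation of the knot, so orienting knots changes neither the
   crossing number, nor the clock number, nor primeness. *)
From Stdlib Require Export Relations.Relation_Operators.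
From mathcomp Require Export all_boot all_fingroup.

Set Implicit Arguments.
Unset Strict Implicit.
Unset Printing Implicit Defensive.

(* The letter (v, o) of the code is the passage of the knot through the crossing
   v, along the over strand iff o = true; the code lists cyclically the passages
   met while travelling along the oriented knot. *)
Record gauss_code := GaussCode {
  crossing : finType;
  code : seq (crossing * bool);
  positive : crossing -> bool
}.

Section Universe.
Variable D : gauss_code.

Definition letter : finType := (crossing D * bool)%type.

(* Half-edge of the universe: (v, o, out) is the half-edge of the passage (v, o)
   that leaves v if out = true, and the one that arrives at v otherwise.
   The dart d also denotes the corner between d and the half-edge that follows d
   counterclockwise around the same crossing. *)
Definition dart : finType := (letter * bool)%type.

Definition passage (d : dart) : letter := d.1.
Definition vertex (d : dart) : crossing D := d.1.1.
Definition over (d : dart) : bool := d.1.2.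

(* Counterclockwise, the half-edges at a positive crossing are over-out,
   under-out, over-in, under-in; at a negative crossing they are over-out,
   under-in, over-in, under-out. *)
Definition ccw (d : dart) : dart :=
  let: (v, o, out) := d in
  (v, ~~ o, if o == positive v then out else ~~ out).

Definition cw (d : dart) : dart :=
  let: (v, o, out) := d in
  (v, ~~ o, if o == positive v then ~~ out else out).

Lemma ccwK : cancel ccw cw.
Proof. by case=> [[v o] out] /=; case: (positive v) o out => [] [] []. Qed.

Lemma cwK : cancel cw ccw.
Proof. by case=> [[v o] out] /=; case: (positive v) o out => [] [] []. Qed.

(* The other half of the edge that contains d. *)
Definition opp (d : dart) : dart :=
  if d.2 then (next (code D) (passage d), false)
  else (prev (code D) (passage d), true).

(* Follows the edge of d, then the next edge around the region to its left. *)
Definition face_next (d : dart) : dart := cw (opp d).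

(* The region to the left of d, i.e. the one containing the corner d, given as
   the set of all its corners. *)
Definition region (d : dart) : {set dart} := [set x | fconnect face_next d x].

Definition regions : {set {set dart}} := [set region d | d : dart].

(* region (opp d) is the region to the right of d. *)
Definition adjacent (Ri Rj : {set dart}) : Prop :=
  Ri <> Rj /\ exists d, region d = Ri /\ region (opp d) = Rj.

(* A code without crossing is the embedded circle. Otherwise the universe is
   connected, with #|crossing D| vertices and twice as many edges, and being
   drawn on the sphere is Euler's formula. *)
Definition planar : Prop :=
  #|crossing D| = 0 \/ #|regions| = #|crossing D| + 2.

End Universe.

Record knot_diagram := KnotDiagram {
  gauss :> gauss_code;
  code_uniq : uniq (code gauss);
  code_full : forall l : letter gauss, l \in code gauss;
  gauss_planar : planar gauss
}.

(* D' is spelled by the cyclic word s in the crossings of D, up to renaming of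
   the crossings. *)
Definition spelled_by (D D' : gauss_code) (s : seq (letter D)) : Prop :=
  exists f : crossing D' -> crossing D,
    (forall v, positive (f v) = positive v) /\
    exists k, [seq (f l.1, l.2) | l <- code D'] = rot k s.

(* The empty diagram being spelled by the empty word, the first two moves below
   may lead to the circle without crossing. *)
Definition erase (D : gauss_code) (S : {set crossing D}) : seq (letter D) :=
  [seq l <- code D | l.1 \notin S].

Definition planar_isotopy (D D' : knot_diagram) : Prop :=
  spelled_by D' (code D).

Definition reidemeister1 (D D' : knot_diagram) : Prop :=
  exists d : dart D,
    face_next d = d /\ spelled_by D' (erase [set vertex d]).

(* The edge of d is the over side of the bigon; its other side is then under. *)
Definition reidemeister2 (D D' : knot_diagram) : Prop :=
  exists d : dart D,
    let d1 := face_next d in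
    [/\ face_next d1 = d,
        vertex d != vertex d1,
        over d && over (opp d) &
        spelled_by D' (erase [set vertex d; vertex d1])].

(* Exchanges, along the strand that carries the edge of d, the passages at the
   two ends of that edge. *)
Definition swap_ends (D : gauss_code) (d : dart D) (l : letter D) : letter D :=
  tperm (passage d) (passage (opp d)) l.

(* The edge of d is the side of the triangle lying on the top strand; of the
   other two sides, one is then on the middle strand and one on the bottom. *)
Definition reidemeister3 (D D' : knot_diagram) : Prop :=
  exists d : dart D,
    let d1 := face_next d in
    let d2 := face_next d1 in
    [/\ face_next d2 = d,
        uniq [:: vertex d; vertex d1; vertex d2],
        over d && over (opp d) &
        spelled_by D'
          [seq swap_ends d (swap_ends d1 (swap_ends d2 l)) | l <- code D]].

Definition reidemeister (D D' : knot_diagram) : Prop :=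
  [\/ planar_isotopy D D', reidemeister1 D D',
      reidemeister2 D D' | reidemeister3 D D'].

Definition same_knot : knot_diagram -> knot_diagram -> Prop :=
  clos_refl_sym_trans knot_diagram reidemeister.

Record knot := Knot {
  diagram_of : knot_diagram -> Prop;
  diagram_ofP : exists D0, forall D, diagram_of D <-> same_knot D0 D
}.

Definition trivial_knot (K : knot) : Prop :=
  exists D, diagram_of K D /\ #|crossing D| = 0.

(* Joining D1 and D2 along the edges at which their cyclic codes are cut open. *)
Definition diagram_sum (D1 D2 D : gauss_code) : Prop :=
  exists (f1 : crossing D1 -> crossing D) (f2 : crossing D2 -> crossing D),
    [/\ forall v, positive (f1 v) = positive v,
        forall v, positive (f2 v) = positive v &
        code D = [seq (f1 l.1, l.2) | l <- code D1]
              ++ [seq (f2 l.1, l.2) | l <- code D2]].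

Definition connected_sum (K1 K2 K : knot) : Prop :=
  exists D1 D2 D : knot_diagram,
    [/\ diagram_of K1 D1, diagram_of K2 D2, diagram_of K D &
        diagram_sum D1 D2 D].

Definition prime_knot (K : knot) : Prop :=
  ~ trivial_knot K /\
  forall K1 K2, connected_sum K1 K2 K -> trivial_knot K1 \/ trivial_knot K2.

Definition is_least (P : nat -> Prop) (n : nat) : Prop :=
  P n /\ forall m, P m -> n <= m.

Definition crossing_number (K : knot) : nat -> Prop :=
  is_least (fun n => exists D, diagram_of K D /\ #|crossing D| = n).

Section Clock.
Variable D : gauss_code.

(* The corner in which each crossing has its marker. *)
Definition marking : finType := {ffun crossing D -> dart D}.

Definition is_state (Ri Rj : {set dart D}) (s : marking) : Prop :=
  (forall v, vertex (s v) = v) /\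
  (forall R, R \in regions D ->
     #|[set v | s v \in R]| = if (R == Ri) || (R == Rj) then 0 else 1).

(* turn is cw or ccw: the quarter turn of the corners around their vertices. *)
Definition turn_at (turn : dart D -> dart D) (v w : crossing D) (s : marking) :
    marking :=
  [ffun u => if (u == v) || (u == w) then turn (s u) else s u].

Definition transposition (turn : dart D -> dart D) : rel marking := fun s t =>
  [exists v, exists w,
    [&& v != w,
        region (s v) != region (s w),
        region (turn (s v)) == region (s w),
        region (turn (s w)) == region (s v) &
        t == turn_at turn v w s]].

Definition clockwise : rel marking := transposition (@cw D).
Definition counterclockwise : rel marking := transposition (@ccw D).

Definition clocked (Ri Rj : {set dart D}) (s : marking) : Prop :=
  is_state Ri Rj s /\ forall t, ~~ counterclockwise s t.

Definition counterclocked (Ri Rj : {set dart D}) (s : marking) : Prop :=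
  is_state Ri Rj s /\ forall t, ~~ clockwise s t.

Definition lattice_height (Ri Rj : {set dart D}) : nat -> Prop :=
  is_least (fun h => exists (s t : marking) (q : seq marking),
    [/\ clocked Ri Rj s,
        counterclocked Ri Rj t,
        path (fun x y => clockwise x y || counterclockwise x y) s q,
        last s q = t &
        h = (size q).+1]).

End Clock.

(* The circle without crossing has no darts, hence no pair Ri, Rj here. Its two
   regions would give it the height 1, which the unknot reaches anyway with a
   diagram with one crossing. *)
Definition clock_number (K : knot) : nat -> Prop :=
  is_least (fun h => exists (D : knot_diagram) (Ri Rj : {set dart D}),
    [/\ diagram_of K D, adjacent Ri Rj & lattice_height Ri Rj h]).

(* Main.v *)
(* Take a diagram D of K and a path of transpositions from the clocked to the
   counterclocked state, realising the clock number.

   Suppose first that D is not a sum of two smaller diagrams. The signed number of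
   transpositions of the path across each edge is a height function; as the path
   goes from the clocked to the counterclocked state, it is positive on every edge
   that does not border a starred region. The ends of every such edge are thus
   exchanged by some transposition of the path, and these edges connect all the
   crossings, so that the path has at least c(D) - 1 steps.

   If D is the sum of D1 and D2, then K being prime, one of them, say D2, is a
   diagram of the unknot. The states, transpositions and the two extreme states of
   D restrict to D1, giving a path that is not longer. Moreover D1 is a diagram of
   K: Reidemeister moves of D2 lift to D, provided that the edge along which D1
   and D2 are joined may be changed; this change amounts to sweeping a strand of
   D2 over the whole of D1. One concludes by induction on the crossings. *)
From Pilot Require Import Defs.
From Stdlib Require Import Classical_Prop.
From mathcomp Require Import all_order all_algebra zify ring.
From Pilot Require Import Defs(opp).

Set Implicit Arguments.
Unset Strict Implicit.
Unset Printing Implicit Defensive.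

(** No picture is available: [planar] is only a count of regions. Equality in Euler's inequality
    makes the first cohomology vanish, so arguments about closed curves become integrations of
    cocycles on the darts: the checkerboard colouring, the two sides of a curve through two edges,
    the potential of a flow. Conversely, a diagram built by hand is shown to be planar by exhibiting
    enough labels of its faces.

    The delicate point for irreducible diagrams is the positivity of the height. Where it fails, a
    closed walk sweeps an unmarked, unstarred corner; its flow integrates to a function on the
    crossings, a sublevel set of which contains the markers of all unstarred regions that it meets.
    A dimension count modulo 2 excludes this for a proper subset.

    For sums, a move of D2 fails to lift only if it involves the edge where D1 is inserted. Sweeping
    a strand over D1 in a geometric order would need a shelling of D1. *)

Module EulerFormula.
Import GRing.Theory.
Local Open Scope ring_scope.

(** * Rank counts for two orthogonal families, each with one linear relation *)

Section FunctionMatrices.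
Variables (F : fieldType) (I J K : finType).

Definition fun_mx (A B : finType) (f : A -> B -> F) : 'M[F]_(#|A|, #|B|) :=
  \matrix_(i, j) f (enum_val i) (enum_val j).
Definition fun_row (A : finType) (x : A -> F) : 'rV[F]_#|A| :=
  \row_i x (enum_val i).
Definition row_fun (A : finType) (x : 'rV[F]_#|A|) : A -> F :=
  fun i => x 0 (enum_rank i).

Lemma row_funK (A : finType) (x : 'rV[F]_#|A|) : fun_row (row_fun x) = x.
Proof. by apply/rowP => i; rewrite mxE /row_fun enum_valK. Qed.

Lemma fun_rowM (A B : finType) (x : A -> F) (f : A -> B -> F) :
  fun_row x *m fun_mx f = fun_row (fun j => \sum_i x i * f i j).
Proof.
apply/rowP => j; rewrite !mxE [RHS](reindex (@enum_val A predT)) /=; last first.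
  by exists enum_rank => i _; rewrite ?enum_valK ?enum_rankK.
by apply: eq_bigr => i _; rewrite !mxE.
Qed.

Lemma fun_row_inj (A : finType) (x y : A -> F) : fun_row x = fun_row y -> x =1 y.
Proof. by move/rowP=> e i; have := e (enum_rank i); rewrite !mxE enum_rankK. Qed.

(** The left kernel lies on the line spanned by [u], hence has dimension at most one. *)
Lemma rank_fun_mx_ge (A B : finType) (f : A -> B -> F) (u : A -> F) :
  (forall x : A -> F, (forall j, \sum_i x i * f i j = 0) ->
     exists c, forall i, x i = c * u i) ->
  (#|A| <= \rank (fun_mx f) + 1)%N.
Proof.
move=> ker1; have : (kermx (fun_mx f) <= fun_row u)%MS.
  apply/rV_subP => x /sub_kermxP; rewrite -[x]row_funK fun_rowM => /rowP e.
  have [j|c ce] := ker1 (row_fun x).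
    by have := e (enum_rank j); rewrite !mxE enum_rankK.
  apply/submxP; exists c%:M; rewrite mul_scalar_mx.
  by apply/rowP => i; rewrite !mxE ce.
move/mxrankS; rewrite mxrank_ker => /leq_trans/(_ (rank_leq_row _)).
by rewrite leq_subLR.
Qed.

Variables (f : I -> J -> F) (g : K -> J -> F) (u : I -> F) (v : K -> F).
Hypothesis fg0 : forall i k, \sum_j f i j * g k j = 0.
Hypothesis ker_f : forall x : I -> F, (forall j, \sum_i x i * f i j = 0) ->
  exists c, forall i, x i = c * u i.
Hypothesis ker_g : forall x : K -> F, (forall j, \sum_k x k * g k j = 0) ->
  exists c, forall k, x k = c * v k.

Let fM := fun_mx f.
Let gM := fun_mx g.

Lemma fun_mx_orthogonal : (fM <= kermx gM^T)%MS.
Proof.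
apply/sub_kermxP/matrixP => i k; rewrite !mxE -[RHS](fg0 (enum_val i) (enum_val k)).
rewrite [RHS](reindex (@enum_val J predT)) /=; last first.
  by exists enum_rank => j _; rewrite ?enum_valK ?enum_rankK.
by apply: eq_bigr => j _; rewrite !mxE.
Qed.

Lemma orthogonal_ranks :
  (#|I| <= \rank fM + 1)%N /\ (\rank (kermx gM^T) + #|K| <= #|J| + 1)%N.
Proof.
split; first exact: rank_fun_mx_ge ker_f.
rewrite mxrank_ker mxrank_tr.
have := rank_fun_mx_ge ker_g; rewrite -/gM => h.
have hr : (\rank gM <= #|J|)%N by apply: rank_leq_col.
lia.
Qed.

(** The row space of [f], of dimension at least [#|I| - 1], lies in the annihilator of [g], of
    dimension at most [#|J| - #|K| + 1]. *)
Lemma orthogonal_card : (#|I| + #|K| <= #|J| + 2)%N.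
Proof.
have [h1 h2] := orthogonal_ranks; have h3 := mxrankS fun_mx_orthogonal.
lia.
Qed.

(** At equality the row space of [f] and the annihilator of [g] have the same dimension, so the
    inclusion between them is an equality. *)
Lemma orthogonal_exact : (#|I| + #|K| = #|J| + 2)%N ->
  forall y : J -> F, (forall k, \sum_j y j * g k j = 0) ->
  exists x : I -> F, forall j, y j = \sum_i x i * f i j.
Proof.
move=> eqc y y0; have [h1 h2] := orthogonal_ranks.
have h3 := mxrankS fun_mx_orthogonal.
have : (kermx gM^T <= fM)%MS.
  have := mxrank_leqif_sup fun_mx_orthogonal; case=> _ <-.
  by lia.
have yk : (fun_row y <= kermx gM^T)%MS.
  apply/sub_kermxP/rowP => k; rewrite !mxE -[RHS](y0 (enum_val k)).
  rewrite [RHS](reindex (@enum_val J predT)) /=; last first.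
    by exists enum_rank => j _; rewrite ?enum_valK ?enum_rankK.
  by apply: eq_bigr => j _; rewrite !mxE.
move/(submx_trans yk)/submxP => [x]; rewrite -[x]row_funK fun_rowM => /fun_row_inj.
by exists (row_fun x).
Qed.

End FunctionMatrices.

(** * Euler's inequality and its equality case *)

Section EulerExact.
Variables (F : fieldType) (T V E R : finType) (s s' a : T -> T).
Variables (pv : T -> V) (pe : T -> E) (pf : T -> R).
Hypothesis sK : cancel s s'.
Hypothesis s'K : cancel s' s.
Hypothesis aK : involutive a.
Hypothesis pv_s : forall d, pv (s d) = pv d.
Hypothesis pe_a : forall d, pe (a d) = pe d.
Hypothesis pf_f : forall d, pf (s' (a d)) = pf d.
Hypothesis pv_surj : forall v, exists d, pv d = v.
Hypothesis pe_surj : forall e, exists d, pe d = e.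
Hypothesis pf_surj : forall r, exists d, pf d = r.
Hypothesis connected : forall phi : T -> F,
  (forall d, phi (s d) = phi d) -> (forall d, phi (a d) = phi d) ->
  forall d d', phi d = phi d'.
Variable d0 : T.

(** [f] is the coboundary matrix of the graph on the darts with edges from [d] to [s d] and from [d]
    to [a d]; [g] lists the cycles of this graph around vertices, edges and regions. The minus sign
    is there because the boundary of a region runs backwards along [s]. *)
Let f (i : T) (j : T + T) : F :=
  match j with
  | inl d => (i == s d)%:R - (i == d)%:R
  | inr d => (i == a d)%:R - (i == d)%:R
  end.
Let g (k : V + E + R) (j : T + T) : F :=
  match k, j with
  | inl (inl v), inl d => (pv d == v)%:R
  | inl (inr e), inr d => (pe d == e)%:R
  | inr r, inl d => - (pf d == r)%:R
  | inr r, inr d => (pf d == r)%:R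
  | _, _ => 0
  end.

Let sum_pick (x : T -> F) (d : T) : \sum_i x i * (i == d)%:R = x d.
Proof.
by rewrite (bigD1 d) //= eqxx mulr1 big1 ?addr0 // => i /negPf ->; rewrite mulr0.
Qed.

Let sum_f x (j : T + T) : \sum_i x i * f i j =
  match j with inl d => x (s d) - x d | inr d => x (a d) - x d end.
Proof.
by case: j => d; under eq_bigr do rewrite mulrBr; rewrite sumrB !sum_pick.
Qed.

Let sum_pick2 (P : pred T) (i : T) (h : T -> T) (h' : T -> T) :
  cancel h h' -> cancel h' h ->
  \sum_d ((i == h d)%:R - (i == d)%:R : F) * (P d)%:R = (P (h' i))%:R - (P i)%:R.
Proof.
move=> hK h'K; under eq_bigr do rewrite mulrBl; rewrite sumrB; congr (_ - _).
  rewrite (bigD1 (h' i)) //= h'K eqxx mul1r big1 ?addr0 // => d dn.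
  by rewrite -(can2_eq h'K hK) eq_sym (negPf dn) mul0r.
rewrite (bigD1 i) //= eqxx mul1r big1 ?addr0 // => d dn.
by rewrite eq_sym (negPf dn) mul0r.
Qed.

Let fg0 i k : \sum_j f i j * g k j = 0.
Proof.
rewrite big_sumType /=; case: k => [[v|e]|r] /=.
- rewrite [X in _ + X]big1 ?addr0 => [|d _]; last by rewrite mulr0.
  rewrite (sum_pick2 (fun d => pv d == v) i sK s'K).
  by rewrite -[in X in _ - X](s'K i) pv_s subrr.
- rewrite [X in X + _]big1 ?add0r => [|d _]; last by rewrite mulr0.
  by rewrite (sum_pick2 (fun d => pe d == e) i aK aK) pe_a subrr.
under eq_bigr do rewrite mulrN; rewrite sumrN.
rewrite (sum_pick2 (fun d => pf d == r) i sK s'K).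
rewrite (sum_pick2 (fun d => pf d == r) i aK aK).
have -> : pf (a i) = pf (s' i) by rewrite -(pf_f (a i)) aK.
by rewrite addrC subrr.
Qed.

Let ker_f (x : T -> F) : (forall j, \sum_i x i * f i j = 0) ->
  exists c, forall i, x i = c * 1.
Proof.
move=> x0; exists (x d0) => i; rewrite mulr1; apply: connected => d.
  by have := x0 (inl d); rewrite sum_f => /eqP; rewrite subr_eq0 => /eqP.
by have := x0 (inr d); rewrite sum_f => /eqP; rewrite subr_eq0 => /eqP.
Qed.

Let sum_g (x : V + E + R -> F) j : \sum_k x k * g k j =
  match j with
  | inl d => x (inl (inl (pv d))) - x (inr (pf d))
  | inr d => x (inl (inr (pe d))) + x (inr (pf d))
  end.
Proof.
have pick (A : finType) (y : A -> F) b : \sum_i y i * (b == i)%:R = y b.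
  rewrite (bigD1 b) //= eqxx mulr1 big1 ?addr0 // => i.
  by rewrite eq_sym => /negPf ->; rewrite mulr0.
rewrite big_sumType big_sumType /=; case: j => d.
  rewrite pick [X in _ + X + _]big1 ?addr0 => [|e _]; last by rewrite mulr0.
  by under eq_bigr do rewrite mulrN; rewrite sumrN (pick _ (fun r => x (inr r))).
rewrite [X in X + _ + _]big1 ?add0r => [|e _]; last by rewrite mulr0.
by rewrite (pick _ (fun e => x (inl (inr e)))) (pick _ (fun r => x (inr r))).
Qed.

(** A relation takes equal values on a vertex and a region that share a dart, and opposite values on
    an edge and such a region; connectedness leaves one free value. *)
Let ker_g (x : V + E + R -> F) : (forall j, \sum_k x k * g k j = 0) ->
  exists c, forall k, x k = c * (if k is inl (inr _) then -1 else 1).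
Proof.
move=> x0.
have xv d : x (inl (inl (pv d))) = x (inr (pf d)).
  by have := x0 (inl d); rewrite sum_g => /eqP; rewrite subr_eq0 => /eqP.
have xe d : x (inl (inr (pe d))) = - x (inr (pf d)).
  by have := x0 (inr d); rewrite sum_g => /eqP; rewrite addr_eq0 => /eqP.
have cst d : x (inr (pf d)) = x (inr (pf d0)).
  apply: (connected (phi := fun d => x (inr (pf d)))) => {}d.
    by rewrite -!xv pv_s.
  by apply: oppr_inj; rewrite -!xe pe_a.
exists (x (inr (pf d0))); case=> [[v|e]|r].
- by have [d <-] := pv_surj v; rewrite xv cst mulr1.
- by have [d <-] := pe_surj e; rewrite xe cst mulrN1.
by have [d <-] := pf_surj r; rewrite cst mulr1.
Qed.

Lemma euler_inequality : (#|V| + #|E| + #|R| <= #|T| + 2)%N.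
Proof.
have := orthogonal_card fg0 ker_f ker_g.
by rewrite !card_sum; lia.
Qed.

(* Equality in Euler's inequality is the vanishing of the first cohomology. *)
Lemma euler_exact : (#|V| + #|E| + #|R| = #|T| + 2)%N ->
  forall A B : T -> F,
  (forall v, \sum_(d | pv d == v) A d = 0) ->
  (forall e, \sum_(d | pe d == e) B d = 0) ->
  (forall r, \sum_(d | pf d == r) (B d - A d) = 0) ->
  exists phi : T -> F, forall d,
    phi (s d) = phi d + A d /\ phi (a d) = phi d + B d.
Proof.
move=> eqc A B Av Be Rf.
pose y (j : T + T) := match j with inl d => A d | inr d => B d end.
have [| |x xP] := orthogonal_exact fg0 ker_f ker_g _ (y := y).
- by rewrite !card_sum eqc; lia.
- have sumP (P : pred T) (h : T -> F) : \sum_d h d * (P d)%:R = \sum_(d | P d) h d.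
    rewrite [RHS]big_mkcond; apply: eq_bigr => d _.
    by case: (P d); rewrite ?mulr1 ?mulr0.
  case=> [[v|e]|r]; rewrite big_sumType /=.
  + rewrite [X in _ + X]big1 ?addr0 => [|d _]; last by rewrite mulr0.
    by rewrite (sumP (fun d => pv d == v)) Av.
  + rewrite [X in X + _]big1 ?add0r => [|d _]; last by rewrite mulr0.
    by rewrite (sumP (fun d => pe d == e)) Be.
  under eq_bigr do rewrite mulrN; rewrite sumrN !(sumP (fun d => pf d == r)).
  by rewrite addrC -sumrB Rf.
exists x => d; have := xP (inl d); have := xP (inr d); rewrite !sum_f /y => -> ->.
by split; rewrite addrC subrK.
Qed.

End EulerExact.

End EulerFormula.
Import EulerFormula.

(** * Darts, regions and integration on a planar diagram *)

Module Diagrams.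
Import GRing.Theory.

Section Diagram.
Variable D : gauss_code.
Hypothesis code_u : uniq (code D).
Hypothesis code_f : forall l : letter D, l \in code D.
Implicit Types (d x y : dart D) (v : crossing D).

Lemma oppK : involutive (@opp D).
Proof.
by case=> [l []]; rewrite /opp /passage /= ?prev_next // next_prev.
Qed.

Lemma opp_neq d : opp d != d.
Proof. by case: d => [l []]; rewrite /opp /= xpair_eqE andbF. Qed.

Lemma opp_inj : injective (@opp D).
Proof. exact: inv_inj oppK. Qed.

Lemma vertex_ccw d : vertex (ccw d) = vertex d.
Proof. by case: d => [[v o] b]. Qed.

Lemma vertex_cw d : vertex (cw d) = vertex d.
Proof. by case: d => [[v o] b]. Qed.

Lemma face_next_inj : injective (@face_next D).
Proof. exact: inj_comp (can_inj (@cwK D)) opp_inj. Qed.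

Lemma face_next_opp_ccw d : face_next (opp (ccw d)) = d.
Proof. by rewrite /face_next oppK ccwK. Qed.

Lemma vertex_face_next d : vertex (face_next d) = vertex (opp d).
Proof. exact: vertex_cw. Qed.

Lemma mem_region d x : (x \in region d) = fconnect (@face_next D) d x.
Proof. by rewrite inE. Qed.

Lemma region_id d : d \in region d.
Proof. by rewrite mem_region connect0. Qed.

Lemma eq_region d x : (region d == region x) = (x \in region d).
Proof.
apply/eqP/idP => [->|]; first exact: region_id.
rewrite mem_region => h; apply/setP => y; rewrite !mem_region.
by rewrite (same_connect (fconnect_sym face_next_inj) h).
Qed.

Lemma region_face d : region (face_next d) = region d.
Proof. by apply/esym/eqP; rewrite eq_region mem_region fconnect1. Qed.

Lemma region_cw d : region (cw d) = region (opp d).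
Proof. by rewrite -[RHS]region_face /face_next oppK. Qed.

Lemma region_opp_ccw d : region (opp (ccw d)) = region d.
Proof. by rewrite -region_cw ccwK. Qed.

Lemma region_invariant (X : Type) (phi : dart D -> X) :
  (forall d, phi (face_next d) = phi d) ->
  forall d x, region d = region x -> phi d = phi x.
Proof.
move=> inv d x /eqP; rewrite eq_region mem_region => /iter_findex <-.
by elim: (findex _ _ _) => //= n ->; rewrite inv.
Qed.

Lemma region_in_regions d : region d \in regions D.
Proof. exact: imset_f. Qed.

Lemma ccw2 d : ccw (ccw d) = (passage d, ~~ d.2).
Proof. by case: d => [[v o] b] /=; case: (positive v) o b => [] [] []. Qed.

Lemma darts_at d x : vertex x = vertex d ->
  [\/ x = d, x = ccw d, x = ccw (ccw d) | x = cw d].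
Proof.
case: d x => [[v o] b] [[v' o'] b']; rewrite /vertex /= => ->.
case: (positive v) o b o' b' => [] [] [] [] [];
  by [constructor 1 | constructor 2 | constructor 3 | constructor 4].
Qed.

(** The knot itself runs through all letters, and two quarter turns exchange the incoming and
    outgoing halves of a passage, so [ccw] and [opp] reach every dart. *)
Lemma dart_connected (X : Type) (phi : dart D -> X) :
  (forall d, phi (ccw d) = phi d) -> (forall d, phi (opp d) = phi d) ->
  forall d x, phi d = phi x.
Proof.
move=> phi_ccw phi_opp.
have phi_out l b : phi (l, b) = phi (l, true).
  by case: b => //; have := phi_ccw (ccw (l, true)); rewrite ccw2 phi_ccw.
have phi_next l : phi (next (code D) l, true) = phi (l, true).
  by rewrite -(phi_out _ false) -(phi_opp (l, true)).
move=> [l b] [l' b']; rewrite !phi_out.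
have : fconnect (next (code D)) l l'.
  by rewrite (fconnect_cycle (cycle_next code_u)).
move/iter_findex => <-.
by elim: (findex _ _ _) => //= n ->; rewrite phi_next.
Qed.

Lemma card_darts : #|dart D| = 4 * #|crossing D|.
Proof. by rewrite !card_prod card_bool -mulnA mulnC. Qed.

Definition edge d : letter D := if d.2 then passage d else passage (opp d).

Lemma edge_opp d : edge (opp d) = edge d.
Proof.
case: d => [l b]; rewrite /edge; case: b => /=; last by [].
by rewrite prev_next.
Qed.

Lemma edge_eq d l : (edge d == l) = (d == (l, true)) || (d == opp (l, true)).
Proof.
rewrite -(inj_eq opp_inj d (opp _)) oppK.
case: d => [k []]; rewrite /edge /opp /= !xpair_eqE ?andbT ?andbF ?orbF //=.
Qed.

Section Euler.
Local Open Scope ring_scope.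
Variable F : fieldType.

Lemma sum_edge (B : dart D -> F) l :
  \sum_(d | edge d == l) B d = B (l, true) + B (opp (l, true)).
Proof.
rewrite (bigD1 (l, true)) /=; last by rewrite edge_eq eqxx.
congr (_ + _); rewrite (big_pred1 (opp (l, true))) // => d.
rewrite edge_eq; case: (d =P (l, true)) => [->|_] /=; last by rewrite andbT.
by rewrite eq_sym (negPf (opp_neq _)).
Qed.

Lemma vertex_surj v : exists d, vertex d = v.
Proof. by exists (v, true, true). Qed.

Lemma edge_surj (l : letter D) : exists d, edge d = l.
Proof. by exists (l, true). Qed.

(** With n crossings, this is the inequality n + 2n + |R| <= 4n + 2 for vertices, edges, labels and
    darts. *)
Lemma labels_le (R : finType) (pf : dart D -> R) :
  (0 < #|crossing D|)%N ->
  (forall d, pf (face_next d) = pf d) -> (forall r, exists d, pf d = r) ->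
  (#|R| <= #|crossing D| + 2)%N.
Proof.
move=> /card_gt0P[v0 _] pf_inv pf_surj.
have := @euler_inequality rat _ _ _ _ _ _ _ (@vertex D) edge pf
  (@ccwK D) (@cwK D) oppK vertex_ccw edge_opp pf_inv vertex_surj edge_surj
  pf_surj (@dart_connected _) (v0, true, true).
by rewrite card_darts !card_prod card_bool; lia.
Qed.

Hypothesis D_planar : planar D.

(** Having n + 2 regions is the equality case of Euler's inequality, so a cocycle on the darts is a
    coboundary. Planarity enters the arguments about curves through this lemma. *)
Lemma planar_exact (A B : dart D -> F) :
  (0 < #|crossing D|)%N ->
  (forall v, \sum_(d | vertex d == v) A d = 0) ->
  (forall d, B (opp d) = - B d) ->
  (forall x, \sum_(d | region d == region x) (B d - A d) = 0) ->
  exists phi : dart D -> F, forall d,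
    phi (ccw d) = phi d + A d /\ phi (opp d) = phi d + B d.
Proof.
move=> n_gt0 Av Bo Rx.
have card_R : #|regions D| = (#|crossing D| + 2)%N.
  by case: D_planar => // n0; rewrite n0 in n_gt0.
pose R : finType := {r : {set dart D} | r \in regions D}.
pose pf d : R := Sub (region d) (region_in_regions d).
have [v0 _] := card_gt0P n_gt0.
have pf_inv d : pf (face_next d) = pf d by apply: val_inj; rewrite /= region_face.
have pf_surj r : exists d, pf d = r.
  by case: r => r r_in; have /imsetP[d _ rE] := r_in; exists d; apply: val_inj.
apply: (euler_exact (@ccwK D) (@cwK D) oppK vertex_ccw edge_opp pf_inv
  vertex_surj edge_surj pf_surj (@dart_connected _) (v0, true, true)) => //.
- by rewrite card_darts !card_prod card_bool card_sig card_R; lia.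
- by move=> l; rewrite sum_edge Bo subrr.
by move=> r; have [x <-] := pf_surj r; rewrite -[RHS](Rx x).
Qed.

End Euler.
End Diagram.

End Diagrams.
Import Diagrams.

(** * Checkerboard colouring, and pairs of regions sharing two edges *)

Module Irreducible.
Import GRing.Theory.

Lemma F2P (x : 'F_2) : x = 0%R \/ x = 1%R.
Proof. have : (x < 2)%N := ltn_ord x.
case: x => m i /= m2; have {m2} : m = 0%N \/ m = 1%N by lia.
by case=> e; [left | right]; apply: val_inj.
Qed.

Lemma addF2 (x : 'F_2) : (x + x = 0)%R.
Proof. by case: (F2P x) => ->; apply: val_inj. Qed.

Lemma oppF2 (x : 'F_2) : (- x = x)%R.
Proof. by apply/eqP; rewrite eq_sym -addr_eq0 addF2. Qed.

(* D is the sum, along an edge, of two diagrams with crossings. *)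
Definition splits (D : gauss_code) : Prop :=
  exists k u w, [/\ rot k (code D) = u ++ w, u <> [::], w <> [::] &
    forall l l', l \in u -> l' \in w -> l.1 != l'.1].

Section Irreducible.
Variable D : gauss_code.
Hypothesis code_u : uniq (code D).
Hypothesis code_f : forall l : letter D, l \in code D.
Hypothesis D_planar : planar D.
Implicit Types (d x y : dart D) (v : crossing D).

Local Open Scope ring_scope.

Lemma sum_vertex (M : zmodType) (A : dart D -> M) x :
  \sum_(d | vertex d == vertex x) A d =
  A x + A (ccw x) + A (ccw (ccw x)) + A (cw x).
Proof.
pose s := [:: x; ccw x; ccw (ccw x); cw x].
rewrite (eq_bigl (mem s)) => [|d].
  rewrite -big_uniq /=; first by rewrite !big_cons big_nil addr0 !addrA.
  by case: x @s => [[v o] b] /=; rewrite !inE !xpair_eqE /=;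
     case: (positive v) o b => [] [] []; rewrite /= ?andbF ?orbF.
rewrite inE; apply/eqP/idP; last first.
  by rewrite !inE => /or4P[] /eqP ->; rewrite ?vertex_cw ?vertex_ccw.
by case/darts_at => ->; rewrite !inE eqxx ?orbT.
Qed.

Lemma dart_crossing d : (0 < #|crossing D|)%N.
Proof. by apply/card_gt0P; exists (vertex d). Qed.

(** Over F_2, let the colour change at each quarter turn and across each edge. These increments sum
    to 4 = 0 at a vertex and cancel along a region, so they integrate; [face_next] combines one of
    each and keeps the colour. *)
Lemma checkerboard : exists col : dart D -> bool,
  (forall d, col (face_next d) = col d) /\ (forall d, col (opp d) = ~~ col d).
Proof.
case: (posnP #|crossing D|) => [n0|n_gt0].
  by exists (fun=> true); split=> d; have := dart_crossing d; rewrite n0.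
have [|||phi phiP] := planar_exact code_u code_f D_planar
  (A := fun=> 1) (B := fun=> (1 : 'F_2)) n_gt0.
- by move=> v; rewrite (sum_vertex _ (v, true, true)); apply: val_inj.
- by move=> d; rewrite oppF2.
- by move=> x; rewrite big1 // => d _; rewrite subrr.
exists (fun d => phi d == 1); split=> d; last first.
  by rewrite (phiP d).2; case: (F2P (phi d)) => ->.
have := (phiP (face_next d)).1; rewrite cwK (phiP d).2.
by case: (F2P (phi d)) => ->; case: (F2P (phi (face_next d))) => ->.
Qed.

Lemma region_opp_neq d : region d != region (opp d).
Proof.
have [col [colf colo]] := checkerboard.
by apply/eqP => /(region_invariant code_u colf); rewrite colo; case: (col d).
Qed.

Lemma edge_inj d x : edge d = edge x -> x = d \/ x = opp d.
Proof.
have H y l : edge y = l -> y = (l, true) \/ y = opp (l, true).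
  by move/eqP; rewrite edge_eq // => /orP[] /eqP; [left | right].
move=> e; have := H _ _ e; have := H x _ erefl; move: (edge x) => l.
by case=> ->; case=> ->; rewrite ?oppK //; auto.
Qed.

(** A closed curve through the two common regions meets the universe on these two edges only. [B] is
    its intersection number modulo 2 with an edge, and the integral [phi] tells on which side of the
    curve a dart lies. As [phi] is constant at each crossing, the two arcs of the knot between these
    edges visit disjoint sets of crossings. *)
Lemma shared_edges_split d x :
  edge d != edge x -> region d = region x -> region (opp d) = region (opp x) ->
  splits D.
Proof.
move=> dx r1 r2; have n_gt0 := dart_crossing d.
pose B y : 'F_2 := (edge y == edge d)%:R + (edge y == edge x)%:R.
have [|||phi phiP] := planar_exact code_u code_f D_planar
  (A := fun=> 0) (B := B) n_gt0.
- by move=> v; rewrite big1.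
- by move=> y; rewrite /B edge_opp // oppF2.
- move=> y; under eq_bigr do rewrite subr0; rewrite big_split /=.
  have S z : \sum_(w | region w == region y) ((edge w == edge z)%:R : 'F_2) =
      (region z == region y)%:R + (region (opp z) == region y)%:R.
    rewrite big_mkcond -big_mkcondr /=.
    transitivity (\sum_(w | edge w == edge z) ((region w == region y)%:R : 'F_2)).
      rewrite big_mkcond [RHS]big_mkcond; apply: eq_bigr => w _.
      by case: (region w == _); case: (edge w == _).
    rewrite sum_edge //; have := edge_eq code_u z (edge z); rewrite eqxx => /esym.
    by case/orP => /eqP -> //; rewrite edge_opp // oppK // addrC.
  by rewrite !S r1 r2 addF2.
have phi_v y z : vertex y = vertex z -> phi y = phi z.
  by case/darts_at=> ->; rewrite ?(phiP _).1 ?addr0 //;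
     have := (phiP (cw z)).1; rewrite cwK addr0.
pose S v := phi (v, true, true).
have phiS y : phi y = S (vertex y) by apply: phi_v.
have SE l : S (next (code D) l).1 = S l.1 + (l == edge d)%:R + (l == edge x)%:R.
  by have := (phiP (l, true)).2; rewrite !phiS /B addrA.
have S_step l : l != edge d -> l != edge x -> S (next (code D) l).1 = S l.1.
  by move=> /negPf h1 /negPf h2; rewrite SE h1 h2 !addr0.
(* An edge is named by the letter that it leaves, so the arcs start at the letters that follow. *)
pose p := next (code D) (edge d); pose q := next (code D) (edge x).
have pq : p != q by rewrite (inj_eq (can_inj (prev_next code_u))).
have [i p1 p2 _ _ rotE] := rot_to_arc code_u (code_f p) (code_f q) pq.
have := cycle_next (p := rot i (code D)); rewrite rot_uniq => /(_ code_u).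
rewrite (eq_cycle (e' := frel (next (code D)))); last first.
  by move=> y z; rewrite /= next_rot.
rewrite rotE.
rewrite /= rcons_cat cat_path /= rcons_path => /and3P[path1 /eqP next1].
case/andP=> path2 /eqP next2.
have pathS (y : letter D) s : path [rel a b | next (code D) a == b] y s ->
    edge d \notin belast y s -> edge x \notin belast y s ->
    all (fun l => S l.1 == S y.1) (y :: s).
  elim: s y => [|z s IH] y /=; first by rewrite eqxx.
  case/andP => /eqP <- ps; rewrite !inE !negb_or => /andP[h1 h2] /andP[h3 h4].
  have := IH _ ps h2 h4; rewrite /= S_step; try by rewrite eq_sym.
  by rewrite eqxx.
have nxt_inj := can_inj (prev_next code_u).
have last1 : last p p1 = edge x by apply: nxt_inj.
have last2 : last q p2 = edge d by apply: nxt_inj.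
have : uniq (rot i (code D)) by rewrite rot_uniq.
rewrite rotE -cat_cons !lastI last1 last2 cat_uniq !rcons_uniq.
case/and3P=> /andP[x1 _] nhas /andP[d2 _].
have d1 : edge d \notin belast p p1.
  apply: contra nhas => h; apply/hasP; exists (edge d).
    by rewrite mem_rcons mem_head.
  by rewrite /= mem_rcons inE h orbT.
have x2 : edge x \notin belast q p2.
  apply: contra nhas => h; apply/hasP; exists (edge x).
    by rewrite mem_rcons inE h orbT.
  by rewrite /= mem_rcons mem_head.
have /allP S1 := pathS _ _ path1 d1 x1.
have /allP S2 := pathS _ _ path2 d2 x2.
have Spq : S p.1 != S q.1.
  have /S1 /eqP Sx : edge x \in p :: p1 by rewrite -last1 mem_last.
  rewrite /q SE Sx eq_sym eqxx (eq_sym (edge x)) (negPf dx) addr0.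
  by rewrite -subr_eq0 addrAC subrr add0r oner_eq0.
exists i, (p :: p1), (q :: p2); split=> // l l' /S1/eqP h /S2/eqP h'.
by apply: contra Spq => /eqP e; rewrite -h -h' e.
Qed.

Hypothesis irr : ~ splits D.

Lemma irr_edge d x :
  region d = region x -> region (opp d) = region (opp x) -> d = x.
Proof.
move=> r1 r2; case: (eqVneq (edge d) (edge x)) => [|dx]; last first.
  by case: irr; apply: shared_edges_split dx r1 r2.
by case/edge_inj => // e; have := region_opp_neq d; rewrite r1 e eqxx.
Qed.

End Irreducible.

End Irreducible.
Import Irreducible.

(** * Proper sets of crossings that mark every unstarred region they meet *)

Module TightSets.
Import GRing.Theory.

(** dim ker f >= |I| - |J| = |K| >= dim im g, so the inclusion of the kernel in the image is an
    equality. *)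
Lemma sub_kernel_image (F : fieldType) (I J K : finType)
    (f : I -> J -> F) (g : K -> I -> F) :
  (#|I| = #|J| + #|K|)%N ->
  (forall y : I -> F, (forall j, \sum_i y i * f i j = 0)%R ->
     exists psi : K -> F, forall i, y i = (\sum_k psi k * g k i)%R) ->
  forall (psi : K -> F) j, (\sum_i (\sum_k psi k * g k i) * f i j = 0)%R.
Proof.
move=> card_I ker_im psi j.
have le_fg : (kermx (fun_mx f) <= fun_mx g)%MS.
  apply/rV_subP => x /sub_kermxP; rewrite -[x]row_funK fun_rowM => /rowP e.
  have [i|psi' psiE] := ker_im (row_fun x).
    by have := e (enum_rank i); rewrite !mxE enum_rankK.
  apply/submxP; exists (fun_row psi'); rewrite fun_rowM.
  by apply/rowP => i; rewrite !mxE psiE.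
have le_gf : (fun_mx g <= kermx (fun_mx f))%MS.
  have := mxrank_leqif_sup le_fg; case=> le <-.
  rewrite eqn_leq le /= mxrank_ker (leq_trans (rank_leq_row _)) //.
  by rewrite leq_subRL ?rank_leq_row // [leqRHS]card_I leq_add2r rank_leq_col.
have /sub_kermxP : ((fun_row psi *m fun_mx g)%R <= kermx (fun_mx f))%MS.
  exact: submx_trans (submxMl _ _) le_gf.
rewrite !fun_rowM => /rowP /(_ (enum_rank j)); rewrite !mxE enum_rankK; exact.
Qed.

Section State.
Variable D : gauss_code.
Hypothesis code_u : uniq (code D).
Variables (Ri Rj : {set dart D}) (s : marking D).
Hypothesis state_s : is_state Ri Rj s.

Definition starred (d : dart D) := (region d == Ri) || (region d == Rj).

Lemma state_vertex v : vertex (s v) = v.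
Proof. exact: state_s.1. Qed.

Lemma state_card d :
  #|[set v | region (s v) == region d]| = if starred d then 0 else 1.
Proof.
rewrite -(state_s.2 _ (region_in_regions d)); congr #|pred_of_set _|.
by apply/setP => v; rewrite !inE eq_sym eq_region // inE.
Qed.

Lemma state_unstarred v : ~~ starred (s v).
Proof.
apply/negP => st; have := state_card (s v); rewrite st => /eqP.
by rewrite cards_eq0 => /eqP/setP/(_ v); rewrite !inE eqxx.
Qed.

Lemma state_inj v w : region (s v) = region (s w) -> v = w.
Proof.
move=> e; have := state_card (s w); rewrite (negPf (state_unstarred w)).
move/eqP/cards1P => [x /setP xP].
have := xP v; have := xP w; rewrite !inE e eqxx => /esym/eqP -> /esym/eqP ->.
by [].
Qed.

Lemma state_surj d : ~~ starred d -> exists v, region (s v) = region d.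
Proof.
move=> /negPf un; have := state_card d; rewrite un.
by move/eqP/cards1P => [v /setP/(_ v)]; rewrite !inE eqxx => /eqP; exists v.
Qed.

End State.

Section Tight.
Variable D : gauss_code.
Hypothesis code_u : uniq (code D).
Hypothesis code_f : forall l : letter D, l \in code D.
Hypothesis D_planar : planar D.
Hypothesis irr : ~ splits D.
Variables (Ri Rj : {set dart D}) (s : marking D).
Hypothesis adj : adjacent Ri Rj.
Hypothesis state_s : is_state Ri Rj s.
Variable X : {set crossing D}.
Hypothesis X_closed : forall d, vertex d \in X -> ~~ starred Ri Rj d ->
  exists2 x, x \in X & region (s x) = region d.
Variables x0 x1 : crossing D.
Hypothesis x0X : x0 \in X.
Hypothesis x1X : x1 \notin X.
Local Notation star := (starred Ri Rj).
Local Open Scope ring_scope.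

(* Work over F_2 and colour the regions black and white. By planarity, a vector
   on X whose sums over the black regions marked by X vanish is a combination of
   the white regions marked by X; comparing dimensions, all these combinations
   have vanishing black sums. A black and a white region sharing an edge that
   leaves X contradict this, as by irreducibility they share no other edge. *)
Lemma tight_contradiction : False.
Proof.
have [col [colf colo]] := checkerboard code_u code_f D_planar.
have col_region d x : region d = region x -> col d = col x.
  exact: (region_invariant code_u colf).
have col_ccw d : col (ccw d) = ~~ col d.
  by rewrite -(col_region _ _ (region_opp_ccw code_u d)) colo negbK.
have col_cw d : col (cw d) = ~~ col d by rewrite (col_region _ (opp d)) ?colo ?region_cw.
have [e [col_e star_e]] : exists e, col e = false /\ star e.
  have [_ [e [e1 e2]]] := adj; case: (boolP (col e)) => ce; last first.
    by exists e; rewrite (negPf ce) /starred e1 eqxx.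
  by exists (opp e); rewrite colo ce /starred e2 eqxx orbT.
(* The starred regions are adjacent, so one is black and the other white. *)
have star_col d x : star d -> star x -> col d = col x -> region d = region x.
  have [neR [e' [e1 e2]]] := adj.
  have cRi y : region y = Ri -> col y = col e' by move=> yR; apply: col_region; rewrite e1.
  have cRj y : region y = Rj -> col y = ~~ col e'.
    by move=> yR; rewrite -colo; apply: col_region; rewrite e2.
  rewrite /starred => /orP[]/eqP h /orP[]/eqP h' c; rewrite h h' //;
    move: c; rewrite ?(cRi _ h) ?(cRi _ h') ?(cRj _ h) ?(cRj _ h').
    by case: (col e').
  by case: (col e').
pose XX : finType := {x : crossing D | x \in X}.
pose Xb : finType := {x : crossing D | (x \in X) && col (s x)}.
pose Xw : finType := {x : crossing D | (x \in X) && ~~ col (s x)}.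
pose hat (y : XX -> 'F_2) v : 'F_2 := \sum_(i : XX) y i * (val i == v)%:R.
have hat_in y (i : XX) : hat y (val i) = y i.
  rewrite /hat (bigD1 i) //= eqxx mulr1 big1 ?addr0 // => j ji.
  by rewrite (inj_eq val_inj) (negPf ji) mulr0.
have hat_out y v : v \notin X -> hat y v = 0.
  move=> vX; rewrite /hat big1 // => i _; case: eqP => [iv|]; last by rewrite mulr0.
  by have := valP i; rewrite /= iv (negPf vX).
pose f (i : XX) (b : Xb) : 'F_2 :=
  \sum_(d | region d == region (s (val b))) (val i == vertex d)%:R.
pose g (w : Xw) (i : XX) : 'F_2 :=
  \sum_(d | vertex d == val i) (region d == region (s (val w)))%:R.
pose A y d : 'F_2 := if col d then hat y (vertex d) else 0.
(* Only the two opposite black corners at [v] contribute, with the same value. *)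
have Av y v : \sum_(d | vertex d == v) A y d = 0.
  rewrite -[v]/(vertex ((v, true, true) : dart D)) sum_vertex /A !col_ccw negbK.
  rewrite col_cw !vertex_ccw vertex_cw.
  by case: (col _); rewrite /= ?addr0 ?add0r ?addF2.
have AR y : (forall b, \sum_i y i * f i b = 0) ->
    forall x, \sum_(d | region d == region x) A y d = 0.
  move=> yker.
  have nb x : ~~ (col x && star x) -> \sum_(d | region d == region x) A y d = 0.
    rewrite negb_and; case: (boolP (col x)) => /= [cx ux|cx _]; last first.
      rewrite big1 // => d /eqP /col_region; rewrite /A => ->.
      by rewrite (negPf cx).
    transitivity (\sum_(d | region d == region x) hat y (vertex d)).
      by apply: eq_bigr => d /eqP /col_region; rewrite /A => ->; rewrite cx.
    have [b bx] := state_surj code_u state_s ux.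
    (* If the marker of the region is outside [X], then by [X_closed] no corner of the region is at
       a crossing of [X]. *)
    case: (boolP (b \in X)) => bX; last first.
      rewrite big1 // => d /eqP dx; apply: hat_out; apply: contra bX => dX.
      have [|x' x'X e'] := X_closed dX; first by rewrite /starred dx.
      by rewrite (state_inj code_u state_s (v := b) (w := x')) // e' dx bx.
    have bP : (b \in X) && col (s b) by rewrite bX (col_region _ x bx).
    rewrite -[RHS](yker (Sub b bP)) /hat exchange_big /=; apply: eq_bigr => i _.
    by rewrite /f mulr_sumr; apply: eq_bigl => d; rewrite /= bx.
  (* For the starred black region the sum vanishes because the total over all corners does. *)
  move=> x; case: (boolP (col x && star x)) => [/andP[cx sx]|/nb //].
  have tot : \sum_d A y d = 0.
    by rewrite (partition_big (@vertex D) xpredT) //= big1 // => v _; apply: Av.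
  move: tot; rewrite (bigID (fun d => region d == region x)) /=.
  rewrite [X in _ + X](partition_big (@region D) xpredT) //= [X in _ + X]big1 ?addr0 //.
  move=> r _; case: (pickP (fun d => (region d != region x) && (region d == r))) => [d|no].
    case/andP => dx /eqP dr; rewrite -[RHS](nb d).
      by apply: eq_bigl => d'; rewrite -dr; case: (region d' =P region d) => [->|_];
         rewrite ?dx ?andbF.
    by apply: contra dx => /andP[cd sd]; rewrite (star_col _ _ sd sx) ?cd ?cx.
  by rewrite big_pred0.
pose psih (psi : Xw -> 'F_2) d : 'F_2 :=
  \sum_w psi w * (region d == region (s (val w)))%:R.
have gE psi i : \sum_w psi w * g w i = \sum_(d | vertex d == val i) psih psi d.
  rewrite /psih exchange_big /=; apply: eq_bigr => w _.
  by rewrite /g mulr_sumr.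
have psih_black psi d : col d -> psih psi d = 0.
  move=> cd; rewrite /psih big1 // => w _; case: eqP => [/col_region|]; last by rewrite mulr0.
  by rewrite cd => cw; have := valP w; rewrite /= -cw andbF.
have psih_star psi d : star d -> psih psi d = 0.
  move=> sd; rewrite /psih big1 // => w _; case: eqP => [e'|]; last by rewrite mulr0.
  by have := state_unstarred code_u state_s (val w); rewrite /starred -e' -/(star d) sd.
have psih_at psi (w : Xw) d : region d = region (s (val w)) -> psih psi d = psi w.
  move=> e'; rewrite /psih (bigD1 w) //= e' eqxx mulr1 big1 ?addr0 // => w' ne.
  case: eqP => [/(state_inj code_u state_s) e''|]; last by rewrite mulr0.
  by case/eqP: ne; apply: val_inj; rewrite e''.
have whiteX d : vertex d \in X -> ~~ col d -> ~~ star d ->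
    exists w : Xw, region d = region (s (val w)).
  move=> dX cd sd; have [x xX xd] := X_closed dX sd.
  have xP : (x \in X) && ~~ col (s x) by rewrite xX (col_region _ d xd).
  by exists (Sub x xP).
have black_at v : exists2 b, col b & vertex b = v.
  case: (boolP (col (v, true, true))) => c; first by exists (v, true, true).
  by exists (ccw (v, true, true)); rewrite ?col_ccw ?c ?vertex_ccw.
have psi_sum psi b : col b ->
    \sum_(d | vertex d == vertex b) psih psi d = psih psi (ccw b) + psih psi (cw b).
  move=> cb; rewrite sum_vertex psih_black // add0r.
  by rewrite (psih_black psi (ccw (ccw b))) ?addr0 // !col_ccw negbK.
have card_XX : #|XX| = (#|Xb| + #|Xw|)%N.
  rewrite !card_sig -(cardID (fun x => col (s x)) (mem X)); congr (_ + _)%N.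
    by apply: eq_card => x; rewrite !inE andbC.
have n_gt0 := dart_crossing e.
have ker_im y : (forall b, \sum_i y i * f i b = 0) ->
    exists psi, forall i, y i = \sum_w psi w * g w i.
  move=> yker.
  have [| |phi phiP] := planar_exact code_u code_f D_planar
    (A := A y) (B := fun=> 0) n_gt0 (Av y).
  - by move=> d; rewrite oppr0.
  - by move=> x; rewrite sumrB big1 // AR // subr0.
  have phi_ccw d : phi (ccw d) = phi d + A y d by rewrite (phiP d).1.
  have phi_opp d : phi (opp d) = phi d by rewrite (phiP d).2 addr0.
  have phi_white d x : ~~ col d -> region d = region x -> phi d = phi x.
    move=> cd dx; have cx : ~~ col x by rewrite -(col_region _ _ dx).
    pose th d := if col d then 0 else phi d.
    have : th d = th x.
      apply: (region_invariant code_u) dx => {cd} {}d; rewrite /th colf.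
      case: (boolP (col d)) => // cd; rewrite -(phi_opp d).
      by have := phi_ccw (face_next d); rewrite /A colf (negPf cd) addr0 cwK.
    by rewrite /th (negPf cd) (negPf cx).
  (* [phi] is constant on each white region; subtracting its value on the starred white region makes
     that region contribute zero, as it does in [psih]. *)
  exists (fun w => phi (s (val w)) - phi e) => i; rewrite gE.
  have [b cb bi] := black_at (val i); rewrite -bi psi_sum //.
  have wh d : vertex d \in X -> ~~ col d ->
      psih (fun w => phi (s (val w)) - phi e) d = phi d - phi e.
    move=> dX cd; case: (boolP (star d)) => sd.
      by rewrite psih_star // (phi_white d e) ?subrr // (star_col d e) // col_e (negPf cd).
    by have [w dw] := whiteX _ dX cd sd; rewrite (psih_at _ w) // (phi_white d (s (val w))).
  have bX : vertex b \in X by rewrite bi (valP i).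
  rewrite !wh ?vertex_ccw ?vertex_cw ?col_ccw ?col_cw ?negbK ?cb //.
  have -> : phi (ccw b) = phi (cw b) + y i.
    rewrite phi_ccw /A cb bi hat_in; congr (_ + _).
    by rewrite -[in LHS](cwK b) phi_ccw /A col_cw cb addr0.
  move: (phi (cw b)) (phi e) (y i) => p q r.
  by case: (F2P p) => ->; case: (F2P q) => ->; case: (F2P r) => ->; apply: val_inj.
(* By connectedness some edge has exactly one end in [X]; [k] is its dart with the black region on
   the left. *)
have [k ck] : exists2 k, col k & (vertex k \in X) != (vertex (opp k) \in X).
  case: (pickP (fun d : dart D => (vertex d \in X) != (vertex (opp d) \in X))) => [d dP|no].
    case: (boolP (col d)) => cd; first by exists d.
    by exists (opp d); rewrite ?colo ?cd // oppK // eq_sym.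
  have inv1 d : (vertex (ccw d) \in X) = (vertex d \in X) by rewrite vertex_ccw.
  have inv2 d : (vertex (opp d) \in X) = (vertex d \in X).
    by have /negbFE/eqP := no d.
  have := dart_connected code_u code_f inv1 inv2 (x0, true, true) (x1, true, true).
  by rewrite /vertex /= x0X (negPf x1X).
move=> kX.
have [psi psiP] : exists psi : Xw -> 'F_2, forall b, col b -> vertex b \in X ->
    psih psi (ccw b) + psih psi (cw b) =
    (region (ccw b) == region (opp k))%:R + (region (cw b) == region (opp k))%:R.
  have cok : ~~ col (opp k) by rewrite colo ck.
  case: (boolP (star (opp k))) => sk.
    (* A crossing has two white corners, so modulo 2 the indicator of the starred white region may
       be replaced by that of all the other white regions. *)
    exists (fun=> 1) => b cb bX.
    have wh d : vertex d \in X -> ~~ col d ->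
        psih (fun=> 1) d = (region d == region (opp k))%:R + 1.
      move=> dX cd; case: (boolP (star d)) => sd.
        rewrite psih_star // (star_col _ _ sd sk) ?eqxx ?addF2 //.
        by rewrite (negPf cd) (negPf cok).
      have [w dw] := whiteX _ dX cd sd; rewrite (psih_at _ w) //.
      case: eqP => [e'|]; last by rewrite add0r.
      by move: sd; rewrite /starred e' -/(star (opp k)) sk.
    rewrite !wh ?vertex_ccw ?vertex_cw ?col_ccw ?col_cw ?negbK ?cb //.
    by rewrite addrACA addF2 addr0.
  have [w kw] : exists w : Xw, region (opp k) = region (s (val w)).
    case: (boolP (vertex (opp k) \in X)) => okX; first exact: whiteX.
    rewrite -region_cw //; apply: whiteX; rewrite ?vertex_cw ?col_cw ?ck //.
      by move: kX; rewrite (negPf okX); case: (_ \in X).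
    by rewrite /starred region_cw.
  exists (fun w' => (w' == w)%:R) => b cb bX.
  have wh d : psih (fun w' => (w' == w)%:R) d = (region d == region (opp k))%:R.
    rewrite /psih (bigD1 w) //= eqxx mul1r big1 ?addr0 ?kw // => w' /negPf ->.
    by rewrite mul0r.
  by rewrite !wh.
have := AR _ (sub_kernel_image card_XX ker_im psi) k.
(* The sum around the black region of [k] counts its corners at crossings of [X] next to the white
   region across [k]. By irreducibility these are the corners at the two ends of the edge of [k],
   and exactly one end is in [X], so the sum is 1. *)
rewrite (eq_bigr (fun d => (vertex d \in X)%:R *
   (region (ccw d) == region (opp k))%:R + (vertex d \in X)%:R *
   (region (cw d) == region (opp k))%:R)); last first.
  move=> d /eqP dk; have cd : col d by rewrite (col_region _ _ dk).
  rewrite /A cd; case: (boolP (vertex d \in X)) => dX; last first.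
    by rewrite hat_out // !mul0r addr0.
  rewrite !mul1r -psiP // -psi_sum //.
  by rewrite -[vertex d]/(val (Sub (vertex d) dX : XX)) hat_in gE.
rewrite big_split /= (bigD1 (face_next k)) /=; last by rewrite region_face.
rewrite [X in _ + X + _]big1 => [|d /andP[/eqP dk dn]]; last first.
  case: eqP => [e'|]; last by rewrite mulr0.
  case/eqP: dn; rewrite -(irr_edge code_u code_f D_planar irr (d := opp (ccw d)) (x := k)).
  - by rewrite face_next_opp_ccw.
  - by rewrite region_opp_ccw.
  by rewrite oppK.
rewrite (bigD1 k) //= [X in _ + (_ + X)]big1 => [|d /andP[/eqP dk dn]]; last first.
  case: eqP => [e'|]; last by rewrite mulr0.
  by case/eqP: dn; apply: (irr_edge code_u code_f D_planar irr) => //; rewrite -region_cw.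
rewrite cwK region_cw // !eqxx vertex_face_next !mulr1 !addr0.
by move: kX; case: (vertex k \in X); case: (vertex (opp k) \in X).
Qed.

End Tight.

End TightSets.
Import TightSets.

(** * Flows that avoid the markers of a state *)

Module Flows.
Import GRing.Theory Num.Theory Order.TTheory.

Section Flow.
Variable D : gauss_code.
Hypothesis code_u : uniq (code D).
Hypothesis code_f : forall l : letter D, l \in code D.
Hypothesis D_planar : planar D.
Hypothesis irr : ~ splits D.
Variables (Ri Rj : {set dart D}) (s : marking D).
Hypothesis adj : adjacent Ri Rj.
Hypothesis state_s : is_state Ri Rj s.
Local Notation star := (starred Ri Rj).

(* By planarity c integrates to a function on the crossings; its sublevel sets
   are excluded by [tight_contradiction] unless it is constant. *)
Lemma flow_unstarred (c : dart D -> nat) :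
  (forall v, c (s v) = 0) ->
  (forall d, c d + c (opp d) = c (cw d) + c (cw (opp d))) ->
  forall d, ~~ star d -> c d = 0.
Proof.
move=> c_s c_flow d0 ud0; have n_gt0 := dart_crossing d0.
pose cr d : rat := ((c d)%:R)%R.
(* The flow equation says that [B] is antisymmetric; around a region it telescopes. *)
pose B d := (cr (face_next d) - cr d)%R.
have [| | |phi phiP] := planar_exact code_u code_f D_planar
  (A := fun=> 0%R) (B := B) n_gt0.
- by move=> v; rewrite big1.
- move=> d; rewrite /B opprB /face_next oppK //.
  apply/eqP; rewrite subr_eq addrAC eq_sym subr_eq -!natrD.
  by rewrite (c_flow d) addnC.
- move=> x; under eq_bigr do rewrite subr0; rewrite sumrB.
  rewrite [X in (_ - X)%R](reindex_inj (face_next_inj code_u)) /=.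
  by under [X in (_ - X)%R]eq_bigl do rewrite region_face //; rewrite subrr.
have phi_ccw d : phi (ccw d) = phi d by rewrite (phiP d).1 addr0.
have phi_v d x : vertex d = vertex x -> phi d = phi x.
  case/darts_at=> ->; rewrite ?phi_ccw //.
  by have := phi_ccw (cw x); rewrite cwK.
have phi_R d x : region d = region x -> (phi d - cr d = phi x - cr x)%R.
  apply: (region_invariant code_u (phi := fun d => (phi d - cr d)%R)) => {}d.
  have -> : phi (face_next d) = phi (opp d) by apply: phi_v; rewrite vertex_face_next.
  by rewrite (phiP d).2 /B; ring.
pose I v := phi (v, true, true).
have phiI d : phi d = I (vertex d) by apply: phi_v.
have cr_s v : cr (s v) = 0%R by rewrite /cr c_s.
(* Within a region [I - c] is constant and [c] vanishes at the marker, so [I] is least at the marked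
   crossing: a sublevel set of [I] marks the unstarred regions that it meets. *)
have I_le d v : region (s v) = region d -> (I (vertex d) = I v + cr d)%R.
  move/phi_R; rewrite cr_s subr0 !phiI (state_vertex state_s) => ->.
  by rewrite subrK.
have Iconst v w : (I v <= I w)%R.
  pose X := [set x | (I x <= I w)%R].
  have XP d : vertex d \in X -> ~~ star d ->
      exists2 x, x \in X & region (s x) = region d.
    rewrite inE => le un; have [x xd] := state_surj code_u state_s un.
    exists x => //; rewrite inE; apply: le_trans le.
    by rewrite (I_le _ _ xd) lerDl ler0n.
  have wX : w \in X by rewrite inE.
  case: (boolP (v \in X)) => [|vX]; first by rewrite inE.
  by case: (tight_contradiction code_u code_f D_planar irr adj state_s XP wX vX).
have [v vd] := state_surj code_u state_s ud0.
have := I_le _ _ vd; have -> : I (vertex d0) = I v by apply: le_anti; rewrite !Iconst.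
move/eqP; rewrite -subr_eq0 opprD addNKr oppr_eq0 /cr pnatr_eq0 => /eqP.
by [].
Qed.

(** The turn from [d] to [cw d] sweeps the corner [cw d], which must carry no marker of [s]. *)
Definition unmarked_step : rel (dart D) := fun d x =>
  (x == opp d) || (x == cw d) && (s (vertex x) != x).

(** Counts the turns of the walk that end in [k]; a step to [opp d] is read as crossing the edge
    even when it is also a turn. *)
Fixpoint landings (d : dart D) (p : seq (dart D)) (k : dart D) : nat :=
  if p is x :: p' then ((x != opp d) && (x == k)) + landings x p' k else 0.

Lemma landings_marked d p v : path unmarked_step d p -> landings d p (s v) = 0.
Proof.
elim: p d => //= x p IH d /andP[st /IH ->]; rewrite addn0.
move: st; rewrite /unmarked_step; case: (eqVneq x (opp d)) => //= _ /andP[_].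
by case: (x =P s v) => // ->; rewrite (state_vertex state_s) eqxx.
Qed.

Definition on_edge (e d : dart D) : nat := (d == e) || (d == opp e).

Lemma on_edgeE e d : on_edge e d = (d == e) + (d == opp e).
Proof.
rewrite /on_edge; case: (d =P e) => [->|_] //=.
by rewrite eq_sym (negPf (opp_neq e)).
Qed.

Lemma on_edge_opp e d : on_edge e (opp d) = on_edge e d.
Proof.
rewrite /on_edge orbC (inj_eq (opp_inj code_u)); congr (nat_of_bool (_ || _)).
by rewrite -(inj_eq (opp_inj code_u)) oppK.
Qed.

(** A walk enters an edge by landing on one of its halves and leaves it by turning to [cw e] or
    [cw (opp e)]. The terms [on_edge] account for the two ends of the walk, so the landings of a
    closed walk satisfy the equation of [flow_unstarred]. *)
Lemma landings_flow d p e : path unmarked_step d p ->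
  landings d p e + landings d p (opp e) + on_edge e d =
  landings d p (cw e) + landings d p (cw (opp e)) + on_edge e (last d p).
Proof.
elim: p d => //= x p IH d /andP[st /IH].
have aux i1 l1 i2 l2 a b o1 m1 o2 m2 z : a + (i1 + i2) = b + (o1 + o2) ->
    l1 + l2 + b = m1 + m2 + z -> i1 + l1 + (i2 + l2) + a = o1 + m1 + (o2 + m2) + z.
  by lia.
apply: aux.
move: st; rewrite /unmarked_step; case: (eqVneq x (opp d)) => [-> _|ne] /=.
  by rewrite on_edge_opp.
case/andP => /eqP -> _; rewrite !(inj_eq (can_inj (@cwK D))) !on_edgeE.
by rewrite addnC.
Qed.
End Flow.

End Flows.
Import Flows.

(** * Positivity of the height away from the starred regions *)

Module Heights.
Import GRing.Theory Num.Theory Order.TTheory.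

Section Height.
Variable D : gauss_code.
Hypothesis code_u : uniq (code D).
Hypothesis code_f : forall l : letter D, l \in code D.
Hypothesis D_planar : planar D.
Hypothesis irr : ~ splits D.
Variables (Ri Rj : {set dart D}) (s t : marking D).
Hypothesis adj : adjacent Ri Rj.
Hypothesis clocked_s : clocked Ri Rj s.
Hypothesis clocked_t : counterclocked Ri Rj t.
Local Notation star := (starred Ri Rj).
Local Notation step := (unmarked_step s).
Let state_s := clocked_s.1.

(** The landings of the closed walk are a flow vanishing at the markers, hence on all unstarred
    corners, whereas the walk lands on [cw d]. *)
Lemma no_unstarred_cycle d : ~~ star (cw d) -> s (vertex d) != cw d ->
  connect step (cw d) d -> False.
Proof.
move=> un um /connectP[p pp lp].
(* Otherwise the corner [cw d] is a whole region; being unstarred, it has to be marked. *)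
have neq : cw d != opp d.
  apply/eqP => e; have fx : face_next (opp d) = opp d by rewrite /face_next oppK.
  have [v] := state_surj code_u state_s un; rewrite e => /esym/eqP.
  rewrite eq_region // mem_region => /iter_findex.
  have -> n : iter n (@face_next D) (opp d) = opp d by elim: n => //= n ->.
  move=> sv; case/eqP: um; rewrite e sv.
  by rewrite -(vertex_cw d) e sv (state_vertex state_s).
have pp' : path step d (cw d :: p).
  by rewrite /= pp andbT /unmarked_step eqxx vertex_cw um orbT.
have := flow_unstarred code_u code_f D_planar irr adj state_s
  (c := landings d (cw d :: p)) _ _ un.
have fl e : landings d (cw d :: p) e + landings d (cw d :: p) (opp e) =
    landings d (cw d :: p) (cw e) + landings d (cw d :: p) (cw (opp e)).
  have := landings_flow code_u e pp'; rewrite [last d _]/= -lp.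
  by move/eqP; rewrite eqn_add2r => /eqP.
move=> /(_ (fun v => landings_marked state_s v pp') fl).
by rewrite /= neq eqxx.
Qed.

Variable h : dart D -> int.
Hypothesis h_opp : forall d, h (opp d) = h d.
Hypothesis h_ccw : forall d,
  (h (ccw d) = h d + (t (vertex d) == d)%:Z - (s (vertex d) == d)%:Z)%R.
Hypothesis h_star : forall d, star d -> h d = 0%R.

Let border d := star d || star (opp d).

Let step_opp d : connect step d (opp d).
Proof. by apply: connect1; rewrite /unmarked_step eqxx. Qed.

Let step_cw d : s (vertex d) != cw d -> connect step d (cw d).
Proof. by move=> um; apply: connect1; rewrite /unmarked_step eqxx vertex_cw um orbT. Qed.

(** The corners of a starred region are unmarked, so a walk can follow its boundary all around. *)
Let star_region d x : star d -> region d = region x -> connect step d x.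
Proof.
move=> sd /eqP; rewrite eq_region // mem_region => /iter_findex <-.
elim: (findex _ _ _) => //= n /connect_trans; apply.
set y := iter n _ d.
have sy : star (face_next y).
  rewrite /starred region_face // {}/y; elim: n => //= n.
  by rewrite /starred region_face.
apply: connect_trans (step_opp y) (step_cw _).
apply/eqP => e; have := state_unstarred code_u state_s (vertex (opp y)).
by rewrite e sy.
Qed.

(** The starred regions share an edge, where walks pass from the boundary of one to that of the
    other. *)
Let border_connect d x : border d -> border x -> connect step d x.
Proof.
have [_ [e [e1 e2]]] := adj.
have se : star e by rewrite /starred e1 eqxx.
have soe : star (opp e) by rewrite /starred e2 eqxx orbT.
have to_e y : star y -> connect step y e.
  move=> sy; case/orP: (sy) => /eqP yR; first by apply: star_region; rewrite // e1.
  apply: connect_trans (star_region (x := opp e) sy _) _; first by rewrite e2.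
  by rewrite -[X in connect _ _ X](oppK code_u).
have from_e y : star y -> connect step e y.
  move=> sy; case/orP: (sy) => /eqP yR; first by apply: star_region; rewrite // e1.
  by apply: connect_trans (step_opp e) (star_region soe _); rewrite e2.
move=> bd bx; apply: (connect_trans (y := e)).
  case/orP: bd => sd; first exact: to_e.
  exact: connect_trans (step_opp d) (to_e _ sd).
case/orP: bx => sx; first exact: from_e.
by apply: connect_trans (from_e _ sx) _; rewrite -[X in connect _ _ X](oppK code_u).
Qed.

Let region_neq (d : dart D) : region d != region (opp d).
Proof. exact: region_opp_neq. Qed.

(** Markers in both corners would allow a counterclockwise transposition across the edge of [d]. The
    next fact is the clockwise analogue for [t]. *)
Let clocked_edge (d : dart D) :
  ~~ ((s (vertex d) == cw d) && (s (vertex (opp d)) == cw (opp d))).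
Proof.
apply/negP => /andP[/eqP s1 /eqP s2].
have /negP := clocked_s.2 (turn_at (@ccw D) (vertex d) (vertex (opp d)) s); apply.
apply/existsP; exists (vertex d); apply/existsP; exists (vertex (opp d)).
rewrite s1 s2 !cwK !region_cw // oppK // (eq_sym (region (opp d))) region_neq !eqxx !andbT.
apply/eqP => e; move: s2; rewrite -e s1 => /(can_inj (@cwK D)) /eqP.
by rewrite eq_sym (negPf (opp_neq d)).
Qed.

Let clocked_edge' (d : dart D) : ~~ ((t (vertex d) == d) && (t (vertex (opp d)) == opp d)).
Proof.
apply/negP => /andP[/eqP s1 /eqP s2].
have /negP := clocked_t.2 (turn_at (@cw D) (vertex d) (vertex (opp d)) t); apply.
apply/existsP; exists (vertex d); apply/existsP; exists (vertex (opp d)).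
rewrite s1 s2 !region_cw // oppK // region_neq !eqxx !andbT.
apply/eqP => e; move: s2; rewrite -e s1 => /eqP.
by rewrite eq_sym (negPf (opp_neq d)).
Qed.

(* Otherwise take an edge where h is minimal. Steps that avoid the markers stay at
   the minimum and lead to the starred regions, both forwards (s is clocked) and
   backwards (t is counterclocked), so they close up to a cycle, which the flow
   lemma excludes. *)
Lemma height_interior d : ~~ star d -> ~~ star (opp d) -> (0 < h d)%R.
Proof.
move=> d1 d2; rewrite ltNge; apply/negP => hd.
have [d0 [u1 u2 hmin]] : exists d0, [/\ ~~ star d0, ~~ star (opp d0) &
    forall x, (h d0 <= h x)%R].
  have [x _ xmin] := Order.TotalTheory.arg_minP (P := xpredT) (i0 := d) h isT.
  (* A negative minimum is not reached beside a star, where [h] is 0; a nonnegative one is reached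
     at [d] itself. *)
  case: (ltP (h x) 0%R) => hx; last first.
    exists d; split=> // y; apply: le_trans hd (le_trans hx _); exact: xmin.
  exists x; split; [| |by move=> y; apply: xmin].
    by apply: contraL hx => /h_star ->.
  by apply: contraL hx => /h_star; rewrite h_opp => ->.
pose M x := h x = h d0.
(* At a minimum [h] cannot drop at the next turn, so a marker of [s] in that corner is also one of
   [t]. Turning the other way exchanges the roles of [s] and [t]. *)
have Ms x : M x -> s (vertex x) == x -> t (vertex x) == x.
  move=> Mx; have := hmin (ccw x); rewrite h_ccw Mx.
  by case: (s _ == x); case: (t _ == x) => //; lia.
have Mt x : M x -> t (vertex x) == cw x -> s (vertex x) == cw x.
  move=> Mx; have := hmin (cw x); have := h_ccw (cw x); rewrite cwK Mx vertex_cw.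
  by case: (s _ == cw x); case: (t _ == cw x) => //; lia.
have fstep x : M x -> exists y, [/\ y = x \/ y = opp x, s (vertex y) != cw y & M (cw y)].
  move=> Mx; have Mo : M (opp x) by rewrite /M h_opp.
  have MC y : M y -> s (vertex y) != cw y -> M (cw y).
    move=> My um; have tm : t (vertex y) != cw y by apply: contra um; apply: Mt.
    have := h_ccw (cw y); rewrite cwK vertex_cw (negPf um) (negPf tm) /M -My.
    by rewrite subr0 addr0.
  have := clocked_edge x; rewrite negb_and => /orP[um|um].
    by exists x; split; [left| |exact: MC].
  by exists (opp x); split; [right| |exact: MC].
have bstep x : M x -> exists y, [/\ y = x \/ y = opp x, s (vertex y) != y & M (ccw y)].
  move=> Mx; have Mo : M (opp x) by rewrite /M h_opp.
  have MC y : M y -> t (vertex y) != y -> s (vertex y) != y /\ M (ccw y).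
    move=> My tm; have um : s (vertex y) != y by apply: contra tm; apply: Ms.
    by split=> //; rewrite /M h_ccw (negPf um) (negPf tm) subr0 addr0.
  have := clocked_edge' x; rewrite negb_and => /orP[tm|tm].
    by have [] := MC x Mx tm; exists x; split=> //; left.
  by have [] := MC _ Mo tm; exists (opp x); split=> //; right.
(* Each turn strictly shrinks the set of darts that can be reached, since a way back to [x] would
   close a cycle through an unstarred corner. *)
have fwd x : M x -> exists2 e, border e & connect step x e.
  have [n] := ubnP #|[set y | connect step x y]|.
  elim: n x => // n IH x; rewrite ltnS => le Mx.
  case: (boolP (border x)) => bx; first by exists x.
  have [y [yx um My]] := fstep x Mx.
  have xy : connect step x y by case: yx => ->.
  have yx' : connect step y x by case: yx => -> //; rewrite -[X in connect _ _ X](oppK code_u).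
  have uy : ~~ star (cw y).
    rewrite /starred region_cw // -/(star (opp y)); move: bx; rewrite /border negb_or.
    by case: yx => ->; rewrite ?oppK // => /andP[].
  have nb : ~~ connect step (cw y) x.
    by apply/negP => c; apply: (no_unstarred_cycle uy um); apply: connect_trans c xy.
  have [|e be ce] := IH (cw y) _ My.
    apply: leq_trans le; apply: proper_card; apply/properP; split.
      apply/subsetP => z; rewrite !inE => c.
      exact: connect_trans xy (connect_trans (step_cw um) c).
    by exists x; rewrite !inE ?connect0.
  exists e => //; exact: connect_trans xy (connect_trans (step_cw um) ce).
have bwd x : M x -> exists2 e, border e & connect step e x.
  have [n] := ubnP #|[set y | connect step y x]|.
  elim: n x => // n IH x; rewrite ltnS => le Mx.
  case: (boolP (border x)) => bx; first by exists x.
  have [y [yx um My]] := bstep x Mx.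
  have xy : connect step x y by case: yx => ->.
  have yx' : connect step y x by case: yx => -> //; rewrite -[X in connect _ _ X](oppK code_u).
  have um' : s (vertex (ccw y)) != cw (ccw y) by rewrite vertex_ccw ccwK.
  have cy : connect step (ccw y) y by have := step_cw um'; rewrite ccwK.
  have uy : ~~ star (cw (ccw y)).
    rewrite ccwK; move: bx; rewrite /border negb_or.
    by case: yx => -> /andP[].
  have nb : ~~ connect step x (ccw y).
    apply/negP => c; apply: (no_unstarred_cycle uy um'); rewrite ccwK.
    exact: connect_trans yx' c.
  have [|e be ce] := IH (ccw y) _ My.
    apply: leq_trans le; apply: proper_card; apply/properP; split.
      apply/subsetP => z; rewrite !inE => c.
      exact: connect_trans c (connect_trans cy yx').
    by exists x; rewrite !inE ?connect0.
  exists e => //; exact: connect_trans ce (connect_trans cy yx').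
have [y [yx um My]] := fstep d0 erefl.
have uy : ~~ star (cw y).
  by rewrite /starred region_cw // -/(star (opp y)); case: yx => ->; rewrite ?oppK.
apply: (no_unstarred_cycle uy um).
have [e be ce] := fwd _ My; have [e' be' ce'] := bwd d0 erefl.
apply: connect_trans ce (connect_trans (border_connect be be') _).
by apply: connect_trans ce' _; case: yx => ->.
Qed.

End Height.

End Heights.
Import Heights.

(** * The bound for irreducible diagrams *)

Module IrreducibleBound.
Import GRing.Theory Num.Theory Order.TTheory.

(** [k] names the components of the graph with edges [E], and each edge lowers their number by at
    most one. *)
Lemma merge_pairs (V : finType) (E : seq (V * V)) :
  exists k : V -> V, (forall v w, (v, w) \in E -> k v = k w) /\
    #|V| <= #|[set k v | v : V]| + size E.
Proof.
elim: E => [|[v w] E [k [kE card_k]]].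
  exists id; split=> //; rewrite addn0 -cardsT.
  by apply/subset_leq_card/subsetP => v _; apply: (imset_f id).
exists (fun u => if k u == k w then k v else k u); split=> [v' w'|].
  by rewrite inE => /orP[/eqP[-> ->]|/kE -> //]; rewrite eqxx; case: eqP => // ->.
apply: leq_trans card_k _; rewrite /= addnS -addSn leq_add2r.
rewrite [X in X <= _](cardsD1 (k w)) -addn1 addnC leq_add ?leq_b1 //.
apply/subset_leq_card/subsetP => u; rewrite !inE => /andP[ne /imsetP[z _ uz]].
by apply/imsetP; exists z; rewrite // -uz (negPf ne).
Qed.

Section Transpositions.
Variable D : gauss_code.
Hypothesis code_u : uniq (code D).
Variables (Ri Rj : {set dart D}).
Implicit Types s t : marking D.

(** The markers at [v] and [w] exchange their regions, so the permutation exchanging [v] and [w]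
    carries the old markers of a region to the new ones. *)
Lemma transposition_state (turn : dart D -> dart D) s t :
  (forall d, vertex (turn d) = vertex d) ->
  is_state Ri Rj s -> transposition turn s t -> is_state Ri Rj t.
Proof.
move=> vt [sv sR] /existsP[v /existsP[w /and5P[vw ne r1 r2 /eqP ->]]].
split=> [u|R RD].
  by rewrite ffunE; case: ifP => _; rewrite ?vt sv.
rewrite -(sR R RD) -(card_preimset _ (@perm_inj _ (tperm v w))).
have /imsetP[d _ ->] := RD; congr #|pred_of_set _|; apply/setP => u; rewrite !inE.
rewrite -!mem_region -!eq_region // ffunE.
case: tpermP => [->|->|/eqP/negPf -> /eqP/negPf ->] //=.
  by rewrite eqxx orbT (eqP r2).
by rewrite eqxx (eqP r1).
Qed.

Lemma ccw_cw_transposition s t :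
  transposition (@ccw D) s t -> transposition (@cw D) t s.
Proof.
case/existsP=> v /existsP[w /and5P[vw ne r1 r2 /eqP ->]].
apply/existsP; exists v; apply/existsP; exists w; rewrite vw !ffunE !eqxx orbT /= !ccwK.
rewrite (eqP r1) (eqP r2) eq_sym ne !eqxx /=; apply/eqP/ffunP => u; rewrite !ffunE.
by case: (_ || _); rewrite ?ccwK.
Qed.

Hypothesis code_f : forall l : letter D, l \in code D.
Hypothesis D_planar : planar D.
Hypothesis irr : ~ splits D.

(** By irreducibility the two regions share one edge only, so both markers move across the same
    edge, that of [x]. The equation records that they leave [x] and [opp x] for [cw x] and
    [cw (opp x)], in the form of an increment of the indicator of this edge under [ccw]. *)
Lemma clockwise_edge s t : is_state Ri Rj s -> clockwise s t ->
  exists x : dart D, [/\ ~~ starred Ri Rj x, ~~ starred Ri Rj (opp x) &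
    forall d, ((t (vertex d) == d) + ((d == x) + (d == opp x)) =
               (s (vertex d) == d) + ((ccw d == x) + (ccw d == opp x)))%N].
Proof.
move=> st /existsP[v /existsP[w /and5P[vw ne /eqP r1 /eqP r2 /eqP ->]]].
have sw : s w = opp (s v).
  rewrite [s v](irr_edge code_u code_f D_planar irr (x := opp (s w))) ?oppK //.
    by rewrite -region_cw.
  by rewrite -region_cw.
exists (s v); rewrite -{1}sw !(state_unstarred code_u st); split=> // d.
rewrite ffunE -sw.
have sE u : (s (vertex d) == d) = (d == s (vertex d)) by rewrite eq_sym.
have ccwE y : (ccw d == y) = (d == cw y) by rewrite (can2_eq (@ccwK D) (@cwK D)).
rewrite !ccwE.
have vtx u y : vertex y = u -> (d == y) = (vertex d == u) && (d == y).
  by move=> <-; case: eqP => [->|]; rewrite ?eqxx ?andbF.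
rewrite (vtx v (s v)) ?(state_vertex st) // (vtx w (s w)) ?(state_vertex st) //.
rewrite (vtx v (cw (s v))) ?vertex_cw ?(state_vertex st) //.
rewrite (vtx w (cw (s w))) ?vertex_cw ?(state_vertex st) //.
case: (vertex d =P v) => [->|_] /=.
  by rewrite (negPf vw) /= !addn0 (eq_sym (s v) d) (eq_sym (cw _) d) addnC.
case: (vertex d =P w) => [->|_] //=.
by rewrite (eq_sym (s w) d) (eq_sym (cw _) d) addnC.
Qed.

(* h d counts the transpositions of the path across the edge of d, with signs; E
   lists the pairs of crossings that they involve. *)
Lemma path_height s q : is_state Ri Rj s ->
  path (fun x y => clockwise x y || counterclockwise x y) s q ->
  exists (E : seq (crossing D * crossing D)) (h : dart D -> int),
  [/\ size E = size q, forall d, h (opp d) = h d,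
      forall d, (h (ccw d) = h d + (last s q (vertex d) == d)%:Z
                             - (s (vertex d) == d)%:Z)%R,
      forall d, starred Ri Rj d -> h d = 0%R &
      forall d, h d <> 0%R ->
        (vertex d, vertex (opp d)) \in E \/ (vertex (opp d), vertex d) \in E].
Proof.
elim: q s => [|t q IH] s st /=.
  move=> _; exists [::], (fun=> 0%R); split=> // d; by rewrite addrK.
case/andP=> stt pq.
have [sgn [x [x1 x2 xE]]] : exists (sgn : bool) (x : dart D),
  [/\ ~~ starred Ri Rj x, ~~ starred Ri Rj (opp x) &
    forall d, ((if sgn then t else s) (vertex d) == d) + ((d == x) + (d == opp x)) =
      ((if sgn then s else t) (vertex d) == d) + ((ccw d == x) + (ccw d == opp x))].
  case/orP: (stt) => tr.
    by have [x xP] := clockwise_edge st tr; exists true, x.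
  have tt := transposition_state (@vertex_ccw D) st tr.
  by have [x xP] := clockwise_edge tt (ccw_cw_transposition tr); exists false, x.
have tt : is_state Ri Rj t.
  by case/orP: stt => tr; apply: transposition_state st tr => d; rewrite ?vertex_cw ?vertex_ccw.
have [E [h [sE h_opp h_ccw h_star hE]]] := IH t tt pq.
pose g d : int := Posz ((d == x) + (d == opp x)).
have g_opp d : g (opp d) = g d.
  rewrite /g addnC (inj_eq (opp_inj code_u)); congr (Posz (_ + _)).
  by rewrite -(inj_eq (opp_inj code_u)) oppK.
have g_star d : starred Ri Rj d -> g d = 0%R.
  move=> sd; rewrite /g; case: eqP => [e|_]; first by rewrite -e sd in x1.
  by case: eqP => [e|_] //; rewrite -e sd in x2.
exists ((vertex x, vertex (opp x)) :: E), (fun d => if sgn then h d + g d else h d - g d)%R.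
split=> [|d|d|d sd|d].
- by rewrite /= sE.
- by rewrite h_opp g_opp.
- rewrite h_ccw.
  have aux1 (a b c e H L : int) :
      (a + b = c + e -> H + L - a + e = H + b + L - c)%R.
    by move/(canRL (addrK _)) => ->; ring.
  have aux2 (a b c e H L : int) :
      (c + b = a + e -> H + L - a - e = H - b + L - c)%R.
    by move/(canRL (addrK _)) => ->; ring.
  case: (sgn) xE => /(_ d) /(congr1 Posz) xd; [apply: aux1 | apply: aux2]; exact: xd.
- by rewrite h_star // g_star //; case: (sgn).
rewrite !inE; case: (h d =P 0%R) => [->|/hE[] -> _]; rewrite ?orbT; auto.
have [->|] := eqVneq d x; first by rewrite eqxx; auto.
have [->|] := eqVneq d (opp x); first by rewrite oppK // eqxx; auto.
by rewrite /g => /negPf -> /negPf ->; case: (sgn).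
Qed.

Hypothesis adj : adjacent Ri Rj.

(** Once around a region, a value that changes has to change back. *)
Lemma second_change (X : eqType) (K : dart D -> X) (d : dart D) :
  K d != K (face_next d) ->
  exists y, [/\ y != d, region y = region d & K y != K (face_next y)].
Proof.
move=> dK; pose f := @face_next D.
case: (pickP (fun y => [&& y != d, region y == region d & K y != K (f y)])) => [y|no].
  by case/and3P=> ? /eqP ? ?; exists y.
have ex : exists n, iter n f (f d) == d.
  exists (findex f (f d) d); apply/eqP/iter_findex.
  by rewrite (fconnect_sym (face_next_inj code_u)) fconnect1.
have [n /eqP nd nmin] := ex_minnP ex.
have reg i : region (iter i f (f d)) = region d.
  by elim: i => [|i IH] /=; rewrite region_face.
have cst i : i <= n -> K (iter i f (f d)) = K (f d).
  elim: i => // i IH ltin; rewrite -(IH (ltnW ltin)) /=; apply/eqP.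
  have := no (iter i f (f d)); rewrite reg eqxx /=.
  have -> : iter i f (f d) != d by apply/negP => /nmin; rewrite leqNgt ltin.
  by rewrite eq_sym => /negbFE.
by have := cst n (leqnn n); rewrite nd => e; rewrite e eqxx in dK.
Qed.

(* An edge along which k changes borders a star; going around its other side, a
   second such edge borders the same star, against irreducibility. *)
Lemma interior_connected (X : eqType) (k : crossing D -> X) :
  (forall d, ~~ starred Ri Rj d -> ~~ starred Ri Rj (opp d) ->
     k (vertex d) = k (vertex (opp d))) ->
  forall v w, k v = k w.
Proof.
move=> kint.
have [col [colf colo]] := checkerboard code_u code_f D_planar.
have col_region d x : region d = region x -> col d = col x.
  exact: (region_invariant code_u colf).
have [neR [e [e1 e2]]] := adj.
have eirr := irr_edge code_u code_f D_planar irr.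
pose K d := k (vertex d).
have noB d : starred Ri Rj d -> ~~ starred Ri Rj (opp d) -> K d = K (opp d).
  move=> sd sod; apply/eqP; apply: contraNT sod => dK.
  have [y [yd yr yK]] : exists y, [/\ y != opp d, region y = region (opp d) & K y != K (face_next y)].
    by apply: second_change; rewrite /K vertex_face_next oppK // eq_sym.
  apply: contraR yd => sod; apply/eqP; apply: eirr => //; rewrite oppK //.
  have soy : starred Ri Rj (opp y).
    apply: contraR yK => soy; rewrite /K vertex_face_next; apply/eqP/kint => //.
    by rewrite /starred yr.
  have cc : col (opp y) = col d by rewrite colo (col_region _ _ yr) colo negbK.
  have ceo : col (opp e) = ~~ col e by rewrite colo.
  case/orP: sd => /eqP dR; case/orP: soy => /eqP yR; rewrite yR dR //.
    have : col (opp e) = col e.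
      by rewrite (col_region _ (opp y)) ?e2 // cc; apply: col_region; rewrite dR e1.
    by rewrite ceo; case: (col e).
  have : col (opp e) = col e.
    by rewrite (col_region _ d) ?e2 // -cc; apply: col_region; rewrite yR e1.
  by rewrite ceo; case: (col e).
have cut d : K (opp d) = K d.
  apply/eqP; apply: contraT => dK.
  (* Only edges with a star on each side are left. A second change around one side lies on an edge
     covered by [noB], or on one with the same two sides, which irreducibility excludes. *)
  have bb : starred Ri Rj d && starred Ri Rj (opp d).
    apply: contraR dK; rewrite negb_and eq_sym => /orP[] h.
      case: (boolP (starred Ri Rj (opp d))) => h'.
        by have := noB (opp d) h'; rewrite oppK // => /(_ h) ->.
      by apply/eqP/kint.
    case: (boolP (starred Ri Rj d)) => h'; first by rewrite (noB d).
    by apply/eqP/kint.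
  have [y [yd yr yK]] : exists y, [/\ y != d, region y = region d & K y != K (face_next y)].
    by apply: second_change; rewrite /K vertex_face_next eq_sym.
  have sy : starred Ri Rj y by rewrite /starred yr; case/andP: bb.
  have soy : ~~ starred Ri Rj (opp y).
    apply: contra yd => soy; apply/eqP/eirr => //.
    have cc : col (opp y) = col (opp d) by rewrite !colo (col_region _ _ yr).
    have ceo : col (opp e) = ~~ col e by rewrite colo.
    case/andP: bb => _ /orP[]/eqP dR; case/orP: soy => /eqP yR; rewrite yR dR //.
      have : col (opp e) = col e.
        by rewrite (col_region _ (opp y)) ?e2 // cc; apply: col_region; rewrite dR e1.
      by rewrite ceo; case: (col e).
    have : col (opp e) = col e.
      by rewrite (col_region _ (opp d)) ?e2 // -cc; apply: col_region; rewrite yR e1.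
    by rewrite ceo; case: (col e).
  by move: yK; rewrite /K vertex_face_next -/(K y) -/(K (opp y)) noB ?eqxx.
move=> v w; have K_ccw d : K (ccw d) = K d by rewrite /K vertex_ccw.
exact: (dart_connected code_u code_f K_ccw cut (v, true, true) (w, true, true)).
Qed.

Theorem irreducible_bound s q :
  clocked Ri Rj s -> counterclocked Ri Rj (last s q) ->
  path (fun x y => clockwise x y || counterclockwise x y) s q ->
  #|crossing D| <= (size q).+1.
Proof.
move=> cs ct pq; have [E [h [sE h_opp h_ccw h_star hE]]] := path_height cs.1 pq.
have [k [kE card_k]] := merge_pairs E.
have kcst : forall v w, k v = k w.
  apply: interior_connected => d d1 d2.
  have := height_interior code_u code_f D_planar irr adj cs ct h_opp h_ccw h_star d1 d2.
  by case: (h d =P 0%R) => [->|/hE[]/kE //].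
apply: leq_trans card_k _; rewrite sE -add1n leq_add2r.
case: (set_0Vmem [set k v | v : crossing D]) => [->|[z /imsetP[v _ _]]].
  by rewrite cards0.
rewrite -(cards1 (k v)); apply/subset_leq_card/subsetP => u /imsetP[w _ ->].
by rewrite inE (kcst w v).
Qed.

End Transpositions.

End IrreducibleBound.
Import IrreducibleBound.

(** * Diagrams as cyclic words, and Reidemeister moves on words *)

Module Words.
(** Such a labelling never has more labels than there are regions, and Euler's inequality bounds the
    regions by n + 2. *)
Lemma planarP (D : gauss_code) :
  uniq (code D) -> (forall l : letter D, l \in code D) -> 0 < #|crossing D| ->
  planar D <->
  exists (R : finType) (lab : dart D -> R),
    [/\ forall d, lab (face_next d) = lab d, forall r, exists d, lab d = r &
        #|crossing D| + 2 <= #|R|].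
Proof.
move=> Du Df n_gt0; pose R0 : finType := {r : {set dart D} | r \in regions D}.
pose pf d : R0 := Sub (region d) (region_in_regions d).
have pf_inv d : pf (face_next d) = pf d by apply: val_inj; rewrite /= region_face.
have pf_surj r : exists d, pf d = r.
  by case: r => r r_in; have /imsetP[d _ rE] := r_in; exists d; apply: val_inj.
have card_R0 : #|R0| = #|regions D| by rewrite card_sig.
split=> [[n0|eR]|[R [lab [lab_inv lab_surj le]]]].
- by rewrite n0 in n_gt0.
- by exists R0, pf; split=> //; rewrite card_R0 eR.
right; apply/eqP; rewrite eqn_leq -card_R0 (labels_le Du Df n_gt0 pf_inv pf_surj).
apply: leq_trans le _.
have surj r : exists d, lab d == r by have [d <-] := lab_surj r; exists d.
rewrite -(card_image (f := fun r : R => pf (xchoose (surj r)))) ?max_card //.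
move=> r r' /(congr1 val) /= /(region_invariant Du lab_inv).
by rewrite (eqP (xchooseP (surj r))) (eqP (xchooseP (surj r'))).
Qed.

Section Words.
Variables (C : choiceType) (sg : C -> bool).
(** Words over one set of names allow diagrams with different types of crossings to be compared, and
    codes to be cut into explicit pieces; the sign of a crossing is read off its name. *)
Definition wdart : eqType := (C * bool * bool)%type.
Implicit Types (w : seq (C * bool)).

Definition wccw (d : wdart) : wdart :=
  let: (v, o, out) := d in (v, ~~ o, if o == sg v then out else ~~ out).
Definition wcw (d : wdart) : wdart :=
  let: (v, o, out) := d in (v, ~~ o, if o == sg v then ~~ out else out).
Definition wopp w (d : wdart) : wdart :=
  if d.2 then (next w d.1, false) else (prev w d.1, true).
Definition wface w (d : wdart) : wdart := wcw (wopp w d).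

Definition gword w : bool := uniq w && all (fun l => (l.1, ~~ l.2) \in w) w.

(* By Euler's inequality a labelling of the faces cannot have more labels, so
   exhibiting one with this many proves planarity without computing the faces. *)
Definition wplanar w : Prop := w = [::] \/
  exists (R : finType) (lab : wdart -> R),
    [/\ forall d : wdart, d.1 \in w -> lab (wface w d) = lab d,
        forall r, exists2 d : wdart, d.1 \in w & lab d = r &
        size w + 4 <= 2 * #|R|].

Definition good w : Prop := gword w /\ wplanar w.

Lemma wccwK : cancel wccw wcw.
Proof. by case=> [[v o] out] /=; case: (sg v) o out => [] [] []. Qed.

Lemma wcwK : cancel wcw wccw.
Proof. by case=> [[v o] out] /=; case: (sg v) o out => [] [] []. Qed.

Lemma woppK w : uniq w -> involutive (wopp w).
Proof. by move=> wu [l []]; rewrite /wopp /= ?prev_next // next_prev. Qed.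

Lemma mem_wopp w (d : wdart) : ((wopp w d).1 \in w) = (d.1 \in w).
Proof. by rewrite /wopp; case: d.2; rewrite /= ?mem_next ?mem_prev. Qed.

Definition realizes (D : gauss_code) (f : crossing D -> C) w : Prop :=
  [/\ injective f, forall v, sg (f v) = positive v &
      [seq (f l.1, l.2) | l <- code D] = w].

Definition wdart_of (D : gauss_code) (f : crossing D -> C) (d : dart D) : wdart :=
  ((f d.1.1, d.1.2), d.2).

Section Realized.
Variables (D : gauss_code) (f : crossing D -> C) (w : seq (C * bool)).
Hypothesis fw : realizes f w.
Hypothesis Du : uniq (code D).

Let finj : injective f. Proof. by case: fw. Qed.
Let fl (l : letter D) : C * bool := (f l.1, l.2).
Let flinj : injective fl.
Proof. by move=> [v o] [v' o'] [/finj -> ->]. Qed.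
Let wE : map fl (code D) = w. Proof. by case: fw. Qed.

Lemma realizes_uniq : uniq w.
Proof. by rewrite -wE map_inj_uniq. Qed.

Lemma wdart_of_inj : injective (wdart_of f).
Proof. by move=> [[v o] b] [[v' o'] b'] [/finj -> -> ->]. Qed.

Lemma wdart_of_ccw d : wccw (wdart_of f d) = wdart_of f (ccw d).
Proof. by case: fw => _ sgf _; case: d => [[v o] b]; rewrite /wdart_of /= sgf. Qed.

Lemma wdart_of_cw d : wcw (wdart_of f d) = wdart_of f (cw d).
Proof. by case: fw => _ sgf _; case: d => [[v o] b]; rewrite /wdart_of /= sgf. Qed.

Lemma wdart_of_opp d : wopp w (wdart_of f d) = wdart_of f (opp d).
Proof.
rewrite -wE; case: d => [l []]; rewrite /wopp /opp /wdart_of /passage /=.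
  by rewrite (next_map flinj Du l).
by rewrite (prev_map flinj Du l).
Qed.

Lemma wdart_of_face d : wface w (wdart_of f d) = wdart_of f (face_next d).
Proof. by rewrite /wface wdart_of_opp wdart_of_cw. Qed.

Hypothesis Df : forall l : letter D, l \in code D.

Lemma realizes_gword : gword w.
Proof.
rewrite /gword realizes_uniq; apply/allP => l; rewrite -wE => /mapP[[v o] _ ->].
by apply/mapP; exists (v, ~~ o).
Qed.

Lemma realizes_size : size w = 2 * #|crossing D|.
Proof.
rewrite -wE size_map -(card_uniqP Du) (eq_card (B := letter D)) => [|l].
  by rewrite card_prod card_bool mulnC.
by rewrite Df.
Qed.

Lemma mem_wdart_of d : (wdart_of f d).1 \in w.
Proof. by rewrite -wE (mem_map flinj). Qed.

Lemma wdart_ofP (d : wdart) : d.1 \in w -> exists x, d = wdart_of f x.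
Proof. by rewrite -wE => /mapP[l _ dl]; exists (l, d.2);
  rewrite [LHS]surjective_pairing dl. Qed.

Lemma wplanarP : wplanar w <-> planar D.
Proof.
have sz := realizes_size; case: (posnP #|crossing D|) => [n0|n_gt0].
  split=> _; first by left.
  by left; apply/nilP; rewrite /nilp sz n0.
have [v0 _] := card_gt0P n_gt0.
rewrite (planarP Du Df n_gt0); split.
  case=> [w0|[R [lab [inv surj le]]]]; first by rewrite w0 in sz; move: sz n_gt0 => /=; lia.
  exists R, (fun d => lab (wdart_of f d)); split.
  - by move=> d; rewrite -wdart_of_face inv // mem_wdart_of.
  - by move=> r; have [d /wdart_ofP[x ->] <-] := surj r; exists x.
  by lia.
case=> [R [lab [inv surj le]]]; right.
pose lab' (d : wdart) := lab (odflt (v0, true, true) [pick x | wdart_of f x == d]).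
have lab'E x : lab' (wdart_of f x) = lab x.
  rewrite /lab'; case: pickP => [y /eqP/wdart_of_inj -> //|/(_ x)].
  by rewrite eqxx.
exists R, lab'; split.
- by move=> d /wdart_ofP[x ->]; rewrite wdart_of_face !lab'E inv.
- by move=> r; have [x <-] := surj r; exists (wdart_of f x); rewrite ?lab'E ?mem_wdart_of.
by rewrite sz; lia.
Qed.

End Realized.

Lemma realizes_good (D : knot_diagram) (f : crossing D -> C) w :
  realizes f w -> good w.
Proof.
move=> fw; split; first exact: realizes_gword fw (code_uniq D) (@code_full D).
by apply/(wplanarP fw (code_uniq D) (@code_full D)); apply: gauss_planar.
Qed.

Lemma gword_realized w : gword w -> exists (D : gauss_code) (f : crossing D -> C),
  [/\ realizes f w, uniq (code D) & forall l : letter D, l \in code D].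
Proof.
case/andP=> wu /allP wf; pose X : finType := seq_sub (unzip1 w).
pose g (l : C * bool) : option (X * bool) :=
  omap (fun c => (c, l.2)) (insub l.1).
pose h (l : X * bool) : C * bool := (val l.1, l.2).
have hinj : injective h by move=> [v o] [v' o'] [/val_inj -> ->].
have gh l : l \in w -> exists2 x, g l = Some x & h x = l.
  move=> lw; have lw1 : l.1 \in unzip1 w by apply: map_f.
  by exists (SeqSub lw1, l.2); rewrite /g /h ?insubT // -surjective_pairing.
have hcode : [seq (val l.1, l.2) | l <- pmap g w] = w.
  suff H s : {subset s <= w} -> [seq h l | l <- pmap g s] = s by apply: H.
  elim: s => //= l s IH sub; have [|x -> hx] := gh l.
    by apply: sub; rewrite mem_head.
  by rewrite /= hx IH // => y ys; apply: sub; rewrite inE ys orbT.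
exists (@GaussCode X (pmap g w) (fun v => sg (val v))), val; split=> /=.
- by split=> //; exact: val_inj.
- by rewrite -(map_inj_uniq hinj) hcode.
move=> [v o]; rewrite /= -(mem_map hinj) hcode /h /=.
have /mapP[[c o'] lw /= ->] := ssvalP v.
by have /= := wf _ lw; move: lw; case: (o); case: (o').
Qed.

Lemma good_realized w : good w ->
  exists (D : knot_diagram) (f : crossing D -> C), realizes f w.
Proof.
case=> gw pw; have [D [f [fw Du Df]]] := gword_realized gw.
by exists (KnotDiagram Du Df (iffLR (wplanarP fw Du Df) pw)), f.
Qed.

(** The relation holds vacuously for words that no diagram realizes; this is why transitivity
    requires the middle word to be good. *)
Definition wsame w w' : Prop :=
  forall (D D' : knot_diagram) (f : crossing D -> C) (f' : crossing D' -> C),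
  realizes f w -> realizes f' w' -> same_knot D D'.

Lemma eq_map_in_inj (A B : eqType) (F : A -> B) (s1 s2 : seq A) :
  {in s1 & s2, forall x y, F x = F y -> x = y} -> map F s1 = map F s2 -> s1 = s2.
Proof.
elim: s1 s2 => [|x s1 IH] [|y s2] //= inj [Fxy /IH e].
rewrite (inj x y) ?mem_head // e // => x' y' x's y's.
by apply: inj; rewrite inE ?x's ?y's orbT.
Qed.

(** The renaming sends a crossing of [D'] to the crossing of the same name that occurs in [s]. *)
Lemma spelled_of (D D' : gauss_code) (f : crossing D -> C) (f' : crossing D' -> C)
    k (s : seq (letter D)) :
  (forall v o v' o', (v, o) \in s -> (v', o') \in s -> f v = f v' -> v = v') ->
  (forall v o, (v, o) \in s -> sg (f v) = positive v) ->
  (forall v', sg (f' v') = positive v') ->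
  (forall l : letter D', l \in code D') ->
  [seq (f' l.1, l.2) | l <- code D'] = rot k [seq (f l.1, l.2) | l <- s] ->
  spelled_by D' s.
Proof.
move=> finj fsg f'sg D'f e.
have ex v' o : exists v, ((v, o) \in s) && (f v == f' v').
  have : (f' v', o) \in [seq (f' l.1, l.2) | l <- code D'].
    by apply/mapP; exists (v', o).
  rewrite e mem_rot => /mapP[[v o'] vs [e1 e2]].
  by exists v; rewrite e2 vs /= e1 eqxx.
pose h v' := xchoose (ex v' true).
have hP v' o : (h v', o) \in s /\ f (h v') = f' v'.
  have /andP[h1 /eqP h2] := xchooseP (ex v' true).
  have [v /andP[v1 /eqP v2]] := ex v' o; split; last by rewrite h2.
  by rewrite /h (finj _ _ _ _ h1 v1) // h2 v2.
exists h; split.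
  by move=> v'; have [h1 h2] := hP v' true; rewrite -(fsg _ _ h1) h2 f'sg.
exists k; apply: (eq_map_in_inj (F := fun l : letter D => (f l.1, l.2))).
  move=> l [v o] /mapP[[v' o'] _ ->] /=; rewrite mem_rot => vs [e1 <-].
  by congr (_, _); apply: (finj _ o' _ o) => //; case: (hP v' o').
rewrite map_rot -e -map_comp; apply: eq_map => l /=.
by rewrite (hP l.1 true).2.
Qed.

Lemma wsame_map_rot w w' (g : C -> C) k :
  (forall c o c' o', (c, o) \in w -> (c', o') \in w -> g c = g c' -> c = c') ->
  (forall c o, (c, o) \in w -> sg (g c) = sg c) ->
  w' = rot k [seq (g l.1, l.2) | l <- w] -> wsame w w'.
Proof.
move=> ginj gsg w'E D D' f f' [finj fsg fw] [_ f'sg f'w'].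
apply: rst_step; apply: Or41.
have lw v o : (f v, o) \in w.
  by rewrite -fw; apply/mapP; exists (v, o) => //; apply: code_full.
apply: (spelled_of (f := g \o f) (f' := f') (k := k)) => //=.
- by move=> v o v' o' _ _ e; apply: finj; apply: (ginj _ o _ o').
- by move=> v o _; rewrite (gsg _ o).
- exact: code_full.
by rewrite f'w' w'E -fw -!map_comp.
Qed.

Lemma wsame_rot w k : wsame w (rot k w).
Proof. by apply: (wsame_map_rot (g := id) (k := k)) => //; rewrite map_id_in // => -[]. Qed.

Lemma wsame_refl w : wsame w w.
Proof. by rewrite -[w in X in wsame _ X]rot0; apply: wsame_rot. Qed.

Lemma wsame_sym w w' : wsame w w' -> wsame w' w.
Proof. by move=> h D D' f f' fw fw'; apply: rst_sym; apply: h fw' fw. Qed.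

Lemma wsame_trans w w' w'' : good w' -> wsame w w' -> wsame w' w'' -> wsame w w''.
Proof.
move=> /good_realized[D' [f' fw']] h1 h2 D D'' f f'' fw fw''.
exact: rst_trans (h1 _ _ _ _ fw fw') (h2 _ _ _ _ fw' fw'').
Qed.

Section Moves.
Variables (w w' : seq (C * bool)).

Lemma R1_wsame (d : wdart) : d.1 \in w -> wface w d = d ->
  w' = [seq l <- w | l.1 != d.1.1] -> wsame w w'.
Proof.
move=> dw fd w'E D D' f f' fw [_ f'sg f'w']; have [finj fsg wE] := fw.
have [x dx] := wdart_ofP fw dw.
have fx : face_next x = x.
  by apply: (wdart_of_inj fw); rewrite -(wdart_of_face fw (code_uniq D)) -dx.
apply: rst_step; apply: Or42; exists x; split=> //.
apply: (spelled_of (f := f) (f' := f') (k := 0)) => //; try exact: code_full.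
- by move=> v o v' o' _ _ /finj.
rewrite rot0 f'w' w'E -wE filter_map /erase; congr map; apply: eq_filter => l /=.
by rewrite inE dx /= (inj_eq finj).
Qed.

Lemma R2_wsame (d : wdart) : d.1 \in w ->
  let d1 := wface w d in
  wface w d1 = d -> d.1.1 != d1.1.1 -> d.1.2 && (wopp w d).1.2 ->
  w' = [seq l <- w | (l.1 != d.1.1) && (l.1 != d1.1.1)] -> wsame w w'.
Proof.
move=> dw d1 fd ne ov w'E D D' f f' fw [_ f'sg f'w']; have [finj fsg wE] := fw.
have [x dx] := wdart_ofP fw dw.
have d1x : d1 = wdart_of f (face_next x).
  by rewrite /d1 dx (wdart_of_face fw (code_uniq D)).
apply: rst_step; apply: Or43; exists x; split.
- by apply: (wdart_of_inj fw); rewrite -(wdart_of_face fw (code_uniq D)) -d1x -dx.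
- by move: ne; rewrite d1x dx /= (inj_eq finj).
- by move: ov; rewrite dx (wdart_of_opp fw (code_uniq D)).
apply: (spelled_of (f := f) (f' := f') (k := 0)) => //; try exact: code_full.
- by move=> v o v' o' _ _ /finj.
rewrite rot0 f'w' w'E -wE filter_map /erase; congr map; apply: eq_filter => l /=.
by rewrite !inE d1x dx /= !(inj_eq finj) negb_or.
Qed.

Definition wswap (d : wdart) (l : C * bool) : C * bool :=
  if l == d.1 then (wopp w d).1 else if l == (wopp w d).1 then d.1 else l.

Lemma R3_wsame (d : wdart) : d.1 \in w ->
  let d1 := wface w d in let d2 := wface w d1 in
  wface w d2 = d -> uniq [:: d.1.1; d1.1.1; d2.1.1] ->
  d.1.2 && (wopp w d).1.2 ->
  w' = [seq wswap d (wswap d1 (wswap d2 l)) | l <- w] -> wsame w w'.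
Proof.
move=> dw d1 d2 fd un ov w'E D D' f f' fw [_ f'sg f'w']; have [finj fsg wE] := fw.
have [x dx] := wdart_ofP fw dw.
have d1x : d1 = wdart_of f (face_next x).
  by rewrite /d1 dx (wdart_of_face fw (code_uniq D)).
have d2x : d2 = wdart_of f (face_next (face_next x)).
  by rewrite /d2 d1x (wdart_of_face fw (code_uniq D)).
have flinj : injective (fun l : letter D => (f l.1, l.2)).
  by move=> [v o] [v' o'] [/finj -> ->].
have swapE y l : wswap (wdart_of f y) (f l.1, l.2) =
    (f (swap_ends y l).1, (swap_ends y l).2).
  rewrite /wswap (wdart_of_opp fw (code_uniq D)) /swap_ends.
  rewrite -[(wdart_of f y).1]/((fun l : letter D => (f l.1, l.2)) (passage y)).
  rewrite -[(wdart_of f (opp y)).1]/((fun l : letter D => (f l.1, l.2)) (passage (opp y))).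
  rewrite -![(f l.1, l.2)]/((fun l : letter D => (f l.1, l.2)) l) !(inj_eq flinj).
  case: tpermP => [->|->|/eqP/negPf -> /eqP/negPf -> //]; rewrite ?eqxx //.
  by case: eqP => // ->.
apply: rst_step; apply: Or44; exists x; split.
- by apply: (wdart_of_inj fw); rewrite -(wdart_of_face fw (code_uniq D)) -d2x -dx.
- by move: un; rewrite d2x d1x dx /= !inE !(inj_eq finj).
- by move: ov; rewrite dx (wdart_of_opp fw (code_uniq D)).
apply: (spelled_of (f := f) (f' := f') (k := 0)) => //; try exact: code_full.
- by move=> v o v' o' _ _ /finj.
rewrite rot0 f'w' w'E -wE -!map_comp; apply: eq_map => l /=.
by rewrite d2x d1x dx !swapE.
Qed.

End Moves.
End Words.

End Words.
Import Words.

(** * Concatenation of words as connected sum, and planarity *)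

Module WordSums.
Section NextPrev.
Variable T : eqType.
Implicit Types (s p q : seq T) (x y : T).

Lemma next_split p x y q : uniq (p ++ x :: y :: q) -> next (p ++ x :: y :: q) x = y.
Proof.
move=> u; have -> : p ++ x :: y :: q = rotr (size p) (x :: y :: q ++ p).
  by rewrite -!cat_cons -[in RHS](rot_size_cat p) rotK.
have u' : uniq (x :: y :: q ++ p) by rewrite -!cat_cons uniq_catC.
by rewrite (next_rotr _ u') /= eqxx.
Qed.

Lemma prev_split p x y q : uniq (p ++ x :: y :: q) -> prev (p ++ x :: y :: q) y = x.
Proof. by move=> u; have := prev_next u x; rewrite next_split. Qed.

Lemma next_last x p : uniq (x :: p) -> next (x :: p) (last x p) = x.
Proof.
move=> u; have := cycle_next u; rewrite /= rcons_path => /andP[_ /eqP].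
by [].
Qed.

Lemma prev_head x p : uniq (x :: p) -> prev (x :: p) x = last x p.
Proof. by move=> u; have := prev_next u (last x p); rewrite next_last. Qed.

Lemma next_infix p s q x x0 :
  uniq (p ++ s ++ q) -> x \in s -> x != last x0 s -> next (p ++ s ++ q) x = next s x.
Proof.
move=> u xs; have us : uniq s by move: u; rewrite !cat_uniq => /and3P[_ _ /and3P[]].
case/splitPr: xs u us => s1 [|y s2] u us; first by rewrite last_cat /= eqxx.
move=> _; rewrite (next_split us); move: u; rewrite -catA /= catA.
exact: next_split.
Qed.

Lemma prev_infix p s q y :
  uniq (p ++ s ++ q) -> y \in s -> y != head y s -> prev (p ++ s ++ q) y = prev s y.
Proof.
move=> u ys; have us : uniq s by move: u; rewrite !cat_uniq => /and3P[_ _ /and3P[]].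
case/splitPr: ys u us => s1 s2; case/lastP: s1 => [|s1 x] u us; first by rewrite /= eqxx.
move=> _; move: u us; rewrite !cat_rcons => u us; rewrite (prev_split us).
by move: u; rewrite -catA /= catA; apply: prev_split.
Qed.

End NextPrev.

Section Sum.
Variables (C : choiceType) (sg : C -> bool).
Local Notation wdart := (wdart C).
Implicit Types (w a e : seq (C * bool)).
Local Notation wcw := (wcw sg).
Local Notation wface := (wface sg).
Local Notation good := (good sg).

(** Taking the regions themselves as labels also separates the two sides of each edge. *)
Lemma wplanar_labels w : good w -> w <> [::] ->
  exists (R : finType) (lab : wdart -> R),
    [/\ forall d : wdart, d.1 \in w -> lab (wface w d) = lab d,
        forall r, exists2 d : wdart, d.1 \in w & lab d = r,
        size w + 4 <= 2 * #|R| &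
        forall d : wdart, d.1 \in w -> lab d <> lab (wopp w d)].
Proof.
move=> gw wn; have [D [f fw]] := good_realized gw.
have Du := code_uniq D; have Df := @code_full D; have Dp := gauss_planar D.
have sz := realizes_size fw Du Df.
have n_gt0 : 0 < #|crossing D|.
  by case: (w) wn sz => //= l s _; case: #|_| => //; rewrite muln0.
have [v0 _] := card_gt0P n_gt0.
have eR : #|regions D| = #|crossing D| + 2.
  by case: Dp => // n0; rewrite n0 in n_gt0.
pose R : finType := {r : {set dart D} | r \in regions D}.
pose pf d : R := Sub (region d) (region_in_regions d).
pose lab (d : wdart) := pf (odflt (v0, true, true) [pick x | wdart_of f x == d]).
have labE x : lab (wdart_of f x) = pf x.
  rewrite /lab; case: pickP => [y /eqP/(wdart_of_inj fw) -> //|/(_ x)].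
  by rewrite eqxx.
exists R, lab; split.
- move=> d /(wdart_ofP fw)[x ->]; rewrite (wdart_of_face fw Du) !labE.
  by apply: val_inj; rewrite /= region_face.
- move=> [r r_in]; have /imsetP[x _ rE] := r_in; exists (wdart_of f x).
    exact: mem_wdart_of fw Df _.
  by rewrite labE; apply: val_inj.
- by rewrite card_sig eR sz; lia.
move=> d /(wdart_ofP fw)[x ->]; rewrite (wdart_of_opp fw Du) !labE => /(congr1 val) /eqP.
by rewrite /= (negPf (region_opp_neq Du Df Dp x)).
Qed.

Lemma gword_cat a e : gword a -> gword e ->
  (forall l l', l \in a -> l' \in e -> l.1 != l'.1) -> gword (a ++ e).
Proof.
move=> /andP[au /allP ac] /andP[eu /allP ec] dis; apply/andP; split.
  rewrite cat_uniq au eu andbT /=; apply/hasPn => l le; apply/negP => la.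
  by have := dis _ _ la le; rewrite eqxx.
by apply/allP => l; rewrite !mem_cat => /orP[/ac ->|/ec ->]; rewrite ?orbT.
Qed.

Lemma mem_wcw w (d : wdart) : gword w -> ((wcw d).1 \in w) = (d.1 \in w).
Proof.
case/andP=> _ /allP wc; case: d => [[v o] b] /=; apply/idP/idP => /wc //=.
by rewrite negbK.
Qed.

Lemma mem_wface w (d : wdart) : gword w -> ((wface w d).1 \in w) = (d.1 \in w).
Proof. by move=> gw; rewrite mem_wcw // mem_wopp. Qed.

Lemma wopp_cat_l a e (d : wdart) x0 : uniq (a ++ e) -> d.1 \in a ->
  d != (last x0 a, true) -> d != (head x0 a, false) -> wopp (a ++ e) d = wopp a d.
Proof.
case: d => l [] u la; rewrite /wopp /= !xpair_eqE ?andbT ?andbF /=.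
  by move=> ne _; rewrite -[a ++ e]/([::] ++ a ++ e) (next_infix (x0 := x0)).
move=> _; case: a u la => // x a u la ne.
by rewrite -[(x :: a) ++ e]/([::] ++ (x :: a) ++ e) prev_infix.
Qed.

Lemma wopp_cat_r a e (d : wdart) x0 : uniq (a ++ e) -> d.1 \in e ->
  d != (last x0 e, true) -> d != (head x0 e, false) -> wopp (a ++ e) d = wopp e d.
Proof.
case: d => l [] u la; rewrite /wopp /= !xpair_eqE ?andbT ?andbF /=.
  move=> ne _; rewrite -[a ++ e]cats0 -catA (next_infix (x0 := x0)) //.
  by rewrite cats0.
move=> _; case: e u la => // x e u la ne.
by rewrite -[a ++ _]cats0 -catA prev_infix ?cats0.
Qed.

Lemma wopp_cat_base a e x0 : uniq (a ++ e) -> a <> [::] -> e <> [::] ->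
  [/\ wopp (a ++ e) (last x0 a, true) = (head x0 e, false),
      wopp (a ++ e) (head x0 a, false) = (last x0 e, true),
      wopp (a ++ e) (last x0 e, true) = (head x0 a, false) &
      wopp (a ++ e) (head x0 e, false) = (last x0 a, true)].
Proof.
case: a => // x a; case: e => // y e u _ _.
have lE : last x (a ++ y :: e) = last y e by rewrite last_cat.
have u' : uniq (belast x a ++ last x a :: y :: e).
  by rewrite -cat_rcons -lastI.
have wE : (x :: a) ++ y :: e = belast x a ++ last x a :: y :: e.
  by rewrite -[RHS]cat_rcons -lastI.
split.
- by rewrite wE; apply: (congr1 (fun l => (l, false)) (next_split u')).
- exact: (congr1 (fun l => (l, true)) (etrans (prev_head u) lE)).
- by rewrite -[last x0 _]lE; apply: (congr1 (fun l => (l, false)) (next_last u)).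
by rewrite wE; apply: (congr1 (fun l => (l, true)) (prev_split u')).
Qed.

Lemma wopp_base a x0 : uniq a -> a <> [::] ->
  wopp a (last x0 a, true) = (head x0 a, false) /\
  wopp a (head x0 a, false) = (last x0 a, true).
Proof.
case: a => // x a u _; split.
  exact: (congr1 (fun l => (l, false)) (next_last u)).
exact: (congr1 (fun l => (l, true)) (prev_head u)).
Qed.

Section CatLabels.
Variables (a e : seq (C * bool)) (Ra Re : finType).
Variables (laba : wdart -> Ra) (labe : wdart -> Re) (l0 : C * bool).
Hypothesis gwa : gword a.
Hypothesis gwe : gword e.
Hypothesis dis : forall l l', l \in a -> l' \in e -> l.1 != l'.1.
Hypothesis an : a <> [::].
Hypothesis en : e <> [::].
Hypothesis inva : forall d : wdart, d.1 \in a -> laba (wface a d) = laba d.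
Hypothesis inve : forall d : wdart, d.1 \in e -> labe (wface e d) = labe d.
Let EL := labe (last l0 e, true).
Let ER := labe (head l0 e, false).
Hypothesis ELR : EL != ER.

Definition cat_rest : finType := {r : Re | (r != EL) && (r != ER)}.

(** Joining identifies the regions on the two sides of the closing edge of [e] with those on the
    sides of the closing edge of [a]; the other regions survive. *)
Definition cat_label (d : wdart) : Ra + cat_rest :=
  if d.1 \in a then inl (laba d) else
  if labe d == EL then inl (laba (last l0 a, true)) else
  if labe d == ER then inl (laba (head l0 a, false)) else
  oapp inr (inl (laba (last l0 a, true))) (insub (labe d) : option cat_rest).

Lemma cat_label_l (d : wdart) : d.1 \in a -> cat_label d = inl (laba d).
Proof. by rewrite /cat_label => ->. Qed.

Lemma cat_disjoint l : l \in e -> l \notin a.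
Proof. by move=> h; apply/negP => h'; have := dis h' h; rewrite eqxx. Qed.

Lemma cat_label_r (d : wdart) (r : cat_rest) :
  d.1 \in e -> labe d = val r -> cat_label d = inr r.
Proof.
move=> /cat_disjoint/negPf de dr; rewrite /cat_label de dr.
by have /andP[/negPf -> /negPf ->] := valP r; rewrite valK.
Qed.

Lemma cat_label_face (d : wdart) :
  d.1 \in a ++ e -> cat_label (wface (a ++ e) d) = cat_label d.
Proof.
have [u _] := andP (gword_cat gwa gwe dis).
have [ua _] := andP gwa; have [ue _] := andP gwe.
have la : last l0 a \in a by case: (a) an => //= l s _; rewrite mem_last.
have ha : head l0 a \in a by case: (a) an => //= l s _; rewrite mem_head.
have le : last l0 e \in e by case: (e) en => //= l s _; rewrite mem_last.
have he : head l0 e \in e by case: (e) en => //= l s _; rewrite mem_head.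
have [ob1 ob2] := wopp_base l0 ua an; have [oe1 oe2] := wopp_base l0 ue en.
have [b1 b2 b3 b4] := wopp_cat_base l0 u an en.
have lab_e (x y : wdart) : x.1 \in e -> y.1 \in e -> labe x = labe y ->
    cat_label x = cat_label y.
  by move=> /cat_disjoint/negPf xa /cat_disjoint/negPf ya e'; rewrite /cat_label xa ya e'.
have labL (x : wdart) : x.1 \in e -> labe x = EL ->
    cat_label x = inl (laba (last l0 a, true)).
  by move=> /cat_disjoint/negPf xa xE; rewrite /cat_label xa xE eqxx.
have labR (x : wdart) : x.1 \in e -> labe x = ER ->
    cat_label x = inl (laba (head l0 a, false)).
  move=> /cat_disjoint/negPf xa xE.
  by rewrite /cat_label xa xE eq_sym (negPf ELR) eqxx.
rewrite mem_cat => /orP[da|de].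
  rewrite (cat_label_l da); case: (eqVneq d (last l0 a, true)) => [->|d1].
    by rewrite /Words.wface b1 -oe1 -/(wface e _) labL ?mem_wface // inve.
  case: (eqVneq d (head l0 a, false)) => [->|d2].
    by rewrite /Words.wface b2 -oe2 -/(wface e _) labR ?mem_wface // inve.
  rewrite /Words.wface (wopp_cat_l (x0 := l0)) // -/(wface a d).
  by rewrite cat_label_l ?mem_wface // inva.
case: (eqVneq d (last l0 e, true)) => [->|d1].
  by rewrite /Words.wface b3 -ob1 -/(wface a _) cat_label_l ?mem_wface // inva // labL.
case: (eqVneq d (head l0 e, false)) => [->|d2].
  by rewrite /Words.wface b4 -ob2 -/(wface a _) cat_label_l ?mem_wface // inva // labR.
rewrite /Words.wface (wopp_cat_r (x0 := l0)) // -/(wface e d).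
by apply: lab_e; rewrite ?mem_wface // inve.
Qed.

End CatLabels.

(** Two labels are lost in the gluing, so (m + 2) + (n + 2) - 2 remain for m + n crossings. *)
Lemma good_cat a e : good a -> good e ->
  (forall l l', l \in a -> l' \in e -> l.1 != l'.1) -> good (a ++ e).
Proof.
move=> ga ge dis; have gae := gword_cat ga.1 ge.1 dis.
case: (eqVneq a [::]) => [-> //|/eqP an]; case: (eqVneq e [::]) => [->|/eqP en].
  by rewrite cats0.
split=> //; right; have [ue _] := andP ge.1.
have [l0 l0a] : exists l0, l0 \in a by case: (a) an => // l s _; exists l; rewrite mem_head.
have le : last l0 e \in e by case: (e) en => //= l s _; rewrite mem_last.
have [Ra [laba [inva surja carda _]]] := wplanar_labels ga an.
have [Re [labe [inve surje carde neqe]]] := wplanar_labels ge en.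
have [oe1 _] := wopp_base l0 ue en.
have ELR : labe (last l0 e, true) != labe (head l0 e, false).
  by apply/eqP; rewrite -oe1; apply: neqe.
exists (Ra + cat_rest e labe l0)%type, (@cat_label a e Ra Re laba labe l0); split.
- by move=> d; apply: cat_label_face; rewrite ?ga.1 ?ge.1.
- case=> r.
    by have [d da dr] := surja r; exists d; rewrite ?mem_cat ?da // cat_label_l // dr.
  have [d de dr] := surje (val r); exists d; first by rewrite mem_cat de orbT.
  exact: cat_label_r.
have cRe' : #|cat_rest e labe l0| + 2 = #|Re|.
  rewrite card_sig -(cardC (pred2 (labe (last l0 e, true)) (labe (head l0 e, false)))) addnC.
  congr (_ + _); first by rewrite card2 ELR.
  by apply: eq_card => r; rewrite !inE negb_or.
rewrite card_sum size_cat; move: carda carde cRe'.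
by move: #|Ra| #|Re| #|cat_rest _ _ _| (size a) (size e); clear; lia.
Qed.

(** The boundary of the region of [x] leaves [K] along [x]; it has to come back, and [y] is the only
    dart along which it can. *)
Lemma cut_regions (D : knot_diagram) (K : crossing D -> bool) (x y : dart D) :
  (forall d, K (vertex d) != K (vertex (opp d)) -> edge d = edge x \/ edge d = edge y) ->
  K (vertex x) -> ~~ K (vertex (opp x)) -> ~~ K (vertex y) -> K (vertex (opp y)) ->
  region x = region y.
Proof.
have Du := code_uniq D; have Df := @code_full D; have Dp := gauss_planar D.
move=> cut Kx Kx' Ky Ky'; apply/eqP; apply: contraT => xy.
have : \sum_(d | region d == region x) (K (vertex (face_next d)) : nat) =
       \sum_(d | region d == region x) (K (vertex d) : nat).
  rewrite [RHS](reindex_inj (face_next_inj Du)) /=.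
  by apply: eq_bigl => d; rewrite region_face.
rewrite (bigD1 x) //= [RHS](bigD1 x) //= vertex_face_next Kx (negPf Kx') add0n => e.
suff : \sum_(d | (region d == region x) && (d != x)) (K (vertex (face_next d)) : nat) <=
       \sum_(d | (region d == region x) && (d != x)) (K (vertex d) : nat).
  by rewrite e add1n ltnn.
apply: leq_sum => d /andP[/eqP dr dx]; rewrite vertex_face_next.
case: (boolP (K (vertex d) != K (vertex (opp d)))) => [/cut|/negPn/eqP -> //].
case=> /esym/(edge_inj Du)[] de; move: dr; rewrite de.
- by rewrite de eqxx in dx.
- by move/esym/eqP; rewrite (negPf (region_opp_neq Du Df Dp x)).
- by move/esym/eqP; rewrite (negPf xy).
by rewrite oppK // (negPf Ky).
Qed.

Section CatRegions.
Variables (a e : seq (C * bool)) (l0 : C * bool) (X : Type) (lab : wdart -> X).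
Hypothesis gae : good (a ++ e).
Hypothesis dis : forall l l', l \in a -> l' \in e -> l.1 != l'.1.
Hypothesis an : a <> [::].
Hypothesis en : e <> [::].
Hypothesis inv : forall d : wdart, d.1 \in a ++ e -> lab (wface (a ++ e) d) = lab d.

(** The two edges that join [a] and [e] are the only ones between their crossings, so [cut_regions]
    applies on both sides of them. *)
Lemma cat_base_labels :
  lab (last l0 a, true) = lab (last l0 e, true) /\
  lab (head l0 a, false) = lab (head l0 e, false).
Proof.
have [D [f fw]] := good_realized gae.
have Du := code_uniq D; have Df := @code_full D.
have [u _] := andP gae.1.
have la : last l0 a \in a by case: (a) an => //= l s _; rewrite mem_last.
have ha : head l0 a \in a by case: (a) an => //= l s _; rewrite mem_head.
have le : last l0 e \in e by case: (e) en => //= l s _; rewrite mem_last.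
have he : head l0 e \in e by case: (e) en => //= l s _; rewrite mem_head.
have [b1 b2 b3 b4] := wopp_cat_base l0 u an en.
have inD l b : l \in a ++ e -> exists x, (l, b) = wdart_of f x.
  by move=> lw; apply: (wdart_ofP fw).
have [x1 x1E] : exists x, (last l0 a, true) = wdart_of f x by apply: inD; rewrite mem_cat la.
have [x2 x2E] : exists x, (head l0 a, false) = wdart_of f x by apply: inD; rewrite mem_cat ha.
have [x3 x3E] : exists x, (last l0 e, true) = wdart_of f x by apply: inD; rewrite mem_cat le orbT.
have [x4 x4E] : exists x, (head l0 e, false) = wdart_of f x by apply: inD; rewrite mem_cat he orbT.
have inj := wdart_of_inj fw.
have o1 : opp x1 = x4.
  by apply: inj; rewrite -(wdart_of_opp fw Du) -x1E b1 x4E.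
have o2 : opp x2 = x3.
  by apply: inj; rewrite -(wdart_of_opp fw Du) -x2E b2 x3E.
pose K (v : crossing D) := f v \in unzip1 a.
have KE (d : dart D) : K (vertex d) = ((wdart_of f d).1 \in a).
  apply/mapP/idP => [[l la' fl]|da]; last by exists (wdart_of f d).1.
  have := mem_wdart_of fw Df d; rewrite mem_cat => /orP[//|de].
  by have := dis la' de; rewrite -fl /= eqxx.
have K1 : K (vertex x1) by rewrite KE -x1E.
have K2 : K (vertex x2) by rewrite KE -x2E.
have dis' l : l \in e -> l \notin a.
  by move=> h; apply/negP => h'; have := dis h' h; rewrite eqxx.
have K3 : ~~ K (vertex x3) by rewrite KE -x3E dis'.
have K4 : ~~ K (vertex x4) by rewrite KE -x4E dis'.
have cut d : K (vertex d) != K (vertex (opp d)) ->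
    [\/ d = x1, d = x2, d = x3 | d = x4].
  rewrite !KE -(wdart_of_opp fw Du) => dK.
  have := mem_wdart_of fw Df d; rewrite mem_cat => /orP[da|de].
    case: (eqVneq (wdart_of f d) (last l0 a, true)) => [|d1].
      by rewrite x1E => /inj ->; constructor 1.
    case: (eqVneq (wdart_of f d) (head l0 a, false)) => [|d2].
      by rewrite x2E => /inj ->; constructor 2.
    by move: dK; rewrite (wopp_cat_l (x0 := l0)) // mem_wopp da.
  case: (eqVneq (wdart_of f d) (last l0 e, true)) => [|d1].
    by rewrite x3E => /inj ->; constructor 3.
  case: (eqVneq (wdart_of f d) (head l0 e, false)) => [|d2].
    by rewrite x4E => /inj ->; constructor 4.
  move: dK; rewrite (wopp_cat_r (x0 := l0)) //.
  by rewrite (negPf (dis' _ de)) (negPf (dis' _ _)) // mem_wopp.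
have cut1 d : K (vertex d) != K (vertex (opp d)) -> edge d = edge x1 \/ edge d = edge x3.
  case/cut => ->; auto; last by rewrite -o1 edge_opp //; left.
  by rewrite -o2 edge_opp //; right.
have cut2 d : K (vertex d) != K (vertex (opp d)) -> edge d = edge x2 \/ edge d = edge x4.
  by move/cut1; rewrite -o1 -o2 !edge_opp //; case; auto.
have linv : forall d, lab (wdart_of f (face_next d)) = lab (wdart_of f d).
  by move=> d; rewrite -(wdart_of_face fw Du) inv //; apply: mem_wdart_of fw Df _.
rewrite x1E x2E x3E x4E; split.
  apply: (region_invariant Du linv (d := x1) (x := x3)).
  by apply: (cut_regions (K := K)); rewrite ?o1 // -o2 oppK.
apply: (region_invariant Du linv (d := x2) (x := x4)).
by apply: (cut_regions (K := K)); rewrite ?o2 // -o1 oppK.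
Qed.

Hypothesis gwa : gword a.

Lemma cat_label_restrict (d : wdart) : d.1 \in a -> lab (wface a d) = lab d.
Proof.
move=> da; have [h1 h2] := cat_base_labels; have [u _] := andP gae.1.
have [ua _] := andP gwa.
have le : last l0 e \in e by case: (e) en => //= l s _; rewrite mem_last.
have he : head l0 e \in e by case: (e) en => //= l s _; rewrite mem_head.
have [b1 b2 b3 b4] := wopp_cat_base l0 u an en.
have [ob1 ob2] := wopp_base l0 ua an.
case: (eqVneq d (last l0 a, true)) => [->|d1].
  by rewrite /Words.wface ob1 -b3 -/(wface _ _) inv ?h1 // mem_cat le orbT.
case: (eqVneq d (head l0 a, false)) => [->|d2].
  by rewrite /Words.wface ob2 -b4 -/(wface _ _) inv ?h2 // mem_cat he orbT.
rewrite -[RHS]inv ?mem_cat ?da // /Words.wface (wopp_cat_l (x0 := l0)) //.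
Qed.

End CatRegions.

Lemma wlabels_le w (R : finType) (lab : wdart -> R) : gword w -> w <> [::] ->
  (forall d : wdart, d.1 \in w -> lab (wface w d) = lab d) ->
  (forall r, exists2 d : wdart, d.1 \in w & lab d = r) ->
  2 * #|R| <= size w + 4.
Proof.
move=> gw wn inv surj; have [D [f [fw Du Df]]] := gword_realized sg gw.
have sz := realizes_size fw Du Df.
have n_gt0 : 0 < #|crossing D|.
  by case: (w) wn sz => //= l s _; case: #|_| => //; rewrite muln0.
have := @labels_le D Du Df R (fun d => lab (wdart_of f d)) n_gt0 _ _.
rewrite sz => h; suff : #|R| <= #|crossing D| + 2.
  by move: #|R| #|crossing D|; clear; lia.
apply: h => [d|r]; first by rewrite -(wdart_of_face fw Du) inv //; apply: mem_wdart_of fw Df _.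
by have [d /(wdart_ofP fw)[x ->] <-] := surj r; exists x.
Qed.

(** The labels met by [a] and those met by [e] cover all labels and have at least two in common;
    Euler's bound on each part then forces both numbers to be maximal. *)
Lemma good_cat_inv a e : good (a ++ e) -> gword a -> gword e ->
  (forall l l', l \in a -> l' \in e -> l.1 != l'.1) -> good a /\ good e.
Proof.
move=> gae gwa gwe dis.
case: (eqVneq a [::]) => [a0|/eqP an].
  by rewrite a0 in gae *; split=> //; split=> //; left.
case: (eqVneq e [::]) => [e0|/eqP en].
  by rewrite e0 cats0 in gae *; split=> //; split=> //; left.
have [l0 l0a] : exists l0, l0 \in a by case: (a) an => // l s _; exists l; rewrite mem_head.
have la : last l0 a \in a by case: (a) an => //= l s _; rewrite mem_last.
have ha : head l0 a \in a by case: (a) an => //= l s _; rewrite mem_head.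
have le : last l0 e \in e by case: (e) en => //= l s _; rewrite mem_last.
have he : head l0 e \in e by case: (e) en => //= l s _; rewrite mem_head.
have aen : a ++ e <> [::] by case: (a) an.
have [R [lab [inv surj card_R neq]]] := wplanar_labels gae aen.
have [h1 h2] := cat_base_labels l0 gae dis an en inv.
have inva := cat_label_restrict l0 gae dis an en inv gwa.
have dis2 l l' : l \in e -> l' \in a -> l.1 != l'.1.
  by move=> le' la'; rewrite eq_sym; apply: dis.
have [u _] := andP gae.1; have [b1 _ _ _] := wopp_cat_base l0 u an en.
have [ua _] := andP gwa; have [ue _] := andP gwe.
have [oe1 oe2] := wopp_base l0 ue en.
have [_ b2 _ b4] := wopp_cat_base l0 u an en.
have inve (d : wdart) : d.1 \in e -> lab (wface e d) = lab d.
  move=> de; case: (eqVneq d (last l0 e, true)) => [->|d1].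
    by rewrite /Words.wface oe1 -b1 -/(wface _ _) inv ?h1 // mem_cat la.
  case: (eqVneq d (head l0 e, false)) => [->|d2].
    by rewrite /Words.wface oe2 -b2 -/(wface _ _) inv ?h2 // mem_cat ha.
  by rewrite -[RHS]inv ?mem_cat ?de ?orbT // /Words.wface (wopp_cat_r (x0 := l0)).
have LR : lab (last l0 a, true) != lab (head l0 a, false).
  by apply/eqP; rewrite h2 -b1; apply: neq; rewrite mem_cat la.
pose sa := map lab ([seq (l, true) | l <- a] ++ [seq (l, false) | l <- a]).
pose se := map lab ([seq (l, true) | l <- e] ++ [seq (l, false) | l <- e]).
have saP s r : reflect (exists2 d : wdart, d.1 \in s & lab d = r)
    (r \in map lab ([seq (l, true) | l <- s] ++ [seq (l, false) | l <- s])).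
  apply: (iffP mapP) => [[d ds ->]|[[l b] ls <-]].
    by exists d => //; move: ds; rewrite mem_cat => /orP[] /mapP[l ls ->].
  exists (l, b) => //; rewrite mem_cat.
  by case: (b); apply/orP; [left|right]; apply: (map_f (fun l => (l, _))).
pose Ra : finType := {r : R | r \in sa}; pose Re : finType := {r : R | r \in se}.
have card_sum : #|R| + 2 <= #|Ra| + #|Re|.
  have <- : #|pred2 (lab (last l0 a, true)) (lab (head l0 a, false))| = 2.
    by rewrite card2 LR.
  rewrite !card_sig -[leqRHS]cardUI; apply: leq_add.
    apply/subset_leq_card/subsetP => r _; change ((r \in sa) || (r \in se)).
    have [d] := surj r; rewrite mem_cat => /orP[] dd dr; apply/orP; [left|right];
      by apply/saP; exists d.
  apply/subset_leq_card/subsetP => r; change (((r == lab (last l0 a, true)) || (r == lab (head l0 a, false))) -> (r \in sa) && (r \in se)).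
  by case/orP=> /eqP ->; apply/andP; split; apply/saP;
     [exists (last l0 a, true) | exists (last l0 e, true) |
      exists (head l0 a, false) | exists (head l0 e, false)].
have planar_part s : gword s -> s <> [::] ->
    (forall d : wdart, d.1 \in s -> lab (wface s d) = lab d) ->
    exists labs : wdart -> {r : R | r \in map lab ([seq (l, true) | l <- s] ++ [seq (l, false) | l <- s])},
    (forall d : wdart, d.1 \in s -> labs (wface s d) = labs d) /\
    (forall r, exists2 d : wdart, d.1 \in s & labs d = r).
  move=> gs sn invs.
  have [l1 l1s] : exists l1, l1 \in s by case: (s) sn => // l s' _; exists l; rewrite mem_head.
  have r1P : lab (l1, true) \in map lab ([seq (l, true) | l <- s] ++ [seq (l, false) | l <- s]).
    by apply/saP; exists (l1, true).
  exists (fun d => insubd (Sub (lab (l1, true)) r1P) (lab d)); split.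
    by move=> d ds; rewrite invs.
  case=> r rP; have /saP[d ds dr] := rP; exists d => //.
  by apply: val_inj; rewrite val_insubd dr rP.
have [labsa [isa ssa]] := planar_part a gwa an inva.
have [labse [ise sse]] := planar_part e gwe en inve.
have c1 := wlabels_le gwa an isa ssa; have c2 := wlabels_le gwe en ise sse.
rewrite -/Ra in c1; rewrite -/Re in c2.
have sz : size (a ++ e) = size a + size e by rewrite size_cat.
split; split=> //; right.
  exists Ra, labsa; split=> //; rewrite sz in card_R; move: card_R card_sum c1 c2.
  by move: #|R| #|Ra| #|Re| (size a) (size e); clear; lia.
exists Re, labse; split=> //; rewrite sz in card_R; move: card_R card_sum c1 c2.
by move: #|R| #|Ra| #|Re| (size a) (size e); clear; lia.
Qed.

End Sum.

End WordSums.
Import WordSums.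

(** * Reidemeister moves with a choice of side *)

Module TurnedMoves.
Section Turn.
Variables (C : choiceType) (sg : C -> bool) (r : bool).
Local Notation wdart := (wdart C).
Implicit Types (w : seq (C * bool)) (d e : wdart).
Local Notation wcw := (wcw sg).
Local Notation wccw := (wccw sg).
Local Notation wface := (wface sg).
Local Notation good := (good sg).
Local Notation wsame := (wsame sg).

(* r is the side to which a strand is pushed: [wturn] is the clockwise quarter
   turn or, for the mirror image of the argument, the counterclockwise one. *)
Definition wturn (d : wdart) : wdart := if r then wcw d else wccw d.
Definition flip (d : wdart) : wdart := (d.1, ~~ d.2).

Lemma flipK : involutive flip.
Proof. by case=> l b; rewrite /flip /= negbK. Qed.

Lemma flip_neq d : flip d != d.
Proof. by case: d => l []; rewrite /flip /= xpair_eqE andbF. Qed.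

Lemma wturn_flip d : wturn (flip d) = flip (wturn d).
Proof. by case: d => [[v o] b]; rewrite /wturn /flip; case: r => /=; case: (_ == _); rewrite ?negbK. Qed.

Lemma wturn2 d : wturn (wturn d) = flip d.
Proof.
case: d => [[v o] b]; rewrite /wturn /flip; case: r => /=;
by case: (sg v) o => [] []; rewrite /= ?negbK.
Qed.

Lemma wturn_inj : injective wturn.
Proof. by move=> d e /(congr1 wturn); rewrite !wturn2 => /(inv_inj flipK). Qed.

Lemma wturn_letter d : (wturn d).1 = (d.1.1, ~~ d.1.2).
Proof. by case: d => [[v o] b]; rewrite /wturn; case: r. Qed.

Lemma mem_wturn w d : gword w -> ((wturn d).1 \in w) = (d.1 \in w).
Proof. by move=> gw; rewrite wturn_letter -(mem_wcw sg d gw); case: d => [[v o] b]. Qed.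

(** [lab] gives the region on the side chosen by [r]: on the left of the dart for the clockwise
    turn, on the right for the counterclockwise one. *)
Definition tlabels w (R : finType) (lab : wdart -> R) : Prop :=
  [/\ forall e, e.1 \in w -> lab (wturn e) = lab (wopp w e),
      forall x, exists2 d, d.1 \in w & lab d = x &
      size w + 4 <= 2 * #|R|].

Lemma tlabelsP w : gword w -> w <> [::] ->
  wplanar sg w <-> exists (R : finType) (lab : wdart -> R), tlabels w lab.
Proof.
move=> gw wn; have [u _] := andP gw; split.
  case=> // -[R [lab [inv surj le]]].
  exists R, (fun d => if r then lab d else lab (wopp w d)); split=> // [e ew|x].
    have key : lab (wcw e) = lab (wopp w e).
      by rewrite -(inv (wopp w e)) ?mem_wopp // /Words.wface woppK.
    rewrite /wturn; case: r => //; rewrite woppK //.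
    have := inv (wopp w (wccw e)); rewrite /Words.wface woppK // wccwK => -> //.
    by rewrite mem_wopp -(mem_wcw sg) ?wccwK.
  have [d dw dx] := surj x; case: r; first by exists d.
  by exists (wopp w d); rewrite ?mem_wopp ?woppK.
case=> R [lab [inv surj le]]; right.
exists R, (fun d => if r then lab d else lab (wopp w d)); split=> // [e ew|x].
  rewrite /Words.wface; move: inv; rewrite /wturn; case: r => inv.
    by rewrite inv ?mem_wopp ?woppK.
  by rewrite -inv ?wcwK // mem_wcw // mem_wopp.
have [d dw dx] := surj x; case: r; first by exists d.
by exists (wopp w d); rewrite ?mem_wopp ?woppK.
Qed.

Definition tface w d : wdart := wturn (wopp w d).

Lemma tface_rev w d d1 : uniq w -> ~~ r -> tface w d = d1 ->
  wface w (wopp w d1) = wopp w d.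
Proof.
by move=> u; rewrite /tface /wturn => /negPf -> <-; rewrite /Words.wface woppK // wccwK.
Qed.

Definition over_edge w d : bool := d.1.2 && (wopp w d).1.2.

Lemma over_edge_opp w d : uniq w -> over_edge w (wopp w d) = over_edge w d.
Proof. by move=> u; rewrite /over_edge woppK // andbC. Qed.

Lemma R2t_wsame w w' d d1 : gword w -> d.1 \in w ->
  tface w d = d1 -> tface w d1 = d -> d.1.1 != d1.1.1 ->
  over_edge w d || over_edge w d1 ->
  w' = [seq l <- w | (l.1 != d.1.1) && (l.1 != d1.1.1)] -> wsame w w'.
Proof.
move=> gw; have [u _] := andP gw.
have H y y1 : y.1 \in w -> tface w y = y1 -> tface w y1 = y -> y.1.1 != y1.1.1 ->
    over_edge w y -> w' = [seq l <- w | (l.1 != y.1.1) && (l.1 != y1.1.1)] -> wsame w w'.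
  move=> yw f1 f2 ne ov w'E; case rE : r.
    have fE z : wface w z = tface w z by rewrite /tface /wturn rE.
    by apply: (R2_wsame (d := y)); rewrite ?fE ?f1.
  have nr : ~~ r by rewrite rE.
  have vE z : (wopp w z).1.1 = (tface w z).1.1 by rewrite /tface wturn_letter.
  have g1 := tface_rev u nr f1; have g2 := tface_rev u nr f2.
  apply: (R2_wsame (d := wopp w y)); rewrite ?mem_wopp ?g2 ?g1 //.
  - by rewrite !vE f1 f2 eq_sym.
  - by rewrite -/(over_edge w (wopp w y)) over_edge_opp.
  by rewrite !vE f1 f2 w'E; apply: eq_filter => l; rewrite andbC.
move=> dw f1 f2 ne /orP[] ov w'E; first exact: (H d d1).
apply: (H d1 d) => //; last by rewrite w'E; apply: eq_filter => l; rewrite andbC.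
  by rewrite -f1 /tface mem_wturn // mem_wopp.
by rewrite eq_sym.
Qed.

Definition lswap (x y l : C * bool) : C * bool :=
  if l == x then y else if l == y then x else l.

Lemma lswapK x y : involutive (lswap x y).
Proof.
move=> l; rewrite /lswap; case: (eqVneq l x) => [->|lx].
  by rewrite eqxx; case: (eqVneq y x).
case: (eqVneq l y) => [->|ly]; first by rewrite eqxx.
by rewrite (negPf lx) (negPf ly).
Qed.

Lemma lswapC x y l : lswap x y l = lswap y x l.
Proof. by rewrite /lswap; case: (eqVneq l x) => [->|//]; case: (eqVneq x y). Qed.

Lemma lswap_out x y l : l != x -> l != y -> lswap x y l = l.
Proof. by rewrite /lswap => /negPf -> /negPf ->. Qed.

Lemma lswap_l x y : lswap x y x = y.
Proof. by rewrite /lswap eqxx. Qed.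

Lemma lswap_r x y : lswap x y y = x.
Proof. by rewrite lswapC lswap_l. Qed.

Lemma lswap_comm x y z t l : uniq [:: x; y; z; t] ->
  lswap x y (lswap z t l) = lswap z t (lswap x y l).
Proof.
rewrite /= !inE !negb_or => /and4P[/and3P[xy xz xt] /andP[yz yt] zt _].
case: (eqVneq l x) => [->|lx].
  by rewrite (lswap_out (x := z)) // /lswap eqxx (negPf yz) (negPf yt).
case: (eqVneq l y) => [->|ly].
  rewrite (lswap_out (x := z)) // /lswap eqxx (eq_sym y) (negPf xy).
  by rewrite (negPf xz) (negPf xt).
rewrite (lswap_out (x := x) (l := l)) //.
case: (eqVneq l z) => [->|lz].
  by rewrite /lswap eqxx (eq_sym t) (negPf xt) eq_sym (negPf yt).
case: (eqVneq l t) => [->|lt].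
  by rewrite /lswap eqxx (eq_sym t z) (negPf zt) (eq_sym z) (negPf xz) eq_sym (negPf yz).
by rewrite (lswap_out (x := z)) // (lswap_out (x := x)).
Qed.

Section Triangle.
Variables (w : seq (C * bool)) (d0 d1 d2 : wdart).
Hypothesis gw : gword w.
Hypothesis d0w : d0.1 \in w.
Hypothesis f0 : tface w d0 = d1.
Hypothesis f1 : tface w d1 = d2.
Hypothesis f2 : tface w d2 = d0.
Hypothesis vd : uniq [:: d0.1.1; d1.1.1; d2.1.1].
Local Notation op := (wopp w).

Definition triangle_swap (l : C * bool) : C * bool :=
  lswap d0.1 (op d0).1 (lswap d1.1 (op d1).1 (lswap d2.1 (op d2).1 l)).

Let u : uniq w. Proof. by case/andP: gw. Qed.

Lemma triangle_letters :
  [/\ (op d0).1 = (d1.1.1, ~~ d1.1.2), (op d1).1 = (d2.1.1, ~~ d2.1.2) &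
      (op d2).1 = (d0.1.1, ~~ d0.1.2)].
Proof.
have H x y : tface w x = y -> (op x).1 = (y.1.1, ~~ y.1.2).
  by move=> <-; rewrite /tface wturn_letter /= negbK -surjective_pairing.
by rewrite !(H _ _ f0) (H _ _ f1) (H _ _ f2).
Qed.

Lemma triangle_uniq :
  uniq [:: d0.1; (op d0).1; d1.1; (op d1).1; d2.1; (op d2).1].
Proof.
have [-> -> ->] := triangle_letters.
move: vd; case: d0 d1 d2 => [[v0 p0] b0] [[v1 p1] b1] [[v2 p2] b2] /=.
rewrite !inE !negb_or !andbT => /andP[/andP[v01 v02] v12].
rewrite !xpair_eqE /= !eqxx ?(negPf v01) ?(negPf v02) ?(negPf v12) ?(eq_sym v1 v0).
rewrite ?(eq_sym v2 v0) ?(eq_sym v2 v1) ?(negPf v01) ?(negPf v02) ?(negPf v12) /=.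
by case: p0; case: p1; case: p2.
Qed.

Lemma mem_triangle : [/\ d1.1 \in w, d2.1 \in w & d0.1 \in w].
Proof.
have H x y : tface w x = y -> x.1 \in w -> y.1 \in w.
  by move=> <- xw; rewrite /tface mem_wturn // mem_wopp.
by have h1 := H _ _ f0 d0w; split=> //; apply: H f1 h1.
Qed.

Let c01 l : lswap d0.1 (op d0).1 (lswap d1.1 (op d1).1 l) =
            lswap d1.1 (op d1).1 (lswap d0.1 (op d0).1 l).
Proof. by apply: lswap_comm; apply: subseq_uniq triangle_uniq; rewrite /= !eqxx. Qed.

Let c02 l : lswap d0.1 (op d0).1 (lswap d2.1 (op d2).1 l) =
            lswap d2.1 (op d2).1 (lswap d0.1 (op d0).1 l).
Proof.
apply: lswap_comm; apply: subseq_uniq triangle_uniq.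
by apply: (@mask_subseq _ [:: true; true; false; false; true; true]
   [:: d0.1; (op d0).1; d1.1; (op d1).1; d2.1; (op d2).1]).
Qed.

Let c12 l : lswap d1.1 (op d1).1 (lswap d2.1 (op d2).1 l) =
            lswap d2.1 (op d2).1 (lswap d1.1 (op d1).1 l).
Proof.
apply: lswap_comm; apply: subseq_uniq triangle_uniq.
by apply: (@mask_subseq _ [:: false; false; true; true; true; true]
   [:: d0.1; (op d0).1; d1.1; (op d1).1; d2.1; (op d2).1]).
Qed.

(** The move as defined starts at the top side and has the triangle on its left. Rotating the three
    sides and, for the other [r], reversing them reduces to this; the three exchanges of letters
    commute. *)
Lemma R3t_wsame : [|| over_edge w d0, over_edge w d1 | over_edge w d2] ->
  wsame w (map triangle_swap w).
Proof.
move=> ov; have [d1w d2w _] := mem_triangle; have [l0 l1 l2] := triangle_letters.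
have swE z l : wswap w z l = lswap z.1 (op z).1 l by [].
have swoE z l : wswap w (op z) l = lswap z.1 (op z).1 l by rewrite swE woppK // lswapC.
move: vd; rewrite /= !inE !negb_or !andbT => /andP[/andP[v01 v02] v12].
have v10 : d1.1.1 != d0.1.1 by rewrite eq_sym.
have v20 : d2.1.1 != d0.1.1 by rewrite eq_sym.
have v21 : d2.1.1 != d1.1.1 by rewrite eq_sym.
case rE : r.
  have fE z : wface w z = tface w z by rewrite /tface /wturn rE.
  case/or3P: ov => ov.
  - apply: (R3_wsame (d := d0)); rewrite ?fE ?f0 ?fE ?f1 ?fE ?f2 //.
  - apply: (R3_wsame (d := d1)); rewrite ?fE ?f1 ?fE ?f2 ?fE ?f0 //.
      by rewrite /= !inE !negb_or ?v01 ?v02 ?v12 ?v10 ?v20 ?v21.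
    by apply: eq_map => l; rewrite !swE /triangle_swap c01 c02.
  apply: (R3_wsame (d := d2)); rewrite ?fE ?f2 ?fE ?f0 ?fE ?f1 //.
    by rewrite /= !inE !negb_or ?v01 ?v02 ?v12 ?v10 ?v20 ?v21.
  by apply: eq_map => l; rewrite !swE /triangle_swap c12 c02.
have nr : ~~ r by rewrite rE.
have g0 := tface_rev u nr f0; have g1 := tface_rev u nr f1; have g2 := tface_rev u nr f2.
have ovo z : (op z).1.2 && (op (op z)).1.2 = over_edge w z.
  by rewrite -/(over_edge w (op z)) over_edge_opp.
case/or3P: ov => ov.
- apply: (R3_wsame (d := op d0)); rewrite ?g2 ?g1 ?g0 ?mem_wopp ?ovo //.
    by rewrite l0 l1 l2 /= !inE !negb_or ?v01 ?v02 ?v12 ?v10 ?v20 ?v21.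
  by apply: eq_map => l; rewrite !swoE /triangle_swap c12.
- apply: (R3_wsame (d := op d1)); rewrite ?g0 ?g2 ?g1 ?mem_wopp ?ovo //.
    by rewrite l0 l1 l2 /= !inE !negb_or ?v01 ?v02 ?v12 ?v10 ?v20 ?v21.
  by apply: eq_map => l; rewrite !swoE /triangle_swap c01.
apply: (R3_wsame (d := op d2)); rewrite ?g1 ?g0 ?g2 ?mem_wopp ?ovo //.
  by rewrite l0 l1 l2 /= !inE !negb_or ?v01 ?v02 ?v12 ?v10 ?v20 ?v21.
by apply: eq_map => l; rewrite !swoE /triangle_swap c01 c02 c12.
Qed.

Lemma triangle_swapK : involutive triangle_swap.
Proof.
by move=> l; rewrite /triangle_swap -c02 -c12 -c01 !lswapK.
Qed.

Lemma triangle_swapE x y :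
  (x, y) \in [:: (d0.1, (op d0).1); (d1.1, (op d1).1); (d2.1, (op d2).1)] ->
  triangle_swap x = y /\ triangle_swap y = x.
Proof.
move: triangle_uniq; rewrite /= !inE !negb_or !andbT.
case/and5P => /and5P[n01 n02 n03 n04 n05] /and4P[n12 n13 n14 n15].
move=> /and3P[n23 n24 n25] /andP[n34 n35] n45.
have sy a b : a != b -> b != a by rewrite eq_sym.
rewrite /triangle_swap; case/or3P=> /eqP[-> ->].
- by rewrite !(lswap_out (x := d2.1)) // !(lswap_out (x := d1.1)) // lswap_l lswap_r.
- rewrite !(lswap_out (x := d2.1)) // lswap_l lswap_r.
  by rewrite !(lswap_out (x := d0.1)) // sy.
rewrite lswap_l lswap_r !(lswap_out (x := d1.1)) // 1?sy //.
by rewrite !(lswap_out (x := d0.1)) // sy.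
Qed.

Lemma triangle_swap_out l :
  l \notin [:: d0.1; (op d0).1; d1.1; (op d1).1; d2.1; (op d2).1] ->
  triangle_swap l = l.
Proof.
rewrite !inE !negb_or => /and5P[h1 h2 h3 h4 /andP[h5 h6]].
by rewrite /triangle_swap !lswap_out.
Qed.

(** Each side is pushed over the opposite vertex: where it had the triangle, it now borders the
    region that faced the triangle across that vertex, and on its other side lies the new triangle,
    which takes the label of the old one. All other labels stay. *)
Lemma triangle_good : good w -> good (map triangle_swap w).
Proof.
move=> [_ pw]; have [d1w d2w _] := mem_triangle; have [l0 l1 l2] := triangle_letters.
have phiK := triangle_swapK; set phi := triangle_swap in phiK *.
have U := triangle_uniq.
have phiE x y : (x, y) \in [:: (d0.1, (op d0).1); (d1.1, (op d1).1); (d2.1, (op d2).1)] ->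
    phi x = y /\ phi y = x by apply: triangle_swapE.
have [p0 q0] := phiE d0.1 (op d0).1 (mem_head _ _).
have [p1 q1] : phi d1.1 = (op d1).1 /\ phi (op d1).1 = d1.1
  by apply: (phiE d1.1 (op d1).1); rewrite !inE eqxx orbT.
have [p2 q2] : phi d2.1 = (op d2).1 /\ phi (op d2).1 = d2.1
  by apply: (phiE d2.1 (op d2).1); rewrite !inE eqxx !orbT.
pose six := [:: d0.1; (op d0).1; d1.1; (op d1).1; d2.1; (op d2).1].
have six_w l : l \in six -> l \in w.
  by rewrite !inE => /or4P[| | |/or3P[]] /eqP ->; rewrite ?mem_wopp.
have phi_out l : l \notin six -> phi l = l by apply: triangle_swap_out.
have six_phi l : (phi l \in six) = (l \in six).
  have H x : x \in six -> phi x \in six.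
    rewrite !inE => /or4P[| | |/or3P[]] /eqP ->;
    by rewrite ?p0 ?p1 ?p2 ?q0 ?q1 ?q2 eqxx ?orbT.
  by apply/idP/idP => /H //; rewrite phiK.
have phi_w l : (phi l \in w) = (l \in w).
  case: (boolP (l \in six)) => ls; last by rewrite phi_out.
  by rewrite !six_w ?six_phi.
have w'E l : (l \in map phi w) = (l \in w).
  by rewrite -[in LHS](phiK l) (mem_map (inv_inj phiK)) phi_w.
have gw' : gword (map phi w).
  apply/andP; split; first by rewrite (map_inj_uniq (inv_inj phiK)).
  by apply/allP => l; rewrite !w'E; case/andP: gw => _ /allP; apply.
have wn : w <> [::] by case: (w) d0w.
have w'n : map phi w <> [::] by case: (w) d0w.
have [R [lab [inv surj card_R]]] := iffLR (tlabelsP gw wn) pw.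
split=> //; apply/(tlabelsP gw' w'n).
pose Phi (d : wdart) : wdart := (phi d.1, d.2).
have PhiK : involutive Phi by move=> [l b]; rewrite /Phi phiK.
have oppPhi d : wopp (map phi w) (Phi d) = Phi (op d).
  case: d => l []; rewrite /wopp /Phi /=; congr (_, _).
    by rewrite (next_map (inv_inj phiK)).
  by rewrite (prev_map (inv_inj phiK)).
pose int := [:: d0; op d0; d1; op d1; d2; op d2].
have int_six d : d \in int -> d.1 \in six.
  by rewrite !inE => /or4P[| | |/or3P[]] /eqP ->; rewrite eqxx ?orbT.
have six_inj x y : x \in int -> y \in int -> x.1 = y.1 -> x = y.
  have U1 : uniq (map fst int) by exact: U.
  move=> xi yi e; apply/eqP; move/uniqP: U1 => /(_ d0.1) U1.
  rewrite -(nth_index d0 xi) -(nth_index d0 yi); apply/eqP; congr nth.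
  apply: U1; rewrite ?inE ?size_map ?index_mem //.
  by rewrite !(nth_map d0) ?index_mem // !nth_index.
have int_uniq : uniq int.
  by apply: (map_uniq (f := fst)); exact: U.
have int_op x : (op x \in int) = (x \in int).
  have H y : y \in int -> op y \in int.
    by rewrite !inE => /or4P[| | |/or3P[]] /eqP ->; rewrite ?woppK // eqxx ?orbT.
  by apply/idP/idP => /H //; rewrite woppK.
have ext x : x \in int -> flip x \notin int.
  move=> xi; apply/negP => fi; have := six_inj _ _ fi xi erefl => /eqP.
  by rewrite (negPf (flip_neq x)).
pose lab2 (e : wdart) := if e == d0 then lab (flip d2) else
  if e == d1 then lab (flip d0) else if e == d2 then lab (flip d1) else
  if e \in int then lab d0 else lab e.
have lab2_out e : e \notin int -> lab2 e = lab e.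
  move=> en; rewrite /lab2 (negPf en).
  move: en; rewrite !inE !negb_or => /and5P[h1 _ h2 _ /andP[h3 _]].
  by rewrite (negPf h1) (negPf h2) (negPf h3).
move: (int_uniq); rewrite [uniq _]/= !inE !negb_or !andbT.
case/and5P => /and5P[n01 n02 n03 n04 n05] /and4P[n12 n13 n14 n15].
move=> /and3P[n23 n24 n25] /andP[n34 n35] n45.
have sy (a b : wdart) : a != b -> b != a by rewrite eq_sym.
have L0 : lab2 d0 = lab (flip d2) by rewrite /lab2 eqxx.
have L1 : lab2 d1 = lab (flip d0) by rewrite /lab2 (negPf (sy _ _ n02)) eqxx.
have L2 : lab2 d2 = lab (flip d1).
  by rewrite /lab2 (negPf (sy _ _ n04)) (negPf (sy _ _ n24)) eqxx.
have Lo x : x \in [:: op d0; op d1; op d2] -> lab2 x = lab d0.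
  rewrite !inE => /or3P[] /eqP ->; rewrite /lab2.
  - by rewrite (negPf (sy _ _ n01)) (negPf n12) (negPf n14) !inE eqxx orbT.
  - by rewrite (negPf (sy _ _ n03)) (negPf (sy _ _ n23)) (negPf n34) !inE eqxx !orbT.
  by rewrite (negPf (sy _ _ n05)) (negPf (sy _ _ n25)) (negPf (sy _ _ n45)) !inE eqxx !orbT.
have op2 x : (op x).2 = ~~ x.2 by rewrite /wopp; case: x.2.
have H a b c : a \in int -> b \in int -> c \in int ->
    tface w a = b -> tface w b = c -> tface w c = a ->
    phi a.1 = (op a).1 -> phi (op a).1 = a.1 ->
    phi b.1 = (op b).1 -> phi (op b).1 = b.1 ->
    phi c.1 = (op c).1 -> phi (op c).1 = c.1 ->
    lab2 a = lab (flip c) -> lab2 c = lab (flip b) ->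
    lab2 (op a) = lab2 (op b) ->
    forall e, e.1 = a.1 \/ e.1 = (op a).1 -> lab2 (Phi (wturn (Phi e))) = lab2 (op e).
  move=> ai bi ci fa fb fc pa qa pb qb pc qc La Lc Lab.
  have Pa : Phi a = flip (op a) by rewrite /Phi /flip pa op2 negbK.
  have Pfa : Phi (flip a) = op a by rewrite /Phi /flip /= pa -op2 -surjective_pairing.
  have Poa : Phi (op a) = flip a by rewrite /Phi /flip qa op2.
  have Pfoa : Phi (flip (op a)) = a by rewrite /Phi /flip /= qa op2 negbK -surjective_pairing.
  have Pb : Phi b = flip (op b) by rewrite /Phi /flip pb op2 negbK.
  have Pfb : Phi (flip b) = op b by rewrite /Phi /flip /= pb -op2 -surjective_pairing.
  have Poc : Phi (op c) = flip c by rewrite /Phi /flip qc op2.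
  have Pfoc : Phi (flip (op c)) = c by rewrite /Phi /flip /= qc op2 negbK -surjective_pairing.
  have ta : wturn (op a) = b by [].
  have tb : wturn (op b) = c by [].
  have tc : wturn (op c) = a by [].
  have ta2 : wturn a = flip (op c) by rewrite -tc wturn2.
  have tc2 : wturn c = flip (op b) by rewrite -tb wturn2.
  have inw x : x \in int -> x.1 \in w by move=> xi; apply: six_w; apply: int_six.
  have out x : x \in int -> op (flip x) \notin int by move=> xi; rewrite int_op ext.
  have E4 e : e.1 = a.1 \/ e.1 = (op a).1 -> [\/ e = a, e = flip a, e = op a | e = flip (op a)].
    have P4 (x : wdart) : e.1 = x.1 -> e = x \/ e = flip x.
      case: e x => l b1 [l' b2] /= ->; rewrite /flip /=.
      by case: b1; case: b2; auto.
    by case=> /P4[] ->; [constructor 1|constructor 2|constructor 3|constructor 4].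
  move=> e /E4[] ->.
  - by rewrite Pa wturn_flip ta Pfb.
  - rewrite Pfa ta Pb !lab2_out ?out ?ext ?int_op //.
    rewrite -tc2 inv ?inw // -[RHS]inv; last exact: (inw a).
    by rewrite wturn_flip ta2 flipK.
  - by rewrite Poa wturn_flip ta2 flipK Poc woppK // La lab2_out ?ext.
  rewrite Pfoa ta2 Pfoc Lc lab2_out ?out ?int_op // -[RHS]inv.
    by rewrite wturn_flip ta.
  by rewrite [X in X \in _]/= mem_wopp inw.
have i0 : d0 \in int by rewrite !inE eqxx.
have i1 : d1 \in int by rewrite !inE eqxx !orbT.
have i2 : d2 \in int by rewrite !inE eqxx !orbT.
exists R, (fun d => lab2 (Phi d)); split.
- move=> d; rewrite w'E => dw; rewrite -[in RHS](PhiK d) oppPhi PhiK.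
  rewrite -[in LHS](PhiK d); have : (Phi d).1 \in w by rewrite phi_w.
  move: (Phi d) => {d dw} e ew.
  case: (boolP (e.1 \in six)) => es; last first.
    have eo : op e \notin int by rewrite int_op; apply: contra es => /int_six.
    have ts : (wturn e).1 \notin six.
      have nsix k : k \in six -> (k.1, ~~ k.2) \in six.
        rewrite /six l0 l1 l2 !inE => /or4P[| | |/or3P[]] /eqP ->;
        by rewrite /= ?negbK -?surjective_pairing eqxx ?orbT.
      apply: contra es; rewrite wturn_letter => /nsix.
      by rewrite /= negbK -surjective_pairing.
    have -> : Phi e = e by rewrite /Phi phi_out // -surjective_pairing.
    have -> : Phi (wturn e) = wturn e by rewrite /Phi phi_out // -surjective_pairing.
    rewrite !lab2_out ?inv //; apply: contra ts; exact: int_six.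
  have Lo01 : lab2 (op d0) = lab2 (op d1) by rewrite !Lo ?inE ?eqxx ?orbT.
  have Lo12 : lab2 (op d1) = lab2 (op d2) by rewrite !Lo ?inE ?eqxx ?orbT.
  move: es; rewrite !inE => /or4P[| | |/or3P[]] /eqP eE.
  + by apply: (H d0 d1 d2); rewrite ?eE; auto.
  + by apply: (H d0 d1 d2); rewrite ?eE; auto.
  + by apply: (H d1 d2 d0); rewrite ?eE; auto.
  + by apply: (H d1 d2 d0); rewrite ?eE; auto.
  + by apply: (H d2 d0 d1); rewrite ?eE -?Lo12 -?Lo01; auto.
  by apply: (H d2 d0 d1); rewrite ?eE -?Lo12 -?Lo01; auto.
- have T1 : lab d1 = lab d0 by rewrite -f0 /tface inv ?mem_wopp // woppK.
  have T2 : lab d2 = lab d0 by rewrite -f1 /tface inv ?mem_wopp // woppK.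
  move=> x; suff [e ew ex] : exists2 e : wdart, e.1 \in w & lab2 e = x.
    by exists (Phi e); rewrite ?PhiK // w'E phi_w.
  have ext_op a b : tface w a = b -> op a \in int -> b \in int -> b.1 \in w -> 
      exists2 e : wdart, e.1 \in w & lab2 e = lab (op b).
    move=> fa oai bi bw; exists (wturn b); first by rewrite mem_wturn.
    by rewrite -inv // -fa /tface wturn2 lab2_out // ext.
  have io x' : (op x' \in int) = (x' \in int) by apply: int_op.
  have [d dw <-] := surj x; case: (boolP (d \in int)) => di; last first.
    by exists d => //; rewrite lab2_out.
  have e0 : exists2 e : wdart, e.1 \in w & lab2 e = lab d0.
    by exists (op d0); rewrite ?mem_wopp // Lo // mem_head.
  move: di; rewrite !inE => /or4P[| | |/or3P[]] /eqP ->; rewrite ?T1 ?T2 //.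
  + by apply: (ext_op d2 d0); rewrite ?io.
  + by apply: (ext_op d0 d1); rewrite ?io.
  by apply: (ext_op d1 d2); rewrite ?io.
by rewrite size_map.
Qed.

End Triangle.

End Turn.

End TurnedMoves.
Import TurnedMoves.

(** * Planarity when a bigon is removed or inserted *)

Module Bigons.
Section Bigon.
Variables (C : choiceType) (sg : C -> bool) (r : bool).
Local Notation wdart := (wdart C).
Local Notation turn := (wturn sg r).
(* W is w with a bigon added: de and d1 are its sides, and the edges al-al' and
   be-be' of w are the two that come to overlap. *)
Variables (w W : seq (C * bool)) (de de' d1 d1' al al' be be' : wdart).
Hypothesis gw : gword w.
Hypothesis gW : gword W.
Hypothesis wn : w <> [::].
Hypothesis letters : uniq [:: de.1; de'.1; d1.1; d1'.1].
Hypothesis memW : forall l, (l \in W) = (l \in w) || (l \in [:: de.1; de'.1; d1.1; d1'.1]).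
Hypothesis newl : forall l, l \in [:: de.1; de'.1; d1.1; d1'.1] -> l \notin w.
Hypothesis o_de : wopp W de = de'.
Hypothesis o_d1 : wopp W d1 = d1'.
Hypothesis o_fde : wopp W (flip de) = al.
Hypothesis o_fde' : wopp W (flip de') = al'.
Hypothesis o_fd1 : wopp W (flip d1) = be.
Hypothesis o_fd1' : wopp W (flip d1') = be'.
Hypothesis t_de' : turn de' = d1.
Hypothesis t_d1' : turn d1' = de.
Hypothesis o_al : wopp w al = al'.
Hypothesis o_be : wopp w be = be'.
Hypothesis alw : al.1 \in w.
Hypothesis bew : be.1 \in w.
Hypothesis alw' : al'.1 \in w.
Hypothesis bew' : be'.1 \in w.
Hypothesis o_old : forall e : wdart, e.1 \in w -> e \notin [:: al; al'; be; be'] ->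
  wopp W e = wopp w e.
Hypothesis sizeW : size W = size w + 4.

Let uw : uniq w. Proof. by case/andP: gw. Qed.
Let uW : uniq W. Proof. by case/andP: gW. Qed.

Let o_de' : wopp W de' = de. Proof. by rewrite -o_de woppK. Qed.
Let o_d1' : wopp W d1' = d1. Proof. by rewrite -o_d1 woppK. Qed.
Let o_Wal : wopp W al = flip de. Proof. by rewrite -o_fde woppK. Qed.
Let o_Wal' : wopp W al' = flip de'. Proof. by rewrite -o_fde' woppK. Qed.
Let o_Wbe : wopp W be = flip d1. Proof. by rewrite -o_fd1 woppK. Qed.
Let o_Wbe' : wopp W be' = flip d1'. Proof. by rewrite -o_fd1' woppK. Qed.
Let o_al' : wopp w al' = al. Proof. by rewrite -o_al woppK. Qed.
Let o_be' : wopp w be' = be. Proof. by rewrite -o_be woppK. Qed.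
Let t_d1 : turn d1 = flip de'. Proof. by rewrite -t_de' wturn2. Qed.
Let t_de : turn de = flip d1'. Proof. by rewrite -t_d1' wturn2. Qed.
Let t_fde' : turn (flip de') = flip d1. Proof. by rewrite wturn_flip t_de'. Qed.
Let t_fd1' : turn (flip d1') = flip de. Proof. by rewrite wturn_flip t_d1'. Qed.
Let t_fd1 : turn (flip d1) = de'. Proof. by rewrite wturn_flip t_d1 flipK. Qed.
Let t_fde : turn (flip de) = d1'. Proof. by rewrite wturn_flip t_de flipK. Qed.

Let new_darts (d : wdart) : d.1 \in [:: de.1; de'.1; d1.1; d1'.1] ->
  d \in [:: de; flip de; de'; flip de'; d1; flip d1; d1'; flip d1'].
Proof.
have P (x : wdart) : d.1 = x.1 -> d = x \/ d = flip x.
  case: d x => l b [l' b'] /= ->; rewrite /flip /=; case: b; case: b'; auto.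
by rewrite !inE => /or4P[] /eqP /P[] ->; rewrite eqxx ?orbT.
Qed.

(** Separating the strands merges the regions [X] and [Y] at the two tips of the bigon and absorbs
    the bigon itself: at most two labels are lost, as many as crossings. *)
Lemma bigon_remove : wplanar sg W -> wplanar sg w.
Proof.
move=> pW; have Wn : W <> [::].
  by move=> W0; move: sizeW; rewrite W0 addnC.
have [R [lab [inv surj card_R]]] := iffLR (tlabelsP sg r gW Wn) pW.
apply/(tlabelsP sg r gw wn).
have newW l : l \in [:: de.1; de'.1; d1.1; d1'.1] -> l \in W.
  by move=> h; rewrite memW h orbT.
have i_de : de.1 \in W by apply: newW; rewrite !inE eqxx.
have i_de' : de'.1 \in W by apply: newW; rewrite !inE eqxx orbT.
have i_d1 : d1.1 \in W by apply: newW; rewrite !inE eqxx !orbT.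
have i_d1' : d1'.1 \in W by apply: newW; rewrite !inE eqxx !orbT.
have old (d : wdart) : d.1 \in w -> d.1 \in W by move=> dw; rewrite memW dw.
pose X := lab (flip d1); pose Y := lab (flip de).
have E1 : lab al' = X by rewrite -o_fde' -inv // t_fde'.
have E2 : lab al = lab d1' by rewrite -o_fde -inv // t_fde.
have E3 : lab (flip de') = lab d1' by rewrite -t_d1 inv // o_d1.
have E4 : lab be' = Y by rewrite -o_fd1' -inv // t_fd1'.
have E5 : lab be = lab de' by rewrite -o_fd1 -inv // t_fd1.
have E6 : lab (flip d1') = lab de' by rewrite -t_de inv // o_de.
have E7 : lab d1 = lab de by rewrite -t_de' inv // o_de'.
pose labw e := if lab e == X then Y else lab e.
pose dl := [seq (l, true) | l <- w] ++ [seq (l, false) | l <- w].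
have dlP (d : wdart) : (d \in dl) = (d.1 \in w).
  rewrite mem_cat; apply/orP/idP => [[] /mapP[l lw ->] //|].
  by case: d => l [] lw; [left|right]; apply/mapP; exists l.
pose R' : finType := {x : R | x \in map labw dl}.
have labwP e : e.1 \in w -> labw e \in map labw dl by move=> ew; rewrite map_f // dlP.
pose lab' e : R' := insubd (Sub (labw al) (labwP al alw) : R') (labw e).
have lab'E e : e.1 \in w -> val (lab' e) = labw e.
  by move=> ew; rewrite val_insubd labwP.
exists R', lab'; split.
- move=> e ew; apply: val_inj; rewrite !lab'E ?mem_wopp ?mem_wturn //.
  case: (boolP (e \in [:: al; al'; be; be'])) => [|en]; last first.
    by rewrite /labw inv ?old // o_old.
  rewrite !inE => /or4P[] /eqP ->; rewrite /labw inv ?old // ?o_Wal ?o_Wal' ?o_Wbe ?o_Wbe'.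
  + by rewrite o_al E1 eqxx -/Y; case: eqP.
  + by rewrite o_al' E2 E3.
  + by rewrite o_be E4 -/X eqxx; case: eqP.
  by rewrite o_be' E5 E6.
- case=> x xP; have /mapP[d] := xP; rewrite dlP => dw dx; exists d => //.
  by apply: val_inj; rewrite lab'E.
have le : #|R| <= #|R'| + 2.
  have c2 : #|pred2 (lab de) X| <= 2 by rewrite card2 ltnS leq_b1.
  apply: leq_trans (leq_add (leqnn _) c2); rewrite card_sig -cardUI.
  apply: leq_trans (leq_addr _ _); apply/subset_leq_card/subsetP => x _.
  change ((x \in map labw dl) || ((x == lab de) || (x == X))).
  case: (eqVneq x (lab de)) => [_|xde]; first by rewrite orbT.
  case: (eqVneq x X) => [_|xX]; first by rewrite !orbT.
  rewrite /= orbF; suff [d dw dx] : exists2 d : wdart, d.1 \in w & lab d = x.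
    by apply/mapP; exists d; rewrite ?dlP // /labw dx (negPf xX).
  have [d] := surj x; rewrite memW => /orP[dw dx|]; first by exists d.
  move/new_darts; rewrite !inE => H dx; move: xde xX; rewrite -dx.
  move: H => /or4P[/eqP ->|/eqP -> _ _|/eqP -> _ _|/or4P[]].
  + by rewrite eqxx.
  + by exists be'.
  + by exists be.
  + by move/eqP => -> _ _; exists al; rewrite // E2 E3.
  + by move/eqP => ->; rewrite E7 eqxx.
  + by move/eqP => ->; rewrite eqxx.
  by case/orP => /eqP -> _ _; [exists al | exists be; rewrite // E6].
move: card_R le; rewrite sizeW; move: #|R| #|R'| (size w); clear; lia.
Qed.

Variable ta : wdart.
Hypothesis t_be : turn be = ta.
Hypothesis f_ta : turn (wopp w ta) = al'.
Hypothesis taw : ta.1 \in w.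
Hypothesis ta_al : ta != al.
Hypothesis ta_al' : ta != al'.
Hypothesis ta_be' : ta != be'.
Hypothesis old4 : uniq [:: al; al'; be; be'].

(** The two edges border a common region, along which the edge of [ta] runs from one to the other.
    The bigon gets the label [None], the piece of the region between the bigon and [ta] gets
    [Some None], and the rest keeps its label: two labels more for two crossings more. *)
Lemma bigon_insert : wplanar sg w -> wplanar sg W.
Proof.
move=> pw; have Wn : W <> [::].
  by move=> W0; move: sizeW; rewrite W0 addnC.
have [R [lab [inv surj card_R]]] := iffLR (tlabelsP sg r gw wn) pw.
apply/(tlabelsP sg r gW Wn).
move: letters; rewrite /= !inE !negb_or !andbT.
case/and3P => /and3P[l01 l02 l03] /andP[l12 l13] l23.
have nE (x y : wdart) : x.1 != y.1 -> (x == y) = false.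
  by move=> ne; apply/negP => /eqP e; rewrite e eqxx in ne.
have sy (x y : C * bool) : x != y -> y != x by rewrite eq_sym.
pose lab' (e : wdart) : option (option R) :=
  if e.1 \in w then if (e == ta) || (e == al') then Some None else Some (Some (lab e))
  else if e.1 == de.1 then if e == de then None else Some (Some (lab be'))
  else if e.1 == de'.1 then if e == de' then Some (Some (lab be)) else Some (Some (lab al))
  else if e.1 == d1.1 then if e == d1 then None else Some None
  else if e == d1' then Some (Some (lab al)) else Some (Some (lab be)).
have n_de : de.1 \in w = false by apply/negbTE/newl; rewrite !inE eqxx.
have n_de' : de'.1 \in w = false by apply/negbTE/newl; rewrite !inE eqxx orbT.
have n_d1 : d1.1 \in w = false by apply/negbTE/newl; rewrite !inE eqxx !orbT.
have n_d1' : d1'.1 \in w = false by apply/negbTE/newl; rewrite !inE eqxx !orbT.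
have L1 : lab' de = None by rewrite /lab' n_de !eqxx.
have L2 : lab' (flip de) = Some (Some (lab be')).
  by rewrite /lab' /= n_de eqxx (negPf (flip_neq _)).
have L3 : lab' de' = Some (Some (lab be)).
  by rewrite /lab' n_de' (negPf (sy _ _ l01)) !eqxx.
have L4 : lab' (flip de') = Some (Some (lab al)).
  by rewrite /lab' /= n_de' (negPf (sy _ _ l01)) eqxx (negPf (flip_neq _)).
have L5 : lab' d1 = None.
  by rewrite /lab' n_d1 (negPf (sy _ _ l02)) (negPf (sy _ _ l12)) !eqxx.
have L6 : lab' (flip d1) = Some None.
  by rewrite /lab' /= n_d1 (negPf (sy _ _ l02)) (negPf (sy _ _ l12)) eqxx (negPf (flip_neq _)).
have L7 : lab' d1' = Some (Some (lab al)).
  by rewrite /lab' n_d1' (negPf (sy _ _ l03)) (negPf (sy _ _ l13)) (negPf (sy _ _ l23)) eqxx.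
have L8 : lab' (flip d1') = Some (Some (lab be)).
  rewrite /lab' /= n_d1' (negPf (sy _ _ l03)) (negPf (sy _ _ l13)) (negPf (sy _ _ l23)).
  by rewrite (negPf (flip_neq _)).
have Lta : lab' ta = Some None by rewrite /lab' taw eqxx.
have Lal' : lab' al' = Some None by rewrite /lab' alw' eqxx orbT.
have Lold e : e.1 \in w -> e != ta -> e != al' -> lab' e = Some (Some (lab e)).
  by rewrite /lab' => -> /negPf -> /negPf ->.
move: old4; rewrite /= !inE !negb_or !andbT.
case/and3P => /and3P[q01 q02 q03] /andP[q12 q13] q23.
have sy2 (x y : wdart) : x != y -> y != x by rewrite eq_sym.
have ta_be : be != ta.
  by apply/eqP => e; have := wturn_letter sg r be; rewrite t_be -e; case: (be) => [[v []] b].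
have Lal : lab' al = Some (Some (lab al)) by apply: Lold; rewrite // sy2.
have Lbe : lab' be = Some (Some (lab be)) by apply: Lold; rewrite // sy2.
have Lbe' : lab' be' = Some (Some (lab be')) by apply: Lold; rewrite // sy2.
have turn_ta e : turn e = ta -> e = be by rewrite -t_be => /wturn_inj.
have turn_al' e : turn e = al' -> e = wopp w ta by rewrite -f_ta => /wturn_inj.
have Eta : lab al' = lab be'.
  by rewrite -f_ta inv ?mem_wopp // woppK // -t_be inv // o_be.
have Lturn e : e.1 \in w -> e != be -> e != wopp w ta ->
    lab' (turn e) = Some (Some (lab (wopp w e))).
  move=> ew n1 n2; rewrite -inv //; apply: Lold; first by rewrite mem_wturn.
    by apply: contra n1 => /eqP/turn_ta ->.
  by apply: contra n2 => /eqP/turn_al' ->.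
have opta x : x != wopp w ta <-> wopp w x != ta.
  by rewrite -(inj_eq (inv_inj (woppK uw))) woppK.
exists (option (option R)), lab'; split.
- move=> e; rewrite memW => /orP[ew|/new_darts]; last first.
    rewrite !inE => /or4P[|||/or4P[|||/orP[]]] /eqP ->;
    by rewrite ?t_de ?t_fde ?t_de' ?t_fde' ?t_d1 ?t_fd1 ?t_d1' ?t_fd1'
       ?o_de ?o_fde ?o_de' ?o_fde' ?o_d1 ?o_fd1 ?o_d1' ?o_fd1'
       ?L1 ?L2 ?L3 ?L4 ?L5 ?L6 ?L7 ?L8 ?Lal ?Lbe ?Lal' ?Lbe'.
  case: (boolP (e \in [:: al; al'; be; be'])) => [|en].
    rewrite !inE => /or4P[] /eqP ->.
    + rewrite o_Wal L2 Lturn // ?o_al ?Eta //.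
      by apply/opta; rewrite o_al sy2.
    + rewrite o_Wal' L4 Lturn // ?o_al' //.
      by apply/opta; rewrite o_al' sy2.
    + by rewrite o_Wbe L6 t_be Lta.
    rewrite o_Wbe' L8 Lturn ?o_be' //; first by rewrite sy2.
    by apply/opta; rewrite o_be'.
  rewrite o_old //; move: en; rewrite !inE !negb_or => /and4P[e1 e2 e3 e4].
  case: (eqVneq e (wopp w ta)) => [->|n]; first by rewrite f_ta Lal' woppK // Lta.
  rewrite Lturn // Lold ?mem_wopp //; first exact/opta.
  by rewrite -o_al (inj_eq (inv_inj (woppK uw))).
- have newW l : l \in [:: de.1; de'.1; d1.1; d1'.1] -> l \in W.
    by move=> h; rewrite memW h orbT.
  move=> [[x|]|]; last first.
  + by exists de => //; apply: newW; rewrite !inE eqxx.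
  + by exists ta; rewrite // memW taw.
  have [d dw <-] := surj x.
  case: (eqVneq d ta) => [->|n1].
    exists be'; rewrite ?memW ?bew' // Lbe'; congr (Some (Some _)).
    by rewrite -t_be inv // o_be.
  case: (eqVneq d al') => [->|n2]; first by exists be'; rewrite ?memW ?bew' // Lbe' Eta.
  by exists d; rewrite ?memW ?dw // Lold.
rewrite !card_option sizeW; move: card_R; move: #|R| (size w); clear; lia.
Qed.

End Bigon.

End Bigons.
Import Bigons.

(** * The second Reidemeister move on explicit words *)

Module BigonWords.
Section WordMoves.
Variables (C : choiceType) (sg : C -> bool).
Local Notation wdart := (wdart C).
Implicit Types (w : seq (C * bool)).
Local Notation good := (good sg).
Local Notation wsame := (wsame sg).

Lemma gword_rot w k : gword (rot k w) = gword w.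
Proof.
rewrite /gword rot_uniq; congr (_ && _); rewrite (eq_all_r (mem_rot k w)).
by apply: eq_all => l; rewrite mem_rot.
Qed.

Lemma wopp_rot w k (d : wdart) : uniq w -> wopp (rot k w) d = wopp w d.
Proof. by move=> u; rewrite /wopp next_rot // prev_rot. Qed.

Lemma good_rot w k : good w -> good (rot k w).
Proof.
case=> gw pw; split; first by rewrite gword_rot.
case: pw => [->|[R [lab [inv surj le]]]]; [by left | right].
exists R, lab; split; last by rewrite size_rot.
  by move=> d; rewrite mem_rot => dw; rewrite /Words.wface wopp_rot ?inv //; case/andP: gw.
by move=> x; have [d dw dx] := surj x; exists d; rewrite ?mem_rot.
Qed.

Lemma good_catC w w' : good (w ++ w') -> good (w' ++ w).
Proof. by move/(good_rot (size w)); rewrite rot_size_cat. Qed.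

Lemma wsame_catC w w' : wsame (w ++ w') (w' ++ w).
Proof. by rewrite -(rot_size_cat w); apply: wsame_rot. Qed.

Lemma wopp_infix (p s q : seq (C * bool)) (d : wdart) x0 :
  uniq (p ++ s ++ q) -> d.1 \in s -> d != (last x0 s, true) -> d != (head x0 s, false) ->
  wopp (p ++ s ++ q) d = wopp s d.
Proof.
case: d => l [] u ls; rewrite /wopp /= !xpair_eqE ?andbT ?andbF /=.
  by move=> ne _; rewrite (next_infix (x0 := x0)).
move=> _ ne; rewrite prev_infix //.
by case: (s) ls ne.
Qed.

Lemma wopp_split (p q : seq (C * bool)) x y : uniq (p ++ x :: y :: q) ->
  wopp (p ++ x :: y :: q) (x, true) = (y, false) /\
  wopp (p ++ x :: y :: q) (y, false) = (x, true).
Proof. by move=> u; rewrite /wopp /= next_split // prev_split. Qed.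

(** Translates the sign of a crossing into the effect of a quarter turn on in and out: [b] is what a
    turn from the strand [~~ o] adds to the last bit, its negation what a turn from the strand [o]
    adds. *)
Lemma sg_turn r (c : C) o b x : sg c = (o == (b == ~~ r)) ->
  wturn sg r (c, o, x) = (c, ~~ o, x (+) ~~ b) /\
  wturn sg r (c, ~~ o, x) = (c, o, x (+) b).
Proof.
move=> sgc; rewrite /wturn /wcw /wccw sgc.
by case: r {sgc}; case: o; case: b; case: x.
Qed.

Section BigonWord.
Variables (r o par : bool) (v v' : C) (w1 w2 : seq (C * bool)).
Local Notation w := (w1 ++ w2).
Hypothesis vv' : v != v'.
Hypothesis fv : forall b, (v, b) \notin w.
Hypothesis fv' : forall b, (v', b) \notin w.
Hypothesis w1n : w1 <> [::].
Hypothesis w2n : w2 <> [::].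
Hypothesis T1 : wturn sg r (v', o, false) = (v', ~~ o, ~~ par).
Hypothesis T2 : wturn sg r (v, ~~ o, par) = (v, o, true).
Hypothesis gw : gword w.

(** The edge from [w1] to [w2], as the strand [o], overlaps the edge from [w2] back to [w1]; [par]
    tells whether the two meet [v] and [v'] in the same order. *)
Definition bigon_word : seq (C * bool) :=
  (if par then v else v', ~~ o) :: (if par then v' else v, ~~ o) ::
  w1 ++ (v, o) :: (v', o) :: w2.
Local Notation W := bigon_word.

Lemma mem_bigon_word l : (l \in W) =
  (l \in w) || (l \in [:: (v, o); (v', o); (v', ~~ o); (v, ~~ o)]).
Proof.
rewrite /bigon_word !inE !mem_cat !inE; case: par;
by do ![case: (_ == _) | case: (_ \in _)].
Qed.

Lemma bigon_gword : gword W.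
Proof.
have [uw /allP cw] := andP gw; apply/andP; split; last first.
  apply/allP => l; rewrite !mem_bigon_word => /orP[/cw -> //|].
  rewrite !inE => /or4P[] /eqP -> /=; rewrite ?negbK eqxx ?orbT //.
have ne (b b' : bool) : (v, b) != (v', b') by rewrite xpair_eqE (negPf vv').
have ne' (b b' : bool) : (v', b) != (v, b') by rewrite eq_sym ne.
have nn (x : C) : (x, ~~ o) != (x, o) by rewrite xpair_eqE eqxx; case: o.
have -> : uniq W = uniq ([:: (if par then v else v', ~~ o); (if par then v' else v, ~~ o);
    (v, o); (v', o)] ++ w).
  apply: perm_uniq; rewrite /bigon_word /= !perm_cons.
  exact: permEl (perm_catCA w1 [:: (v, o); (v', o)] w2).
rewrite cat_uniq uw andbT; apply/andP; split.
  by case: par; rewrite /= !inE !negb_or ?ne ?ne' ?nn.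
apply/hasPn => l lw; apply/negP; rewrite /= !inE => h.
have : l != (l.1, l.2) by move: h; case: par => /or4P[] /eqP e; move: lw; rewrite e;
  rewrite ?(negPf (fv _)) ?(negPf (fv' _)).
by rewrite -surjective_pairing eqxx.
Qed.

Let gW := bigon_gword.
Let uW : uniq W. Proof. by case/andP: gW. Qed.
Let uw : uniq w. Proof. by case/andP: gw. Qed.

Let x0 : C * bool := (v, o).
Let de : wdart := (v, o, true).
Let de' : wdart := (v', o, false).
Let d1 : wdart := (v', ~~ o, ~~ par).
Let d1' : wdart := (v, ~~ o, par).
Definition bigon_al : wdart := (last x0 w1, true).
Definition bigon_al' : wdart := (head x0 w2, false).
Definition bigon_be : wdart := if par then (head x0 w1, false) else (last x0 w2, true).
Definition bigon_be' : wdart := if par then (last x0 w2, true) else (head x0 w1, false).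
Local Notation al := bigon_al.
Local Notation al' := bigon_al'.
Local Notation be := bigon_be.
Local Notation be' := bigon_be'.

Let oWs p x y q : W = p ++ x :: y :: q ->
  wopp W (x, true) = (y, false) /\ wopp W (y, false) = (x, true).
Proof. by move=> e; rewrite e; apply: wopp_split; rewrite -e. Qed.

Let opps : [/\ wopp W de = de', wopp W d1 = d1', wopp W (flip de) = al &
  [/\ wopp W (flip de') = al', wopp W (flip d1) = be & wopp W (flip d1') = be']].
Proof.
have [z [w1' w1E]] : exists z w1', w1 = rcons w1' z.
  by case/lastP: (w1) w1n => // w1' z _; exists z, w1'.
have [y [w2' w2E]] : exists y w2', w2 = y :: w2'.
  by case: (w2) w2n => // y w2' _; exists y, w2'.
have [h [w1'' w1E']] : exists h w1'', w1 = h :: w1''.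
  by case: (w1) w1n => // h w1'' _; exists h, w1''.
set B1 := (if par then v else v', ~~ o); set B2 := (if par then v' else v, ~~ o).
have [a1 a2] := @oWs (B1 :: B2 :: w1) (v, o) (v', o) w2 erefl.
have [a3 a4] := @oWs [::] B1 B2 (w1 ++ (v, o) :: (v', o) :: w2) erefl.
have [a5 a6] : wopp W (z, true) = (v, o, false) /\ wopp W (v, o, false) = (z, true).
  by apply: (@oWs (B1 :: B2 :: w1') z (v, o) ((v', o) :: w2)); rewrite /bigon_word w1E cat_rcons.
have [a7 a8] : wopp W (v', o, true) = (y, false) /\ wopp W (y, false) = (v', o, true).
  apply: (@oWs (B1 :: B2 :: rcons w1 (v, o)) (v', o) y w2').
  by rewrite /bigon_word w2E /= cat_rcons.
have [a9 a10] : wopp W (B2, true) = (h, false) /\ wopp W (h, false) = (B2, true).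
  by apply: (@oWs [:: B1] B2 h (w1'' ++ (v, o) :: (v', o) :: w2)); rewrite /bigon_word w1E'.
have a11 : wopp W (B1, false) = (last x0 w2, true).
  have e : prev W B1 = last x0 w2 by rewrite [LHS](prev_head uW) /= last_cat w2E.
  exact: (congr1 (fun l => (l, true)) e).
have alE : al = (z, true) by rewrite /bigon_al w1E last_rcons.
have hE : head x0 w1 = h by rewrite w1E'.
have al'E : al' = (y, false) by rewrite /bigon_al' w2E.
rewrite alE al'E /bigon_be /bigon_be' hE /flip /= !negbK.
split=> //; first by rewrite /d1 /d1' /B1 /B2 in a3 a4 *; case: par a3 a4.
by rewrite /B1 /B2 in a9 a11 *; split=> //; case: par a9 a11.
Qed.

Let letters : uniq [:: de.1; de'.1; d1.1; d1'.1].
Proof.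
rewrite /= !inE !xpair_eqE !eqxx (eq_sym v' v) (negPf vv') /=.
by case: o.
Qed.

Let newl l : l \in [:: de.1; de'.1; d1.1; d1'.1] -> l \notin w.
Proof. by rewrite !inE => /or4P[] /eqP ->; rewrite ?fv ?fv'. Qed.

Let mw1 : (head x0 w1 \in w1) && (last x0 w1 \in w1).
Proof. by case: (w1) w1n => // h s _; rewrite /= mem_head mem_last. Qed.

Let mw2 : (head x0 w2 \in w2) && (last x0 w2 \in w2).
Proof. by case: (w2) w2n => // h s _; rewrite /= mem_head mem_last. Qed.

Let o_al : wopp w al = al'.
Proof. by have [] := wopp_cat_base x0 uw w1n w2n. Qed.

Let o_be : wopp w be = be'.
Proof.
have [b1 b2 b3 b4] := wopp_cat_base x0 uw w1n w2n.
by rewrite /bigon_be /bigon_be'; case: par.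
Qed.

Let mal : al.1 \in w. Proof. by rewrite mem_cat; case/andP: mw1 => _ ->. Qed.
Let mal' : al'.1 \in w. Proof. by rewrite mem_cat; case/andP: mw2 => -> _; rewrite orbT. Qed.
Let mbe : be.1 \in w.
Proof.
by rewrite mem_cat /bigon_be; case: par; [case/andP: mw1 => -> _|case/andP: mw2 => _ ->];
   rewrite ?orbT.
Qed.
Let mbe' : be'.1 \in w.
Proof.
by rewrite mem_cat /bigon_be'; case: par; [case/andP: mw2 => _ ->|case/andP: mw1 => -> _];
   rewrite ?orbT.
Qed.

Let o_old (e : wdart) : e.1 \in w -> e \notin [:: al; al'; be; be'] -> wopp W e = wopp w e.
Proof.
move=> ew en.
have {en} : [&& e != (last x0 w1, true), e != (head x0 w1, false),
    e != (last x0 w2, true) & e != (head x0 w2, false)].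
  move: en; rewrite !inE !negb_or /bigon_be /bigon_be'.
  by case: par => /and4P[] -> -> -> ->.
case/and4P=> e1 e2 e3 e4; move: ew; rewrite mem_cat => /orP[ew|ew].
  rewrite (wopp_cat_l (x0 := x0)) //.
  by apply: (@wopp_infix [:: _; _] w1 ((v, o) :: (v', o) :: w2) e x0).
rewrite (wopp_cat_r (x0 := x0)) //.
have WE : W = ((if par then v else v', ~~ o) :: (if par then v' else v, ~~ o) ::
    w1 ++ [:: (v, o); (v', o)]) ++ w2 ++ [::].
  by rewrite cats0 /= -catA.
by rewrite WE (@wopp_infix _ w2 _ e x0) // -WE.
Qed.

Let sizeW : size W = size w + 4.
Proof. by rewrite /bigon_word /= !size_cat /= !addnS addn0. Qed.

Let wn : w <> [::]. Proof. by case: (w1) w1n. Qed.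

Lemma bigon_word_remove : good W -> good w.
Proof.
case=> _ pW; split=> //.
have [p1 p2 p3 [p4 p5 p6]] := opps.
refine (@bigon_remove _ sg r w W de de' d1 d1' al al' be be' gw gW wn mem_bigon_word p1 p2 p3 p4 p5 p6
  T1 T2 o_al o_be mal mbe mal' mbe' o_old sizeW pW).
Qed.

Lemma bigon_word_insert (ta : wdart) :
  wturn sg r be = ta -> wturn sg r (wopp w ta) = al' -> ta.1 \in w ->
  ta != al -> ta != al' -> ta != be' -> good w -> good W.
Proof.
move=> t1 t2 t3 t4 t5 t6 [_ pw]; split=> //.
have [p1 p2 p3 [p4 p5 p6]] := opps.
have old4 : uniq [:: al; al'; be; be'].
  have ne (x y : C * bool) : x \in w1 -> y \in w2 -> x != y.
    move=> xw yw; move: uw; rewrite cat_uniq => /and3P[_ /hasPn /(_ _ yw) ny _].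
    by apply: contra ny => /eqP <-.
  have n1 : last x0 w1 != last x0 w2 by apply: ne; [case/andP: mw1 | case/andP: mw2].
  have n2 : head x0 w1 != head x0 w2 by apply: ne; [case/andP: mw1 | case/andP: mw2].
  rewrite /= !inE /bigon_be /bigon_be' /bigon_al /bigon_al'; case: par; rewrite !xpair_eqE /=;
  by rewrite (negPf n1) ?(eq_sym (head x0 w2)) (negPf n2) ?andbF.
refine (@bigon_insert _ sg r w W de de' d1 d1' al al' be be' gw gW wn letters mem_bigon_word newl p1 p2 p3 p4 p5 p6
  T1 T2 o_al o_be mal mbe mal' mbe' o_old sizeW ta t1 t2 t3 t4 t5 t6 old4 pw).
Qed.

Lemma bigon_word_wsame : wsame W w.
Proof.
have [p1 p2 p3 [p4 p5 p6]] := opps.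
apply: (@R2t_wsame _ sg r W w de d1) => //.
- by rewrite mem_bigon_word !inE eqxx orbT.
- by rewrite /tface p1.
- by rewrite /tface p2.
- by rewrite /over_edge p1 p2 /=; case: o.
have fl s : {subset s <= w} -> [seq l <- s | (l.1 != v) && (l.1 != v')] = s.
  move=> sw; apply/all_filterP/allP => -[c b] /sw cw /=; apply/andP; split.
    by apply: contraL cw => /eqP ->.
  by apply: contraL cw => /eqP ->.
rewrite /bigon_word /= filter_cat /= !eqxx !andbF /=.
have q1 : ((if par then v else v') != v) && ((if par then v else v') != v') = false.
  by case: par; rewrite eqxx ?andbF.
have q2 : ((if par then v' else v) != v) && ((if par then v' else v) != v') = false.
  by case: par; rewrite eqxx ?andbF.
rewrite q1 q2.
by rewrite !fl // => l lw; rewrite mem_cat lw ?orbT.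
Qed.

End BigonWord.
End WordMoves.

End BigonWords.
Import BigonWords.

(** * Pushing a strand over one crossing *)

Module VertexPass.
Section Pass.
Variables (C : choiceType) (sg : C -> bool).
Local Notation wdart := (wdart C).
Local Notation good := (good sg).
Local Notation wsame := (wsame sg).
Variables (r o p : bool) (u cn c1 c3 : C) (w0 w1 w2 w3 : seq (C * bool)).
Let b1 := (p == sg u) (+) r.
Hypothesis sg_cn : sg cn = (o == (true == ~~ r)).
Hypothesis sg_c1 : sg c1 = (o == (b1 == ~~ r)).
Hypothesis sg_c3 : sg c3 = (o == (~~ b1 == ~~ r)).

(* The strand through cn crosses the edge that enters u along (u, p); pushed over
   u by a second and a third Reidemeister move, it crosses the other three. *)
Definition pass_before : seq (C * bool) :=
  w0 ++ (cn, ~~ o) :: (u, p) :: w1 ++ (u, ~~ p) :: w2 ++ (cn, o) :: w3.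
Definition pass_after : seq (C * bool) :=
  w0 ++ (u, p) :: (cn, ~~ o) :: w1 ++
  (if b1 then [:: (c3, ~~ o); (u, ~~ p); (c1, ~~ o)]
   else [:: (c1, ~~ o); (u, ~~ p); (c3, ~~ o)]) ++
  w2 ++ (c1, o) :: (cn, o) :: (c3, o) :: w3.
Hypothesis gw : good pass_before.
Hypothesis c13 : c1 != c3.
Hypothesis f1 : forall b, (c1, b) \notin pass_before.
Hypothesis f3 : forall b, (c3, b) \notin pass_before.
Hypothesis w2n : w2 <> [::].

(** The cyclic word is cut at the two edges of the second move: the one arriving at [(cn, o)], and
    the one carrying the dart [(u, ~~ p, b1)], which leaves or enters [(u, ~~ p)] according to
    [b1]. *)
Let P1 := if b1 then w2 else (u, ~~ p) :: w2.
Let P2 := (cn, o) :: w3 ++ w0 ++ (cn, ~~ o) :: (u, p) :: w1 ++ (if b1 then [:: (u, ~~ p)] else [::]).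

Let wE : exists k, P1 ++ P2 = rot k pass_before.
Proof.
rewrite /P1 /P2 /pass_before; case: b1.
  exists (size (w0 ++ (cn, ~~ o) :: (u, p) :: w1 ++ [:: (u, ~~ p)])).
  have -> : w0 ++ (cn, ~~ o) :: (u, p) :: w1 ++ (u, ~~ p) :: w2 ++ (cn, o) :: w3 =
    (w0 ++ (cn, ~~ o) :: (u, p) :: w1 ++ [:: (u, ~~ p)]) ++ w2 ++ (cn, o) :: w3.
    by rewrite -!catA /= -!catA.
  by rewrite rot_size_cat -!catA.
exists (size (w0 ++ (cn, ~~ o) :: (u, p) :: w1)).
have -> : w0 ++ (cn, ~~ o) :: (u, p) :: w1 ++ (u, ~~ p) :: w2 ++ (cn, o) :: w3 =
    (w0 ++ (cn, ~~ o) :: (u, p) :: w1) ++ ((u, ~~ p) :: w2) ++ (cn, o) :: w3.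
  by rewrite -!catA.
by rewrite rot_size_cat -!catA cats0.
Qed.

(** The second move lets the strand cross the edge of [(u, ~~ p, b1)] at [c1] and [c3]. This creates
    a triangle with vertices [cn], [c3] and [u]; the third move across it carries [cn] and [c3] to
    the other side of [u] along their strands. *)
Lemma pass_vertex : good pass_after /\ wsame pass_before pass_after.
Proof.
have [k kE] := wE; have gP : good (P1 ++ P2) by rewrite kE; apply: good_rot.
have fr1 b : (c1, b) \notin P1 ++ P2 by rewrite kE mem_rot.
have fr3 b : (c3, b) \notin P1 ++ P2 by rewrite kE mem_rot.
have P1n : P1 <> [::] by rewrite /P1; case: b1.
have P2n : P2 <> [::] by [].
have T1 : wturn sg r (c3, o, false) = (c3, ~~ o, ~~ ~~ b1).
  by rewrite (sg_turn false sg_c3).1 /= negbK.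
have T2 : wturn sg r (c1, ~~ o, ~~ b1) = (c1, o, true).
  by rewrite (sg_turn (~~ b1) sg_c1).2; case: b1.
have uP : uniq (P1 ++ P2) by case/andP: gP.1.
pose M := bigon_word o (~~ b1) c1 c3 P1 P2.
have gM : gword M := bigon_gword o (~~ b1) c13 fr1 fr3 gP.1.
have uM : uniq M by case/andP: gM.
have sameM : wsame M (P1 ++ P2) := bigon_word_wsame c13 fr1 fr3 P1n P2n T1 T2 gP.1.
have tl : wturn sg r (u, ~~ p, b1) = (u, p, false).
  rewrite /wturn /wcw /wccw /b1 negbK.
  by case: r; case: (sg u); case: p.
have tc : wturn sg r (cn, ~~ o, true) = (cn, o, false).
  by rewrite (sg_turn true sg_cn).2.
pose x0 : C * bool := (c1, o).
have beE : bigon_be o (~~ b1) c1 P1 P2 = (u, ~~ p, b1).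
  rewrite /bigon_be /P1 /P2; case: b1 => //=.
  by rewrite !last_cat /= last_cat.
have opl : wopp (P1 ++ P2) (u, p, false) = (cn, ~~ o, true).
  have -> : P1 ++ P2 = (P1 ++ (cn, o) :: w3 ++ w0) ++ (cn, ~~ o) :: (u, p) ::
      w1 ++ (if b1 then [:: (u, ~~ p)] else [::]) by rewrite -!catA /= -!catA.
  apply: (wopp_split _).2; rewrite -!catA /= -!catA; exact: uP.
have lP : (u, p) \in P1 ++ P2 by rewrite kE mem_rot /pass_before mem_cat !inE eqxx !orbT.
have ul : (cn, o) != (u, p).
  have [uw _] := andP gw.1; move: uw; rewrite /pass_before cat_uniq => /and3P[_ _].
  rewrite /= => /and3P[_ h _]; apply: contra h => /eqP <-.
  by rewrite mem_cat inE mem_cat mem_head !orbT.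
(* The dart [ta] of [bigon_insert] is on the edge between [cn] and [u], so the piece cut off is the
   triangle of the third move. *)
have goodM : good M.
  apply: (@bigon_word_insert _ sg r o (~~ b1) c1 c3 P1 P2 c13 fr1 fr3 P1n P2n T1 T2 gP.1
     (u, p, false)); rewrite ?beE ?opl ?tl ?tc //.
  - by rewrite xpair_eqE andbF.
  - by rewrite /bigon_al' /P2 [head _ _]/= xpair_eqE eqxx andbT eq_sym.
  rewrite /bigon_be' /P1 /P2; case: b1; last by rewrite xpair_eqE andbF.
  rewrite [~~ true]/= xpair_eqE eqxx andbT.
  have : head x0 w2 \in w2 by case: (w2) w2n => //= h s _; rewrite mem_head.
  rewrite -/x0; move: (head x0 w2) => h hw2.
  have [uw _] := andP gw.1; move: uw; rewrite /pass_before cat_uniq => /and3P[_ _].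
  rewrite /= => /and3P[_ nh _]; apply: contra nh => /eqP ->.
  by rewrite !mem_cat inE mem_cat hw2 !orbT.
pose d0 : wdart := (cn, o, false); pose d1 : wdart := (c3, ~~ o, ~~ b1).
pose d2 : wdart := (u, p, false).
have oM q x y q' : M = q ++ x :: y :: q' ->
    wopp M (x, true) = (y, false) /\ wopp M (y, false) = (x, true).
  by move=> e; rewrite e; apply: wopp_split; rewrite -e.
have o0 : wopp M d0 = (c3, o, true).
  set t := w3 ++ w0 ++ (cn, ~~ o) :: (u, p) :: w1 ++ (if b1 then [:: (u, ~~ p)] else [::]).
  have e : M = ((if ~~ b1 then c1 else c3, ~~ o) :: (if ~~ b1 then c3 else c1, ~~ o) ::
      P1 ++ [:: (c1, o)]) ++ (c3, o) :: (cn, o) :: t.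
    by rewrite /M /bigon_word /P2 /= -catA.
  by case: (oM _ _ _ _ e).
have o2 : wopp M d2 = (cn, ~~ o, true).
  have e : M = ((if ~~ b1 then c1 else c3, ~~ o) :: (if ~~ b1 then c3 else c1, ~~ o) ::
      P1 ++ [:: (c1, o), (c3, o), (cn, o) & w3 ++ w0]) ++ (cn, ~~ o) :: (u, p) ::
      (w1 ++ (if b1 then [:: (u, ~~ p)] else [::])).
    by rewrite /M /bigon_word /P2 /= -!catA /= -!catA.
  by case: (oM _ _ _ _ e).
have o1 : wopp M d1 = (u, ~~ p, b1).
  rewrite /d1 /M /bigon_word /P1 /P2; move: uM; rewrite /M /bigon_word /P1 /P2.
  case: b1 => /= uM'; last exact: (wopp_split (p := [:: _]) uM').1.
  apply: (congr1 (fun l => (l, true))); rewrite (prev_head uM').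
  by rewrite /= !(last_cat, last_cons).
have F0 : tface sg r M d0 = d1 by rewrite /tface o0 (sg_turn true sg_c3).1 /d1; case: b1.
have F1 : tface sg r M d1 = d2 by rewrite /tface o1 tl.
have F2 : tface sg r M d2 = d0 by rewrite /tface o2 tc.
have d0M : d0.1 \in M by rewrite mem_bigon_word mem_cat inE eqxx !orbT.
have cnP b : (cn, b) \in P1 ++ P2.
  rewrite kE mem_rot /pass_before !(mem_cat, inE) !xpair_eqE !eqxx /=.
  by case: (b); case: (o); rewrite ?orbT.
have vd : uniq [:: d0.1.1; d1.1.1; d2.1.1].
  rewrite /= !inE !negb_or !andbT; apply/andP; split; [apply/andP; split|].
  - by apply: contra (fr3 true) => /eqP <-.
  - have [uw _] := andP gw.1; move: uw; rewrite /pass_before cat_uniq => /and3P[_ _].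
    apply: contraL => /eqP e; rewrite e; apply/negP => /= /and3P[].
    rewrite !inE !mem_cat !inE mem_cat !inE !xpair_eqE !eqxx /=.
    by case: (p); case: (o); rewrite ?orbT ?orbF.
  by apply: contra (fr3 p) => /eqP ->.
have ov : [|| over_edge M d0, over_edge M d1 | over_edge M d2].
  by rewrite /over_edge o0 o1 o2 /=; case: (o); case: (p); rewrite ?orbT.
have same2 := R3t_wsame gM d0M F0 F1 F2 vd ov.
have good2 := triangle_good gM d0M F0 F1 F2 vd goodM.
have swE := triangle_swapE F0 F1 F2 vd.
set phi := triangle_swap M d0 d1 d2 in same2 good2 swE.
have [q0 q0'] : phi (cn, o) = (c3, o) /\ phi (c3, o) = (cn, o).
  by apply: swE; rewrite o0 mem_head.
have [q1 q1'] : phi (c3, ~~ o) = (u, ~~ p) /\ phi (u, ~~ p) = (c3, ~~ o).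
  by apply: swE; rewrite o1 !inE eqxx !orbT.
have [q2 q2'] : phi (u, p) = (cn, ~~ o) /\ phi (cn, ~~ o) = (u, p).
  by apply: swE; rewrite o2 !inE eqxx !orbT.
have swout l : l.1 != u -> l.1 != cn -> l.1 != c3 -> phi l = l.
  move=> n1 n2 n3; apply: triangle_swap_out; rewrite o0 o1 o2.
  have nE (x : C * bool) : l.1 != x.1 -> l != x by apply: contra => /eqP ->.
  by rewrite !inE !negb_or !nE.
have [uw _] := andP gw.1.
have lab (x : C) b s : uniq s -> (x, b) \in s -> (x, ~~ b) \in s -> forall l s', perm_eq s ((x, b) :: (x, ~~ b) :: s') -> l \in s' -> l.1 != x.
  move=> us xs xs' l s' ps ls'; move: us; rewrite (perm_uniq ps) /= => /and3P[h1 h2 _].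
  apply/eqP => e; move: h1 h2; rewrite inE negb_or => /andP[_ h1] h2.
  move: ls' h1 h2; rewrite [l]surjective_pairing e.
  by case: (l.2); case: (b) => ->.
pose rest := w0 ++ w1 ++ w2 ++ w3.
have perm_all : perm_eq pass_before [:: (cn, o), (cn, ~~ o), (u, p), (u, ~~ p) & rest].
  rewrite /pass_before /rest; apply/seq.permP => a; rewrite /= !count_cat /= !count_cat /= !count_cat /=.
  by clear; lia.
have restE l : l \in rest -> phi l = l.
  move=> lr; apply: swout.
  - apply: (lab u p pass_before uw _ _ l ((cn, o) :: (cn, ~~ o) :: rest)).
    + by rewrite (perm_mem perm_all) !inE eqxx ?orbT.
    + by rewrite (perm_mem perm_all) !inE eqxx ?orbT.
    + apply: (perm_trans perm_all).
      by rewrite (perm_catCA [:: (cn, o); (cn, ~~ o)] [:: (u, p); (u, ~~ p)] rest).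
    by rewrite !inE lr ?orbT.
  - apply: (lab cn o pass_before uw _ _ l ((u, p) :: (u, ~~ p) :: rest)) => //.
    + by rewrite (perm_mem perm_all) !inE eqxx ?orbT.
    + by rewrite (perm_mem perm_all) !inE eqxx ?orbT.
    by rewrite !inE lr ?orbT.
  apply: contra (f3 l.2) => /eqP <-; rewrite -surjective_pairing (perm_mem perm_all).
  by rewrite !inE lr ?orbT.
have phi_c1 b : phi (c1, b) = (c1, b).
  apply: swout => //=.
  - by apply: contra (fr1 p) => /eqP ->.
  by apply: contra (fr1 o) => /eqP ->.
have mapE s : {subset s <= rest} -> map phi s = s.
  by move=> sr; rewrite map_id_in // => l /sr/restE.
have m0 : map phi w0 = w0 by apply: mapE => l h; rewrite /rest !mem_cat h.
have m1 : map phi w1 = w1 by apply: mapE => l h; rewrite /rest !mem_cat h ?orbT.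
have m2 : map phi w2 = w2 by apply: mapE => l h; rewrite /rest !mem_cat h ?orbT.
have m3 : map phi w3 = w3 by apply: mapE => l h; rewrite /rest !mem_cat h ?orbT.
have [k' k'E] : exists k', pass_after = rot k' (map phi M).
  have ME : map phi M = (if b1 then [:: (u, ~~ p), (c1, ~~ o) & w2] else [:: (c1, ~~ o), (u, ~~ p), (c3, ~~ o) & w2])
      ++ (c1, o) :: (cn, o) :: (c3, o) :: w3 ++ w0 ++ (u, p) :: (cn, ~~ o) :: w1 ++
      (if b1 then [:: (c3, ~~ o)] else [::]).
    rewrite /M /bigon_word /P1 /P2; case: b1; rewrite /= !(map_cat, map_cons) /= ?map_cat /=;
    by rewrite ?m0 ?m1 ?m2 ?m3 ?phi_c1 ?q0 ?q0' ?q1 ?q1' ?q2 ?q2'.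
  rewrite ME /pass_after; case: b1.
    exists (size ([:: (u, ~~ p), (c1, ~~ o) & w2] ++ [:: (c1, o), (cn, o), (c3, o) & w3])).
    set A := (X in rot _ X).
    have -> : A = ([:: (u, ~~ p), (c1, ~~ o) & w2] ++ [:: (c1, o), (cn, o), (c3, o) & w3]) ++
       (w0 ++ (u, p) :: (cn, ~~ o) :: w1 ++ [:: (c3, ~~ o)]) by rewrite /A -!catA.
    by rewrite rot_size_cat -!catA /= -!catA.
  exists (size ([:: (c1, ~~ o), (u, ~~ p), (c3, ~~ o) & w2] ++ [:: (c1, o), (cn, o), (c3, o) & w3])).
  set A := (X in rot _ X).
  have -> : A = ([:: (c1, ~~ o), (u, ~~ p), (c3, ~~ o) & w2] ++ [:: (c1, o), (cn, o), (c3, o) & w3]) ++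
     (w0 ++ (u, p) :: (cn, ~~ o) :: w1) by rewrite /A -!catA cats0.
  by rewrite rot_size_cat -!catA.
split; first by rewrite k'E; apply: good_rot.
apply: (wsame_trans (w' := P1 ++ P2)) => //; first by rewrite kE; apply: wsame_rot.
apply: (wsame_trans (w' := M)) => //; first exact: wsame_sym.
apply: (wsame_trans (w' := map phi M)) => //.
by rewrite k'E; apply: wsame_rot.
Qed.

End Pass.

End VertexPass.
Import VertexPass.

(** * Backtracking of a curve that crosses a sequence of darts *)

Module Contours.
Section Contour.
Variables (T R : eqType) (op : T -> T) (col : T -> R).

(* A curve that starts in the region x and crosses the darts of s in turn, each
   from the side [col (op d)] to the side [col d]. *)
Fixpoint chain (x : R) (s : seq T) : Prop :=
  if s is d :: s' then col (op d) = x /\ chain (col d) s' else True.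

Lemma chain_cat x s1 s2 :
  chain x (s1 ++ s2) <-> chain x s1 /\ chain (last x (map col s1)) s2.
Proof.
elim: s1 x => [|d s1 IH] x /=; first by split=> [|[]].
by rewrite IH; split=> [[? []]|[[]]]; split.
Qed.

Definition gap_labels (x : R) (s : seq T) : seq R := undup (x :: map col s).

Lemma chain_nth x s i d0 : chain x s -> i < size s ->
  col (op (nth d0 s i)) = nth x (x :: map col s) i.
Proof.
elim: s x i => [|d s IH] x [|i] //=; first by case.
case=> _ ch lt; rewrite (IH (col d) i ch lt); case: i lt => //= i lt.
by apply: set_nth_default; rewrite size_map ltnW.
Qed.

Lemma two_occurrences (y0 : R) s i j : i < size s -> j < size s -> i != j ->
  nth y0 s i = nth y0 s j -> 1 < count_mem (nth y0 s i) s.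
Proof.
wlog ij : i j / i < j => [H|].
  move=> li lj ne e; case: (ltngtP i j) ne => // h _.
    by apply: (H i j) => //; rewrite neq_ltn h.
  by rewrite e; apply: (H j i) => //; rewrite neq_ltn h.
move=> li lj _ e; rewrite -(cat_take_drop j s) count_cat.
rewrite (@leq_add 1 1) // -has_count has_pred1.
  by rewrite cat_take_drop -(nth_take y0 ij) mem_nth // size_take lj.
rewrite cat_take_drop e -{1}[j]addn0 -nth_drop mem_nth // size_drop subn_gt0.
exact: lj.
Qed.

Lemma undup_size_le (s : seq R) (y0 : R) :
  (forall y, y \in s -> y != y0 -> 1 < count_mem y s) ->
  2 * size (undup s) <= (size s).+1.
Proof.
move=> H; have := perm_size (perm_count_undup s); rewrite size_flatten /shape -map_comp.
move=> <-; have : {subset undup s <= s} by move=> y; rewrite mem_undup.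
have : uniq (undup s) by apply: undup_uniq.
have H1 U : uniq U -> {subset U <= s} -> y0 \notin U ->
    2 * size U <= sumn [seq (size \o (fun x => nseq (count_mem x s) x)) i | i <- U].
  elim: U => //= y U IH /andP[yU uU] sub; rewrite inE negb_or => /andP[y0y y0U].
  rewrite mulnS leq_add ?IH ?size_nseq //.
    by apply: H; rewrite ?sub ?mem_head // eq_sym.
  by move=> z zU; apply: sub; rewrite inE zU orbT.
elim: (undup s) => //= y U IH /andP[yU uU] sub; rewrite size_nseq.
have sub' : {subset U <= s} by move=> z zU; apply: sub; rewrite inE zU orbT.
case: (eqVneq y y0) => [yy0|ne].
  have := H1 U uU sub'; rewrite -yy0 => /(_ yU) h.
  have : 0 < count_mem y s by rewrite -has_count has_pred1 sub ?mem_head.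
  by move: h; move: (sumn _) (count_mem y s) (size U); clear; lia.
have := H y (sub y (mem_head _ _)) ne; have := IH uU sub'.
by move: (sumn _) (count_mem y s) (size U); clear; lia.
Qed.

Variables (om : T).
Hypothesis opK : involutive op.

(** Without such a pair, the label of a gap next to a dart [d] other than [om] recurs at a different
    gap, next to [op d]. Only an end gap whose single neighbour is [om] may escape, so twice the
    number of labels is at most [size S + 2]. *)
Lemma adjacent_pair x (S : seq T) :
  uniq S -> om \in S -> op om \notin S ->
  (forall d, d \in S -> d != om -> op d \in S) ->
  chain x S -> size S + 3 <= 2 * size (gap_labels x S) -> 1 < size S ->
  exists S1 d S2, S = S1 ++ d :: op d :: S2.
Proof.
move=> uS omS oomS clS ch card k1.
pose adj i := (i.+1 < size S) && (nth om S i.+1 == op (nth om S i)).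
case: (boolP (has adj (iota 0 (size S)))) => [/hasP[i _ /andP[lt /eqP e]]|no].
  exists (take i S), (nth om S i), (drop i.+2 S).
  rewrite -{1}(cat_take_drop i S) (drop_nth om (ltnW lt)) (drop_nth om lt).
  by rewrite e.
have noadj i : i.+1 < size S -> nth om S i.+1 != op (nth om S i).
  move=> lt; apply: contra no => e; apply/hasP; exists i; last by rewrite /adj lt.
  by rewrite mem_iota /= add0n ltnW.
pose G := x :: map col S; pose k := size S.
have sG : size G = k.+1 by rewrite /= size_map.
have gapS j : j < k -> nth x G j.+1 = col (nth om S j).
  by move=> lt; rewrite /= (nth_map om).
have gapP j : j < k -> nth x G j = col (op (nth om S j)).
  by move=> lt; rewrite (chain_nth om ch).
have opidx d : d \in S -> d != om -> exists2 j, j < k & nth om S j = op d.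
  move=> dS dn; exists (index (op d) S); first by rewrite index_mem clS.
  by rewrite nth_index ?clS.
have caseA i : i < k -> nth om S i != om ->
    exists j, [/\ j < k.+1, i != j & nth x G i = nth x G j].
  move=> lt ne; have [j ltj jE] := opidx _ (mem_nth om lt) ne.
  exists j.+1; split=> //; last by rewrite gapS // jE gapP.
  apply/eqP => e; have := noadj j; rewrite -e -/k lt => /(_ isT).
  by rewrite jE opK eqxx.
have caseB i : i < k -> nth om S i != om ->
    exists j, [/\ j < k.+1, i.+1 != j & nth x G i.+1 = nth x G j].
  move=> lt ne; have [j ltj jE] := opidx _ (mem_nth om lt) ne.
  exists j; split; [exact: ltnW| |by rewrite gapS // gapP // jE opK].
  apply/eqP => e; have := noadj i; rewrite e -/k ltj => /(_ isT).
  by rewrite jE eqxx.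
(* The label that is allowed to occur once: that of the end gap beside [om], if [om] is at an
   end. *)
pose y0 := if nth om S 0 == om then x else nth x G k.
have k0 : 0 < k by apply: ltnW.
suff H y : y \in G -> y != y0 -> 1 < count_mem y G.
  have := undup_size_le H; rewrite -/(gap_labels x S) sG => h.
  by move: (leq_trans card h); rewrite -/k; clear; lia.
move=> yG; have iG : index y G < k.+1 by rewrite -sG index_mem.
rewrite -(nth_index x yG); move: (index y G) iG => i ik ne {y yG}.
have key : exists j, [/\ j < k.+1, i != j & nth x G i = nth x G j].
  case: (eqVneq i k) => [ek|nk].
    have lt' : k.-1 < k by rewrite prednK.
    have := caseB k.-1 lt'; rewrite prednK // -ek; apply.
    apply: contra ne => /eqP e; rewrite /y0 -ek.
    case: (nth om S 0 =P om) => [e0|//]; have : nth om S 0 = nth om S k.-1 by rewrite e0 -ek.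
    move/eqP; rewrite nth_uniq // => /eqP h; move: k1; rewrite -/k -(prednK k0) -h.
    by [].
  have lt : i < k by rewrite ltn_neqAle nk -ltnS.
  case: (eqVneq (nth om S i) om) => [e|]; last exact: caseA.
  case: i e ne lt {ik nk} => [|i] e ne lt; first by rewrite /y0 e eqxx /= eqxx in ne.
  apply: caseB; first exact: ltnW.
  apply: contraTN isT => /eqP e'; have : nth om S i = nth om S i.+1 by rewrite e e'.
  move/eqP; rewrite nth_uniq // -/k; last by rewrite ltnW.
  by rewrite ltn_eqF.
have [j [jk ij ee]] := key.
by apply: (two_occurrences (j := j)); rewrite ?sG.
Qed.

Lemma cancel_chain x S1 d S2 : chain x (S1 ++ d :: op d :: S2) -> chain x (S1 ++ S2).
Proof.
rewrite !chain_cat /= => -[h1 [h2 [h3 h4]]]; split=> //.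
by rewrite -h2.
Qed.

(** The gaps before and after the pair have the same label and merge, so only the label between [d]
    and [op d] can disappear. *)
Lemma cancel_labels x S1 d S2 : chain x (S1 ++ d :: op d :: S2) ->
  size (gap_labels x (S1 ++ d :: op d :: S2)) <= (size (gap_labels x (S1 ++ S2))).+1.
Proof.
move=> ch; have /chain_cat[_ [e _]] := ch.
have -> : (size (gap_labels x (S1 ++ S2))).+1 = size (col d :: gap_labels x (S1 ++ S2)) by [].
apply: uniq_leq_size; first exact: undup_uniq.
move=> y; rewrite inE !mem_undup !inE !map_cat !mem_cat /= !inE.
have lst : last x (map col S1) \in x :: map col S1 by apply: mem_last.
rewrite e; case/orP => [->|]; rewrite ?orbT //.
case/orP => [->|]; rewrite ?orbT //; case/or3P => [->|/eqP ->|->]; rewrite ?orbT //.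
by move: lst; rewrite inE => /orP[->|->]; rewrite ?orbT.
Qed.

End Contour.

End Contours.
Import Contours.

(** * One step of the sweep of a strand over a diagram *)

Module Sweep.
Lemma good_map (C : choiceType) (sg : C -> bool) (w : seq (C * bool)) (g : C -> C) :
  (forall c o c' o', (c, o) \in w -> (c', o') \in w -> g c = g c' -> c = c') ->
  (forall c o, (c, o) \in w -> sg (g c) = sg c) ->
  good sg w -> good sg [seq (g l.1, l.2) | l <- w].
Proof.
move=> ginj gsg /good_realized[D [f [finj fsg fw]]].
have lw v : (f v, true) \in w.
  by rewrite -fw; apply/mapP; exists (v, true) => //; apply: code_full.
apply: (@realizes_good _ sg D (g \o f)); split.
- by move=> v v' /= /(ginj _ _ _ _ (lw v) (lw v')) /finj.
- by move=> v /=; rewrite (gsg _ true).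
by rewrite -fw -map_comp.
Qed.

Section Sweep.
Variables (C : choiceType) (sg : C -> bool).
Local Notation wdart := (wdart C).
Local Notation good := (good sg).
Local Notation wsame := (wsame sg).
Variables (r o : bool) (nm : wdart -> C) (a e1 e2 : seq (C * bool)).
Hypothesis nm_inj : injective nm.
Hypothesis sg_nm : forall d, sg (nm d) = (o == (d.2 == ~~ r)).
Hypothesis fresh : forall d b, (nm d, b) \notin a ++ e1 ++ e2.
Hypothesis ua : uniq a.
Hypothesis ca : forall l, l \in a -> (l.1, ~~ l.2) \in a.
Hypothesis e1n : e1 <> [::].
Implicit Types (S : seq wdart) (s : seq (C * bool)).

(* Between e1 and e2 the swept strand crosses a once for each dart d of S, at the
   crossing [nm d] placed on d; [dec] inserts these crossings into a. *)
Definition dec1 S (k : C * bool) : seq (C * bool) :=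
  (if (k, false) \in S then [:: (nm (k, false), ~~ o)] else [::]) ++
  k :: (if (k, true) \in S then [:: (nm (k, true), ~~ o)] else [::]).
Definition dec S s : seq (C * bool) := flatten (map (dec1 S) s).
Definition gam S : seq (C * bool) := [seq (nm d, o) | d <- S].
Definition stage S : seq (C * bool) := dec S a ++ e1 ++ gam S ++ e2.

Lemma dec_cat S s1 s2 : dec S (s1 ++ s2) = dec S s1 ++ dec S s2.
Proof. by rewrite /dec map_cat flatten_cat. Qed.

Lemma dec_cons S k s : dec S (k :: s) = dec1 S k ++ dec S s.
Proof. by []. Qed.

Lemma dec1_eq S S' k : (forall b, ((k, b) \in S) = ((k, b) \in S')) -> dec1 S k = dec1 S' k.
Proof. by move=> e; rewrite /dec1 !e. Qed.

Lemma dec_eq S S' s : (forall k b, k \in s -> ((k, b) \in S) = ((k, b) \in S')) ->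
  dec S s = dec S' s.
Proof.
elim: s => // k s IH e; rewrite !dec_cons (dec1_eq (S' := S')) ?IH // => [k' b ks|b].
  by apply: e; rewrite inE ks orbT.
by apply: e; rewrite mem_head.
Qed.

Lemma dec1_plain S k : (forall b, (k, b) \notin S) -> dec1 S k = [:: k].
Proof. by move=> n; rewrite /dec1 !(negPf (n _)). Qed.

Lemma mem_dec S s l : l \in dec S s ->
  l \in s \/ exists d, [/\ d \in S, d.1 \in s & l = (nm d, ~~ o)].
Proof.
elim: s => // k s IH; rewrite dec_cons mem_cat => /orP[|/IH[ls|[d [dS ds ->]]]].
- rewrite /dec1 mem_cat inE => /or3P[|/eqP ->|].
  + case: ifP => // kS; rewrite inE => /eqP ->; right.
    by exists (k, false); rewrite /= mem_head.
  + by left; rewrite mem_head.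
  case: ifP => // kS; rewrite inE => /eqP ->; right.
  by exists (k, true); rewrite /= mem_head.
- by left; rewrite inE ls orbT.
by right; exists d; rewrite inE ds orbT.
Qed.

Lemma mem_dec_nm S s d b : (nm d, b) \in dec S s -> d \in S \/ (nm d, b) \in s.
Proof.
case/mem_dec => [?|[d' [dS _ [/nm_inj -> _]]]]; first by right.
by left.
Qed.

Lemma mem_gam_nm S d b : (nm d, b) \in gam S -> d \in S.
Proof. by case/mapP => d' dS [/nm_inj -> _]. Qed.

Section Step.
Variables (a0 a1 : seq (C * bool)) (u cn : C) (p : bool) (Sl Sr : seq wdart).
Let l : C * bool := (u, p).
Hypothesis aE : a = a0 ++ l :: a1.
Hypothesis sg_cn : sg cn = (o == (true == ~~ r)).
Hypothesis u_new : forall b, (u, b) \notin a0.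
Hypothesis S_new : forall d, d \in Sl ++ Sr -> d.1.1 != u.
Hypothesis cn_nm : forall d, d.1.1 = u -> nm d != cn.
Let b1 := (p == sg u) (+) r.
Let d1 : wdart := (u, ~~ p, b1).
Let d2 : wdart := (u, p, true).
Let d3 : wdart := (u, ~~ p, ~~ b1).

Definition step_before : seq (C * bool) :=
  dec (Sl ++ Sr) a0 ++ (cn, ~~ o) :: l :: dec (Sl ++ Sr) a1 ++
  e1 ++ gam Sl ++ (cn, o) :: gam Sr ++ e2.
Definition step_darts : seq wdart := Sl ++ [:: d1; d2; d3] ++ Sr.

(** This is [pass_vertex] at [u], followed by renaming [cn] to [nm d2]: names record positions, and
    this crossing has moved to the edge that leaves [u] along [(u, p)]. *)
Lemma sweep_step : good step_before ->
  good (stage step_darts) /\ wsame step_before (stage step_darts).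
Proof.
move=> gB; set S := Sl ++ Sr; set S' := step_darts.
have la : l \in a by rewrite aE mem_cat mem_head orbT.
have l'a1 : (u, ~~ p) \in a1.
  have := ca la; rewrite aE mem_cat inE (negPf (u_new _)) /= => /orP[|//].
  by rewrite xpair_eqE eqxx; case: (p).
have [a2 [a3 a1E]] : exists a2 a3, a1 = a2 ++ (u, ~~ p) :: a3.
  by case/splitPr: l'a1 => a2 a3; exists a2, a3.
have plainS k b : k.1 = u -> (k, b) \notin S.
  by move=> ku; apply/negP => /S_new; rewrite /= ku eqxx.
have BE : step_before = pass_before o p u cn (dec S a0) (dec S a2)
    (dec S a3 ++ e1 ++ gam Sl) (gam Sr ++ e2).
  rewrite /step_before /pass_before a1E dec_cat dec_cons dec1_plain => [|b]; last exact: plainS.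
  by rewrite /= -?catA /= -?catA /= -?catA.
have fr d b : d.1.1 = u -> (nm d, b) \notin step_before.
  move=> du; have dS : d \notin S by apply/negP => /S_new; rewrite du eqxx.
  have := fresh d b; rewrite /step_before aE !(mem_cat, inE) !negb_or.
  case/and3P => /and3P[f1 f2 f3] f4 f5.
  rewrite f2 f4 f5 !xpair_eqE (negPf (cn_nm du)) /= !andbT.
  apply/and4P; split; try (apply/negP => /mem_dec_nm[]; [exact/negP|exact/negP]).
    by apply: contra dS => /mem_gam_nm h; rewrite mem_cat h.
  by apply: contra dS => /mem_gam_nm h; rewrite mem_cat h orbT.
have sg1 : sg (nm d1) = (o == (b1 == ~~ r)) by rewrite sg_nm.
have sg3 : sg (nm d3) = (o == (~~ b1 == ~~ r)) by rewrite sg_nm.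
have c13 : nm d1 != nm d3.
  by rewrite (inj_eq nm_inj) /d1 /d3 !xpair_eqE !eqxx /=; case: b1.
have w2n : dec S a3 ++ e1 ++ gam Sl <> [::].
  by move/(congr1 size); rewrite !size_cat; case: (e1) e1n => //= y e _; lia.
have gB' := gB; rewrite BE in gB'.
have [gA sA] := pass_vertex sg_cn sg1 sg3 gB' c13
  (fun b => eq_ind _ (fun w => (nm d1, b) \notin w) (fr d1 b erefl) _ BE)
  (fun b => eq_ind _ (fun w => (nm d3, b) \notin w) (fr d3 b erefl) _ BE) w2n.
rewrite -BE in sA.
set A := pass_after _ _ _ _ _ _ _ _ _ _ _ _ in gA sA.
pose g (c : C) := if c == cn then nm d2 else c.
have S'E k b : k.1 != u -> ((k, b) \in S') = ((k, b) \in S).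
  move=> ku; rewrite /S' /step_darts !(mem_cat, inE) !xpair_eqE.
  have -> : (k == (u, ~~ p)) = false by apply/eqP => e; rewrite e eqxx in ku.
  have -> : (k == (u, p)) = false by apply/eqP => e; rewrite e eqxx in ku.
  by [].
have [ub _] := andP gB.1.
pose restB := dec S a0 ++ dec S a2 ++ dec S a3 ++ e1 ++ gam Sl ++ gam Sr ++ e2.
have permB : perm_eq step_before [:: (cn, ~~ o), (cn, o), l, (u, ~~ p) & restB].
  rewrite BE /pass_before /restB; apply/seq.permP => P.
  have cc q s : count P (q :: s) = P q + count P s by [].
  rewrite !(count_cat, cc); move: (P _) (P _) (P _) (P _).
  by move: (count _ (dec S a0)) (count _ (dec S a2)) (count _ (dec S a3)); clear; lia.
have restg q : q \in restB -> q.1 != cn.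
  move=> qr; move: ub; rewrite (perm_uniq permB) /= => /and3P[h1 h2 _].
  move: h1 h2; rewrite !inE !negb_or => /and4P[_ _ _ h1] /and3P[_ _ h2].
  apply/eqP => e; move: qr h1 h2; rewrite [q]surjective_pairing e.
  by case: q.2; case: (o) => ->.
have gid s : {subset s <= restB} -> [seq (g q.1, q.2) | q <- s] = s.
  move=> sr; apply: map_id_in => q /sr/restg ne.
  by rewrite /g (negPf ne) -surjective_pairing.
have ucn : u != cn.
  apply/eqP => e; move: ub; rewrite (perm_uniq permB) /l e /= !inE !xpair_eqE !eqxx /=.
  by case: (o); case: (p); rewrite ?andbF.
have cn1 : nm d1 != cn by apply: cn_nm. have cn3 : nm d3 != cn by apply: cn_nm.
have g0 : [seq (g q.1, q.2) | q <- dec S a0] = dec S' a0.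
  rewrite gid; last by move=> q h; rewrite /restB mem_cat h.
  apply: dec_eq => k b ka0; rewrite S'E //.
  by apply: contra (u_new k.2) => /eqP <-; rewrite -surjective_pairing.
have uk k : k \in a2 ++ a3 -> k.1 != u.
  move=> k23; apply/eqP => e; move: ua; rewrite aE a1E.
  rewrite cat_uniq => /and3P[_ _] /= /andP[]; rewrite !mem_cat inE !negb_or cat_uniq /=.
  case/and3P=> n1 _ n2 /and4P[_]; rewrite negb_or => /andP[n3 _] n4 _.
  move: k23; rewrite mem_cat [k]surjective_pairing e /l in n1 n2 *.
  case: (eqVneq k.2 p) => [->|ne]; first by rewrite (negPf n1) (negPf n2).
  have -> : k.2 = ~~ p by move: ne; case: (k.2); case: (p).
  by rewrite (negPf n3) (negPf n4).
have ga2 : [seq (g q.1, q.2) | q <- dec S a2] = dec S' a2.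
  rewrite gid; last by move=> q h; rewrite /restB !mem_cat h orbT.
  by apply: dec_eq => k b ka; rewrite S'E //; apply: uk; rewrite mem_cat ka.
have ga3 : [seq (g q.1, q.2) | q <- dec S a3] = dec S' a3.
  rewrite gid; last by move=> q h; rewrite /restB !mem_cat h !orbT.
  by apply: dec_eq => k b ka; rewrite S'E //; apply: uk; rewrite mem_cat ka orbT.
have ge1 : [seq (g q.1, q.2) | q <- e1] = e1.
  by apply: gid => q h; rewrite /restB !mem_cat h !orbT.
have gsl : [seq (g q.1, q.2) | q <- gam Sl] = gam Sl.
  by apply: gid => q h; rewrite /restB !mem_cat h !orbT.
have gsr : [seq (g q.1, q.2) | q <- gam Sr] = gam Sr.
  by apply: gid => q h; rewrite /restB !mem_cat h !orbT.
have ge2 : [seq (g q.1, q.2) | q <- e2] = e2.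
  by apply: gid => q h; rewrite /restB !mem_cat h !orbT.
have gu : g u = u by rewrite /g (negPf ucn).
have gcn : g cn = nm d2 by rewrite /g eqxx.
have g1 : g (nm d1) = nm d1 by rewrite /g (negPf cn1).
have g3 : g (nm d3) = nm d3 by rewrite /g (negPf cn3).
have decl : dec1 S' l = [:: l; (nm d2, ~~ o)].
  have -> : dec1 S' l = [::] ++ l :: [:: (nm (l, true), ~~ o)]; last by [].
  have m1 : (l, false) \in S' = false.
    rewrite /S' /step_darts !(mem_cat, inE) /d1 /d2 /d3 !xpair_eqE !eqxx /=.
    have := plainS l false erefl; rewrite mem_cat negb_or => /andP[/negPf -> /negPf ->].
    by case: (p).
  have m2 : (l, true) \in S' by rewrite /S' /step_darts !(mem_cat, inE) eqxx !orbT.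
  by rewrite /dec1 m1 m2.
have decl' : dec1 S' (u, ~~ p) = [:: (nm (u, ~~ p, false), ~~ o); (u, ~~ p); (nm (u, ~~ p, true), ~~ o)].
  have m b : (u, ~~ p, b) \in S'.
    rewrite /S' /step_darts !(mem_cat, inE) /d1 /d2 /d3 !xpair_eqE !eqxx /=.
    by case: (b); case: b1; rewrite ?orbT.
  by rewrite /dec1 !m.
have QE : [seq (g q.1, q.2) | q <-
    if b1 then [:: (nm d3, ~~ o); (u, ~~ p); (nm d1, ~~ o)]
    else [:: (nm d1, ~~ o); (u, ~~ p); (nm d3, ~~ o)]] = dec1 S' (u, ~~ p).
  move: g1 g3; rewrite decl' /d1 /d3; case: b1 => q1 q3;
  by rewrite /= ?gu ?q1 ?q3.
have gamE : gam S' = gam Sl ++ (nm d1, o) :: (nm d2, o) :: (nm d3, o) :: gam Sr.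
  by rewrite /gam map_cat.
have AE : [seq (g q.1, q.2) | q <- A] = stage S'.
  rewrite /A /pass_after -/b1 /stage aE a1E !dec_cat !dec_cons dec_cat dec_cons decl gamE.
  rewrite !(map_cat, map_cons) QE /= gu gcn g1 g3 g0 ga2 ga3 ge1 gsl gsr ge2 -/l.
  by rewrite decl' -!catA /= -!catA.
have memA q : q \in A -> q \in step_before \/ q.1 = nm d1 \/ q.1 = nm d3.
  have permA : perm_eq A ((nm d1, o) :: (nm d1, ~~ o) :: (nm d3, o) :: (nm d3, ~~ o) :: step_before).
    rewrite BE /A /pass_after /pass_before -/b1; apply/seq.permP => P.
    have cc q' s : count P (q' :: s) = P q' + count P s by [].
    rewrite !(count_cat, cc); have -> : count P (if b1 then [:: (nm d3, ~~ o); (u, ~~ p); (nm d1, ~~ o)]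
      else [:: (nm d1, ~~ o); (u, ~~ p); (nm d3, ~~ o)]) =
      P (nm d3, ~~ o) + P (u, ~~ p) + P (nm d1, ~~ o).
      by case: b1; rewrite /= addn0; move: (P _) (P _) (P _); clear; lia.
    move: (P (nm d3, ~~ o)) (P (nm d1, ~~ o)) (P (nm d3, o)) (P (nm d1, o)).
    move: (P (u, p)) (P (u, ~~ p)) (P (cn, o)) (P (cn, ~~ o)).
    by move: (count _ (dec S a0)) (count _ (dec S a2)) (count _ (dec S a3)); clear; lia.
  rewrite (perm_mem permA) !inE => /or4P[| | |/orP[]]; try by move/eqP->; auto.
  by left.
have d2A q : q \in A -> q.1 != nm d2.
  case/memA => [qB|[->|->]]; last 2 first.
  - by rewrite (inj_eq nm_inj) /d1 /d2 !xpair_eqE; case: (p); rewrite ?andbF.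
  - by rewrite (inj_eq nm_inj) /d3 /d2 !xpair_eqE; case: (p); rewrite ?andbF.
  by apply: contraL qB => /eqP e; rewrite [q]surjective_pairing e fr.
have ginj c b c' b' : (c, b) \in A -> (c', b') \in A -> g c = g c' -> c = c'.
  move=> /d2A /= cA /d2A /= c'A; rewrite /g.
  case: eqP => [->|_]; case: eqP => [-> //|_] // e; first by rewrite e eqxx in c'A.
  by rewrite e eqxx in cA.
have gsg c b : (c, b) \in A -> sg (g c) = sg c.
  by move=> _; rewrite /g; case: eqP => // ->; rewrite sg_cn sg_nm.
split; first by rewrite -AE; apply: good_map.
apply: (wsame_trans gA sA); apply: (wsame_map_rot (k := 0) ginj gsg).
by rewrite rot0.
Qed.

End Step.
End Sweep.

End Sweep.
Import Sweep.

(** * Removing the backtracks of the swept strand *)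

Module Cancellation.
Lemma gword_remove2 (C : choiceType) (W w : seq (C * bool)) (v v' : C) (o : bool) :
  gword W -> perm_eq W [:: (v, o), (v, ~~ o), (v', o), (v', ~~ o) & w] ->
  [/\ gword w, v != v', forall b, (v, b) \notin w & forall b, (v', b) \notin w].
Proof.
move=> /andP[uW /allP cW] pW.
have := uW; rewrite (perm_uniq pW) /= !inE !negb_or !xpair_eqE !eqxx /=.
case/and5P=> /and4P[_ n1 _ n2] /and3P[_ _ n3] /andP[_ n4] n5 uw.
have vv' : v != v' by apply: contra n1 => ->.
have fv b : (v, b) \notin w by move: n2 n3; case: (b); case: (o).
have fv' b : (v', b) \notin w by move: n4 n5; case: (b); case: (o).
split=> //; apply/andP; split=> //; apply/allP => l lw.
have := cW l; rewrite !(perm_mem pW) !inE lw !orbT => /(_ isT).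
have nl c : (forall b, (c, b) \notin w) -> l.1 != c.
  by move=> fc; apply: contra (fc l.2) => /eqP <-; rewrite -surjective_pairing.
by rewrite !xpair_eqE (negPf (nl _ fv)) (negPf (nl _ fv')).
Qed.

Section Slide.
Variables (C : choiceType) (sg : C -> bool).
Local Notation wdart := (wdart C).
Local Notation good := (good sg).
Local Notation wsame := (wsame sg).
Variables (r o : bool) (nm : wdart -> C) (a e1 e2 : seq (C * bool)).
Hypothesis sg_nm : forall d, sg (nm d) = (o == (d.2 == ~~ r)).
Hypothesis ga : good a.
Implicit Types (S : seq wdart) (s : seq (C * bool)).
Local Notation dec := (dec o nm).
Local Notation dec1 := (dec1 o nm).
Local Notation gam := (gam o nm).
Local Notation stage := (stage o nm a e1 e2).

Let ua : uniq a. Proof. by case/andP: ga.1. Qed.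

(** The strand crosses one edge of [a] twice in succession, which leaves a bigon. This bigon lies
    ahead of the moving strand, whereas those made by a push lie behind it; hence the side [~~ r].
    [par] holds when the strand meets the two crossings in the order of the edge. *)
Lemma sweep_cancel p1 k k' p2 S1 d d' S2 :
  a = p1 ++ k :: k' :: p2 -> uniq (S1 ++ d :: d' :: S2) ->
  (d = (k, true) /\ d' = (k', false)) \/ (d = (k', false) /\ d' = (k, true)) ->
  good (stage (S1 ++ d :: d' :: S2)) ->
  good (stage (S1 ++ S2)) /\ wsame (stage (S1 ++ d :: d' :: S2)) (stage (S1 ++ S2)).
Proof.
move=> aE uS dd; set S := S1 ++ d :: d' :: S2; set S' := S1 ++ S2 => gS.
have memS y : (y \in S) = (y \in S') || (y == d) || (y == d').
  by rewrite /S /S' !mem_cat !inE; do ![case: (_ \in _) | case: (_ == _)].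
have [dS' d'S'] : d \notin S' /\ d' \notin S'.
  move: uS; rewrite -/S (perm_uniq (s2 := d :: d' :: S')).
    by rewrite /= inE negb_or => /and3P[/andP[_ ->] ->].
  exact: permEl (perm_catCA S1 [:: d; d'] S2).
have [kS k'S] : (k, true) \in S /\ (k', false) \in S.
  by case: dd => -[<- <-]; rewrite !memS !eqxx ?orbT.
have [kS' k'S'] : (k, true) \notin S' /\ (k', false) \notin S'.
  by case: dd => -[<- <-].
have other y : y != (k, true) -> y != (k', false) -> (y \in S) = (y \in S').
  by move=> n1 n2; rewrite memS; case: dd => -[-> ->]; rewrite (negPf n1) (negPf n2) ?orbF.
have ua' := ua; rewrite aE in ua'.
have [kp1 k'p1 kp2 k'p2 kk'] : [/\ k \notin p1, k' \notin p1, k \notin p2, k' \notin p2 & k != k'].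
  move: ua'; rewrite cat_uniq /= !inE !negb_or => /and3P[_ /and3P[-> -> _]].
  by case/and3P=> /andP[-> ->] ->.
have decp s : k \notin s -> k' \notin s -> dec S s = dec S' s.
  move=> ks k's; apply: dec_eq => q b qs; apply: other.
    by apply: contra ks => /eqP[<- _].
  by apply: contra k's => /eqP[<- _].
pose pk := if (k, false) \in S' then [:: (nm (k, false), ~~ o)] else [::].
pose qk := if (k', true) \in S' then [:: (nm (k', true), ~~ o)] else [::].
have dk : dec1 S k = pk ++ k :: [:: (nm (k, true), ~~ o)].
  rewrite /Sweep.dec1 kS (other (k, false)) //; first by rewrite xpair_eqE andbF.
  by rewrite xpair_eqE andbT.
have dk' : dec1 S k' = (nm (k', false), ~~ o) :: k' :: qk.
  rewrite /Sweep.dec1 k'S (other (k', true)) //; last by rewrite xpair_eqE andbF.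
  by rewrite xpair_eqE andbT eq_sym.
have ek : dec1 S' k = pk ++ [:: k] by rewrite /Sweep.dec1 (negPf kS').
have ek' : dec1 S' k' = k' :: qk by rewrite /Sweep.dec1 (negPf k'S').
pose L := dec S' p1 ++ pk ++ [:: k].
pose M := k' :: qk ++ dec S' p2 ++ e1 ++ gam S1.
pose Q := gam S2 ++ e2.
have SE : stage S = L ++ (nm (k, true), ~~ o) :: (nm (k', false), ~~ o) ::
    M ++ (nm d, o) :: (nm d', o) :: Q.
  rewrite /Sweep.stage aE dec_cat !dec_cons dk dk' !decp // /Sweep.gam map_cat /=.
  by rewrite /L /M /Q -!catA /= -!catA.
have S'E : stage S' = L ++ M ++ Q.
  rewrite /Sweep.stage aE dec_cat !dec_cons ek ek' /Sweep.gam map_cat /=.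
  by rewrite /L /M /Q -!catA /= -!catA.
pose par := d == (k, true).
have parE : (if par then nm d else nm d') = nm (k, true) /\
            (if par then nm d' else nm d) = nm (k', false).
  rewrite /par; case: dd => -[-> ->]; first by rewrite eqxx.
  by rewrite xpair_eqE andbF.
have BE : bigon_word o par (nm d) (nm d') M (Q ++ L) = rot (size L) (stage S).
  by rewrite SE rot_size_cat /bigon_word parE.1 parE.2 /= -!catA /= -!catA.
have gB : good (bigon_word o par (nm d) (nm d') M (Q ++ L)) by rewrite BE; apply: good_rot.
have pB : perm_eq (bigon_word o par (nm d) (nm d') M (Q ++ L))
    [:: (nm d, o), (nm d, ~~ o), (nm d', o), (nm d', ~~ o) & M ++ Q ++ L].
  apply/seq.permP => P; have cc q' s : count P (q' :: s) = P q' + count P s by [].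
  rewrite /bigon_word !(count_cat, cc); case: (par);
  move: (P (nm d, o)) (P (nm d, ~~ o)) (P (nm d', o)) (P (nm d', ~~ o)) (count P M) (count P Q) (count P L);
  by clear; lia.
have [gw vv' fv fv'] := gword_remove2 gB.1 pB.
have Mn : M <> [::] by [].
have Ln : Q ++ L <> [::] by move/(congr1 size); rewrite /L !size_cat /= addn1 !addnS.
have tr y x' : wturn sg (~~ r) (nm y, o, x') = (nm y, ~~ o, x' (+) y.2) /\
    wturn sg (~~ r) (nm y, ~~ o, x') = (nm y, o, x' (+) ~~ y.2).
  have sgy : sg (nm y) = (o == (~~ y.2 == ~~ ~~ r)).
    by rewrite sg_nm; congr (_ == _); case: (y.2); case: (r).
  by have [h1 h2] := sg_turn x' sgy; rewrite h1 h2 negbK.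
have T1 : wturn sg (~~ r) (nm d', o, false) = (nm d', ~~ o, ~~ par).
  by rewrite (tr d' false).1 /par; case: dd => -[-> ->]; rewrite /= ?eqxx ?xpair_eqE ?andbF.
have T2 : wturn sg (~~ r) (nm d, ~~ o, par) = (nm d, o, true).
  by rewrite (tr d par).2 /par; case: dd => -[-> _]; rewrite /= ?eqxx ?xpair_eqE ?andbF.
have g2 : good (M ++ Q ++ L) := bigon_word_remove vv' fv fv' Mn Ln T1 T2 gw gB.
have s2 := bigon_word_wsame vv' fv fv' Mn Ln T1 T2 gw.
have S'rot : stage S' = (L ++ (M ++ Q)) by rewrite S'E.
have gMQL : good ((M ++ Q) ++ L) by rewrite -catA.
split; first by rewrite S'rot; apply: good_catC.
apply: (wsame_trans gB); first by rewrite BE; apply: wsame_rot.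
apply: (wsame_trans g2 s2); rewrite S'rot catA; exact: wsame_catC.
Qed.

Variables (R : finType) (lab : wdart -> R).
Variables (l1 : C * bool) (a' : seq (C * bool)).
Hypothesis aE1 : a = l1 :: a'.
Let om : wdart := (last l1 a', true).
Let op := wopp a.
Let x := lab (l1, false).

Let opK : involutive op. Proof. exact: woppK. Qed.

(** While several crossings are left, [adjacent_pair] finds two that cancel. This lowers [size S] by
    two and the number of gap labels by at most one, so the inequality persists until only [om]
    remains. *)
Lemma sweep_reduce S : uniq S -> om \in S -> op om \notin S ->
  (forall d, d \in S -> d.1 \in a) ->
  (forall d, d \in S -> d != om -> op d \in S) ->
  chain op lab x S -> size S + 3 <= 2 * size (gap_labels lab x S) ->
  good (stage S) -> good (stage [:: om]) /\ wsame (stage S) (stage [:: om]).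
Proof.
have [n] := ubnP (size S); elim: n S => // n IH S; rewrite ltnS => leS uS omS oomS Sa clS ch card gS.
case: (leqP (size S) 1) => [le1|gt1].
  have SE : S = [:: om].
    case: S omS le1 {leS uS oomS Sa clS ch card gS} => [|y [|z S]] //=.
    by rewrite inE => /eqP ->.
  by rewrite SE in gS *; split=> //; apply: wsame_refl.
have [S1 [d [S2 SE]]] := adjacent_pair opK uS omS oomS clS ch card gt1.
have dS : d \in S by rewrite SE mem_cat mem_head orbT.
have odS : op d \in S by rewrite SE mem_cat !inE eqxx !orbT.
have dom : d != om by apply: contra oomS => /eqP <-.
have odom : op d != om by apply: contra oomS => /eqP <-; rewrite opK.
have split2 k : k \in a -> (k, true) != om -> exists p1 k' p2,
    a = p1 ++ k :: k' :: p2 /\ op (k, true) = (k', false).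
  move=> ka ne; have [p1 [p2 aE]] : exists p1 p2, a = p1 ++ k :: p2.
    by case/splitPr: ka => p1 p2; exists p1, p2.
  case: p2 aE => [|k' p2] aE.
    case/eqP: ne; rewrite /om; congr (_, _).
    have : last l1 a = last l1 (p1 ++ [:: k]) by rewrite aE.
    by rewrite aE1 last_cat.
  exists p1, k', p2; split=> //.
  have u := ua; rewrite aE in u; rewrite /op aE.
  exact: (wopp_split u).1.
have [p1 [k [k' [p2 [aE dd]]]]] : exists p1 k k' p2, a = p1 ++ k :: k' :: p2 /\
    ((d = (k, true) /\ op d = (k', false)) \/ (d = (k', false) /\ op d = (k, true))).
  case: d dS odS dom odom {SE} => k [] dS odS dom odom.
    have [p1 [k' [p2 [aE e]]]] := split2 _ (Sa _ dS) dom.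
    by exists p1, k, k', p2; split=> //; left.
  have e : op (k, false) = ((op (k, false)).1, true) by [].
  have [p1 [k' [p2 [aE e']]]] := split2 _ (Sa _ odS) odom.
  exists p1, (op (k, false)).1, k', p2; split=> //; right; split=> //.
  by rewrite -e' -e opK.
have uS' := uS; have gS' := gS; have ch' := ch; rewrite SE in uS' gS' ch'.
have [g2 s2] := sweep_cancel aE uS' dd gS'.
have memS y : (y \in S) = [|| y \in S1 ++ S2, y == d | y == op d].
  by rewrite SE !mem_cat !inE; do ![case: (_ \in _) | case: (_ == _)].
have [dn odn u2] : [/\ d \notin S1 ++ S2, op d \notin S1 ++ S2 & uniq (S1 ++ S2)].
  move: uS'; rewrite (perm_uniq (s2 := d :: op d :: S1 ++ S2)).
    by rewrite /= inE negb_or => /and3P[/andP[_ ->] -> ->].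
  exact: permEl (perm_catCA S1 [:: d; op d] S2).
have sS : size S = (size (S1 ++ S2)).+2 by rewrite SE !size_cat /= !addnS.
have [|||||||||g3 s3] := IH (S1 ++ S2).
- by rewrite -ltnS -sS ltnW.
- by [].
- by move: omS; rewrite memS ![om == _]eq_sym (negPf dom) (negPf odom) !orbF.
- by apply: contra oomS => h; rewrite memS h.
- by move=> y yS; apply: Sa; rewrite memS yS.
- move=> y yS yn; have : op y \in S by apply: clS; rewrite // memS yS.
  rewrite memS => /or3P[//|/eqP e|/eqP e].
    by move: odn; rewrite -e opK yS.
  by move: dn; rewrite -(inv_inj opK e) yS.
- exact: cancel_chain ch'.
- have := cancel_labels ch'; rewrite -SE; move: card; rewrite sS.
  by move: (size (gap_labels _ _ _)) (size (gap_labels _ _ _)) (size _); clear; lia.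
- by [].
by split=> //; rewrite SE; apply: (wsame_trans g2).
Qed.

End Slide.

End Cancellation.
Import Cancellation.

(** * The invariant of the sweep *)

Module SweepInvariant.
Section Inv.
Variables (C : choiceType) (sg : C -> bool).
Local Notation wdart := (wdart C).
Local Notation good := (good sg).
Local Notation wsame := (wsame sg).
Variables (r o : bool) (nm : wdart -> C) (a e1 e2 : seq (C * bool)).
Hypothesis nm_inj : injective nm.
Hypothesis sg_nm : forall d, sg (nm d) = (o == (d.2 == ~~ r)).
Hypothesis fresh : forall d b, (nm d, b) \notin a ++ e1 ++ e2.
Hypothesis ga : good a.
Hypothesis e1n : e1 <> [::].
Implicit Types (S : seq wdart) (s : seq (C * bool)).
Local Notation dec := (dec o nm).
Local Notation dec1 := (dec1 o nm).
Local Notation gam := (gam o nm).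
Local Notation stage := (stage o nm a e1 e2).
Variables (R : finType) (lab : wdart -> R).
Hypothesis labP : tlabels sg r a lab.
Variables (l1 : C * bool) (a' : seq (C * bool)).
Hypothesis aE1 : a = l1 :: a'.
Variable xn : C.
Hypothesis sg_xn : sg xn = (o == (true == ~~ r)).
Hypothesis nm_xn : forall d, nm d != xn.
Local Notation start := ((xn, ~~ o) :: a ++ e1 ++ (xn, o) :: e2).
Hypothesis g_start : good start.

Let ua : uniq a. Proof. by case/andP: ga.1. Qed.
Let ca l : l \in a -> (l.1, ~~ l.2) \in a.
Proof. by case/andP: ga.1 => _ /allP; apply. Qed.
Let op := wopp a.
Let x := lab (l1, false).

Definition first_visit (k : C * bool) : bool := index k a < index (k.1, ~~ k.2) a.
Definition seen (N : nat) (c : C) : bool :=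
  (index (c, true) a < N) || (index (c, false) a < N).
(* The edges by which the first N letters of [a] first reach a crossing form a
   tree; these are the darts leaving the crossings of that tree along other edges. *)
Definition contour (N : nat) (d : wdart) : bool :=
  seen N d.1.1 && ~~ (if d.2 then ((index d.1 a).+1 < N) &&
    first_visit (nth d.1 a (index d.1 a).+1) else first_visit d.1).

(** Each new crossing replaces one intersection of the strand by three, whence [swept_size];
    [swept_labels] says that the gaps of the strand meet every region around the visited crossings.
    At the end these two give the inequality required by [sweep_reduce]. *)
Record swept (N : nat) (S : seq wdart) : Prop := Swept {
  swept_uniq : uniq S;
  swept_mem : forall d, (d \in S) = contour N d;
  swept_chain : chain op lab x S;
  swept_labels : forall e, seen N e.1.1 -> lab e \in x :: map lab S;
  swept_size : size S = (count first_visit (take N a)).*2.+1;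
  swept_good : good (stage S);
  swept_same : wsame start (stage S) }.

Lemma seenE N c b : seen N c = (index (c, b) a < N) || (index (c, ~~ b) a < N).
Proof. by case: b; rewrite // orbC. Qed.

Lemma seen_mem N (l : C * bool) : N <= size a -> seen N l.1 -> l \in a.
Proof.
move=> le; rewrite (seenE _ _ l.2) -surjective_pairing.
case/orP=> h; have := leq_trans h le; rewrite index_mem // => /ca /=.
by rewrite negbK -surjective_pairing.
Qed.

Section Position.
Variables (N : nat).
Hypothesis ltN : N < size a.
Let l := nth l1 a N.
Let u := l.1.
Let p := l.2.
Let b1 := (p == sg u) (+) r.
Let d1 : wdart := (u, ~~ p, b1).
Let d2 : wdart := (u, p, true).
Let d3 : wdart := (u, ~~ p, ~~ b1).
Let lE : l = (u, p). Proof. exact: surjective_pairing. Qed.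
Let la : l \in a. Proof. exact: mem_nth. Qed.
Let idx_l : index l a = N. Proof. exact: index_uniq. Qed.

Let idxP k : (index k a == N) = (k == l).
Proof.
apply/eqP/eqP => [e|->//]; have ka : k \in a by rewrite -index_mem e.
by rewrite /l -e nth_index.
Qed.

Let aE : a = take N a ++ l :: drop N.+1 a.
Proof. by rewrite -[LHS](cat_take_drop N) (drop_nth l1 ltN). Qed.

Lemma mem_fan d : (d \in [:: d1; d2; d3]) = (d.1.1 == u) && (d != (l, false)).
Proof.
rewrite lE !inE /d1 /d2 /d3; case: d => [[c q] b]; rewrite !xpair_eqE /=.
by case: (c == u) => //=; move: b1 => bb; case: q b p bb => [] [] [] [].
Qed.

Let turn2 : wturn sg r d2 = d1.
Proof. by rewrite /wturn /d1 /d2 /b1; case: r => /=; case: (p == sg u). Qed.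
Let turn1 : wturn sg r d1 = (l, false).
Proof. by rewrite -turn2 wturn2 lE. Qed.
Let turn3 : wturn sg r d3 = d2.
Proof. by rewrite -[d3]/(flip d1) wturn_flip turn1 lE. Qed.
Let turnl : wturn sg r (l, false) = d3.
Proof. by rewrite lE -[(u, p, false)]/(flip d2) wturn_flip turn2. Qed.

Lemma seen_succ c : seen N.+1 c = seen N c || (c == u).
Proof.
have idx k : (index k a < N.+1) = (index k a < N) || (k == l).
  by rewrite ltnS leq_eqVlt idxP orbC.
rewrite (seenE _ _ p) (seenE N _ p) !idx lE !xpair_eqE eqxx andbT.
by case: (c == u); rewrite ?orbT ?orbF //=; case: p; rewrite ?orbF.
Qed.

(** An edge that returns to a visited crossing is not in the tree, so the contour stays the same. *)
Lemma contour_seen d : seen N u -> contour N.+1 d = contour N d.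
Proof.
move=> su; have -> : contour N.+1 d = seen N d.1.1 && ~~ (if d.2 then ((index d.1 a).+1 < N.+1) &&
    first_visit (nth d.1 a (index d.1 a).+1) else first_visit d.1).
  rewrite /contour seen_succ; case: eqP => [->|_]; last by rewrite orbF.
  by rewrite su.
rewrite /contour; congr (_ && ~~ _); case: d.2 => //.
rewrite [in LHS]ltnS leq_eqVlt; case: eqP => //= e.
have -> : nth d.1 a (index d.1 a).+1 = l by rewrite e; apply: set_nth_default.
move: su; rewrite (seenE _ _ p) -lE idx_l ltnn /= => h.
by rewrite /first_visit idx_l -/u -/p [_ < index _ _]ltnNge (ltnW h) andbF.
Qed.

Section New.
Hypothesis new : ~~ seen N u.

Let idx_u q : N <= index (u, q) a.
Proof. by move: new; rewrite (seenE _ _ q) negb_or -!leqNgt => /andP[]. Qed.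

Let first_l : first_visit l.
Proof.
rewrite /first_visit idx_l ltn_neqAle idx_u andbT eq_sym idxP lE xpair_eqE.
by case: p; rewrite andbF.
Qed.

Lemma contour_new d : contour N.+1 d =
  if d.1.1 == u then d != (l, false)
  else contour N d && ~~ (((index d.1 a).+1 == N) && d.2).
Proof.
rewrite /contour seen_succ; case: eqP => [du|_]; last first.
  rewrite orbF -andbA; congr (_ && _); case: d => k [] /=; last by rewrite andbF andbT.
  rewrite andbT [in LHS]ltnS leq_eqVlt; case: eqP => [e|_]; last by rewrite andbT.
  have -> : nth k a (index k a).+1 = l by rewrite e; apply: set_nth_default.
  by rewrite first_l andbF.
rewrite orbT /=; case: d du => [[c q] b] /= ->; case: b.
  by rewrite ltnS (leq_gtF (idx_u q)) /= xpair_eqE andbF.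
rewrite lE !xpair_eqE eqxx andbT /=; case: (eqVneq q p) => [->|ne].
  by move: first_l; rewrite lE => ->.
have qE : ~~ q = p by move: ne; case: (q); case: (p).
by rewrite /first_visit /= qE -lE idx_l ltnNge idx_u.
Qed.

Let lab_op e : e.1 \in a -> lab (op e) = lab (wturn sg r e).
Proof. by case: labP => inv _ _ /inv. Qed.

Let mem_a (d : wdart) : d.1.1 = u -> d.1 \in a.
Proof.
case: d => [[c q] b] /= ->; case: (eqVneq q p) => [->|ne]; first by rewrite -lE.
by have -> : q = ~~ p; [move: ne; case: (q); case: (p) | exact: ca la].
Qed.

Let lab1 : lab (op d1) = lab (l, false). Proof. by rewrite lab_op ?turn1 ?mem_a. Qed.
Let lab2 : lab (op d2) = lab d1. Proof. by rewrite lab_op ?turn2 ?mem_a. Qed.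
Let lab3 : lab (op d3) = lab d2. Proof. by rewrite lab_op ?turn3 ?mem_a. Qed.
Let labl : lab (op (l, false)) = lab d3. Proof. by rewrite lab_op ?turnl. Qed.

Let u_new b : (u, b) \notin take N a.
Proof.
apply/negP => h; have ha := mem_take h; move: h; rewrite in_take //.
by rewrite ltnNge idx_u.
Qed.

Let fan_labels (d : wdart) S1 S2 : d.1.1 = u -> last x (map lab S1) = lab (l, false) ->
  lab d \in x :: map lab (S1 ++ [:: d1; d2; d3] ++ S2).
Proof.
move=> du e; case: (eqVneq d (l, false)) => [->|ne].
  by rewrite -e map_cat -cat_cons mem_cat mem_last.
rewrite inE map_f ?orbT // mem_cat mem_cat mem_fan ne du eqxx orbT //.
Qed.

Let fan_uniq : uniq [:: d1; d2; d3].
Proof. by rewrite /= !inE /d1 /d2 /d3 !xpair_eqE !eqxx /=; case: p b1 => [] []. Qed.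

(** The dart [t] that leads to [u] is crossed by the strand; [sweep_step] replaces it by the fan
    [d1], [d2], [d3], which goes from the region before [t] to the region after it, so the chain is
    not broken. *)
Lemma sweep_new S : 0 < N -> swept N S -> exists S', swept N.+1 S'.
Proof.
move=> N0 [uS memS ch labS sz gS sS].
pose z := nth l1 a N.-1; pose t : wdart := (z, true).
have idx_z : index z a = N.-1 by apply: index_uniq => //; rewrite prednK // ltnW.
have z_lt : index z a < N by rewrite idx_z prednK.
have seen_z : seen N z.1 by rewrite (seenE _ _ z.2) -surjective_pairing z_lt.
have zu : z.1 != u by apply: contraTneq seen_z => ->.
have tS : t \in S.
  by rewrite memS /contour /= seen_z idx_z prednK // ltnn.
have [Sl [Sr SE]] : exists Sl Sr, S = Sl ++ t :: Sr.
  by case/splitPr: tS => Sl Sr; exists Sl, Sr.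
have memS' y : (y \in Sl ++ Sr) = (y \in S) && (y != t).
  move: uS; rewrite SE (perm_uniq (s2 := t :: Sl ++ Sr)); last first.
    exact: permEl (perm_catCA Sl [:: t] Sr).
  rewrite /= => /andP[tn _]; case: (eqVneq y t) => [->|ne].
    by rewrite andbF (negPf tn).
  by rewrite andbT !mem_cat inE (negPf ne).
have takeE : take N a = rcons (take N.-1 a) z.
  by rewrite -{1}(prednK N0) (take_nth l1) // prednK // ltnW.
have aE' : a = take N.-1 a ++ z :: l :: drop N.+1 a by rewrite {1}aE takeE cat_rcons.
have opt : op t = (l, false) /\ op (l, false) = t.
  by have := ua; rewrite /op aE' => /wopp_split[].
have SnewP k b : k.1 = u -> (k, b) \notin S.
  by move=> ku; rewrite memS /contour /= ku (negPf new).
have Snew d : d \in Sl ++ Sr -> d.1.1 != u.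
  rewrite memS' => /andP[h _]; apply: contraTneq h => e.
  by case: d e => k b; apply: SnewP.
have decS s : z \notin s -> dec S s = dec (Sl ++ Sr) s.
  move=> zs; apply: dec_eq => k b ks; have kz : k != z by apply: contraNneq zs => <-.
  by rewrite memS' xpair_eqE (negPf kz) andbT.
have ua' := ua; rewrite aE' in ua'.
have [z1 z2] : z \notin take N.-1 a /\ z \notin drop N.+1 a.
  move: ua'; rewrite cat_uniq /= ?inE !negb_or => /and3P[_ /and3P[h _ _]].
  by case/andP => /andP[_ ->] _; split=> //; rewrite h.
have decz : dec1 S z = dec1 (Sl ++ Sr) z ++ [:: (nm t, ~~ o)].
  rewrite /Sweep.dec1 tS memS' xpair_eqE andbF andbT memS' eqxx andbF.
  by rewrite -catA.
have stE : stage S = step_before o nm e1 e2 (take N a) (drop N.+1 a) u (nm t) p Sl Sr.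
  rewrite /Sweep.stage /step_before {1}aE' dec_cat !dec_cons decz !decS //.
  rewrite (dec1_plain _ _ (k := l)) => [|b]; last exact: SnewP.
  rewrite takeE -cats1 dec_cat dec_cons /Sweep.gam SE map_cat /= cats0.
  by rewrite lE -!catA /=.
have gB := gS; rewrite stE in gB.
have aElu : a = take N a ++ (u, p) :: drop N.+1 a by rewrite -lE.
have sgt : sg (nm t) = (o == (true == ~~ r)) by rewrite sg_nm.
have cn d : d.1.1 = u -> nm d != nm t.
  by move=> du; rewrite (inj_eq nm_inj); apply: contraNneq zu => e; rewrite -du e.
have [g' s'] := sweep_step nm_inj sg_nm fresh ua ca e1n aElu sgt u_new Snew cn gB.
rewrite -stE in s'.
have mem_step d : (d \in Sl ++ [:: d1; d2; d3] ++ Sr) =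
    (d \in Sl ++ Sr) || (d \in [:: d1; d2; d3]).
  by rewrite !mem_cat; do ![case: (d \in _)].
have tcase d : ((index d.1 a).+1 == N) && d.2 = (d == t).
  case: d => k b; rewrite xpair_eqE /=; case: b; rewrite ?andbF ?andbT //.
  rewrite -{1}(prednK N0) eqSS -idx_z; apply/eqP/eqP => [e|-> //].
  have ka : k \in a by rewrite -index_mem e idx_z prednK // ltnW.
  by rewrite -(nth_index l1 ka) e idx_z.
move: ch; rewrite SE => /chain_cat[ch1 [ch2 ch3]].
rewrite opt.1 in ch2.
exists (Sl ++ [:: d1; d2; d3] ++ Sr); split.
- rewrite (perm_uniq (s2 := [:: d1; d2; d3] ++ Sl ++ Sr)).
    rewrite cat_uniq fan_uniq /=.
    have -> : uniq (Sl ++ Sr).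
      by move: uS; rewrite SE !cat_uniq /= negb_or => /and3P[-> /andP[_ ->] /andP[_ ->]].
    rewrite andbT; apply/hasPn => d /Snew du; rewrite mem_fan (negPf du).
    by [].
  exact: permEl (perm_catCA Sl [:: d1; d2; d3] Sr).
- move=> d; rewrite mem_step contour_new mem_fan memS' memS tcase.
  case: (d.1.1 =P u) => [du|_]; last by rewrite /= orbF.
  by rewrite /contour du (negPf new).
- apply/chain_cat; split=> //=; rewrite lab1 lab2 lab3; split=> //; split=> //; split=> //.
  by rewrite -labl opt.2.
- move=> e; rewrite seen_succ => /orP[se|/eqP eu]; last exact: fan_labels.
  have := labS e se; rewrite SE !inE !map_cat !mem_cat /= !inE.
  case/orP => [->//|]; case/or3P => [->|/eqP ->|->]; rewrite ?orbT //.
  by rewrite -opt.2 labl eqxx !orbT.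
- rewrite (take_nth l1) // -cats1 count_cat -/l /= first_l addn0 doubleD.
  by move: sz; rewrite SE !size_cat /=; move: (_.*2) (size Sl) (size Sr); clear; lia.
- exact: g'.
exact: wsame_trans gS sS s'.
Qed.

(** Here [xn], on the edge that enters the first letter of [a], takes the place of the dart leading
    to the new crossing. *)
Lemma sweep_init : N = 0 -> exists S, swept 1 S.
Proof.
move=> N0; have ll1 : l = l1 by rewrite /l N0 aE1.
have t0 : take N a = [::] by rewrite N0 take0.
have aElu : a = [::] ++ (u, p) :: drop N.+1 a by rewrite -t0 -lE.
have nil0 : forall d : wdart, d \in [::] ++ [::] -> d.1.1 != u by [].
have cn (d : wdart) : d.1.1 = u -> nm d != xn by move=> _; apply: nm_xn.
have dec0 s : dec [::] s = s by elim: s => //= k s IH; rewrite dec_cons IH.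
have stE : start = step_before o nm e1 e2 [::] (drop N.+1 a) u xn p [::] [::].
  by rewrite /step_before /= dec0; congr (_ :: _); rewrite [X in X ++ _]aElu.
have gB := g_start; rewrite stE in gB.
have [g' s'] := sweep_step nm_inj sg_nm fresh ua ca e1n aElu sg_xn
  (fun b => isT) nil0 cn gB.
rewrite -stE in s'.
have lastx : last x (map lab [::]) = lab (l, false) by rewrite /x ll1.
exists [:: d1; d2; d3]; split; rewrite -?N0.
- exact: fan_uniq.
- move=> d; rewrite mem_fan contour_new /contour.
  case: eqP => // _; rewrite /seen {1 2}N0 !ltn0 /=; by [].
- by rewrite /= lab1 lab2 lab3 /x ll1.
- move=> e; rewrite seen_succ {1}/seen {1 2}N0 !ltn0 /= => /eqP eu.
  by have := fan_labels [::] eu lastx; rewrite cats0.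
- by rewrite (take_nth l1) // t0 /= -/l first_l.
- exact: g'.
exact: s'.
Qed.

End New.

Lemma sweep_seen S : seen N u -> swept N S -> swept N.+1 S.
Proof.
move=> su [uS memS ch labS sz gS sS]; split=> //.
- by move=> d; rewrite contour_seen.
- move=> e; rewrite seen_succ => /orP[se|/eqP eu]; apply: labS => //.
  by rewrite eu.
rewrite (take_nth l1) // -cats1 count_cat -/l /=.
suff -> : first_visit l = false by rewrite !addn0.
move: su; rewrite (seenE _ _ p) -lE idx_l ltnn /= => h.
by rewrite /first_visit idx_l -/u -/p ltnNge (ltnW h).
Qed.

End Position.

Lemma sweep_prefix N : 0 < N <= size a -> exists S, swept N S.
Proof.
elim: N => // N IH /andP[_ ltN]; case: (posnP N) => [N0|Ngt0].
  have lt0 : 0 < size a by rewrite aE1.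
  by rewrite N0; apply: (sweep_init lt0).
have [|S SP] := IH; first by rewrite Ngt0 ltnW.
case: (boolP (seen N (nth l1 a N).1)) => [su|new].
  by exists S; apply: sweep_seen.
exact: sweep_new new S Ngt0 SP.
Qed.

Lemma index_star k : k \in a -> index (k.1, ~~ k.2) a != index k a.
Proof.
move=> ka; apply/eqP => e; have := nth_index l1 (ca ka); rewrite e nth_index //.
by move/(congr1 snd); case: k {ka e} => c [].
Qed.

(** The involution exchanging the two letters of each crossing exchanges first and second visits. *)
Lemma count_first_visit : (count first_visit a).*2 = size a.
Proof.
pose star (k : C * bool) := (k.1, ~~ k.2).
have starK : involutive star by case=> c b; rewrite /star /= negbK.
have pa : perm_eq (map star a) a.
  apply: uniq_perm => //; first by rewrite (map_inj_uniq (inv_inj starK)).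
  move=> k; apply/mapP/idP => [[k' ka ->]|ka]; first exact: ca.
  by exists (star k); [apply: ca | rewrite starK].
rewrite -addnn -{2}(seq.permP pa first_visit) count_map -(count_predC first_visit a).
congr (_ + _); apply: eq_in_count => k ka /=.
rewrite /first_visit -/(star k) /= negbK -surjective_pairing -leqNgt.
by rewrite [X in _ = X]leq_eqVlt (negPf (index_star ka)).
Qed.

(** After the last letter [size S] is [size a + 1] and all labels of [a] are met by gaps. Planarity
    gives [size a + 4 <= 2 * #|R|], which is exactly what allows cancelling down to the edge leaving
    [a]. *)
Lemma sweep_end : exists om : wdart, [/\ om = (last l1 a', true),
  good (stage [:: om]) & wsame start (stage [:: om])].
Proof.
have sza : 0 < size a <= size a by rewrite aE1 /= leqnn.
have [S [uS memS ch labS sz gS sS]] := sweep_prefix sza.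
pose om : wdart := (last l1 a', true); exists om.
have lastE : nth l1 a (size a).-1 = last l1 a' by rewrite nth_last aE1.
have ltp : (size a).-1 < size a by rewrite prednK //; case/andP: sza.
have idx_om : index (last l1 a') a = (size a).-1 by rewrite -lastE index_uniq.
have seen_all k : k \in a -> seen (size a) k.1.
  by move=> ka; rewrite (seenE _ _ k.2) -surjective_pairing index_mem ka.
have last_a : last l1 a' \in a by rewrite -lastE mem_nth.
have idx1 : index l1 a = 0 by rewrite aE1 /= eqxx.
have op_om : op om = (l1, false).
  have u' := ua; rewrite /op /om aE1 in u' *.
  exact: (congr1 (fun k => (k, false)) (next_last u')).
have omS : om \in S.
  by rewrite memS /contour seen_all //= idx_om prednK ?ltnn //; case/andP: sza.
have oomS : op om \notin S.
  rewrite memS op_om /contour /= negb_and negbK orbC /first_visit idx1 lt0n.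
  by rewrite -idx1 index_star // aE1 mem_head.
have Sa d : d \in S -> d.1 \in a.
  by rewrite memS => /andP[h _]; apply: seen_mem h.
have nthE k i : k \in a -> i < size a -> index k a = i -> exists p q, a = p ++ k :: q /\ size p = i.
  move=> ka lt e; exists (take i a), (drop i.+1 a); split; last by rewrite size_take lt.
  by rewrite -{1}(nth_index k ka) e -drop_nth // cat_take_drop.
have clS d : d \in S -> d != om -> op d \in S.
  case: d => k b dS ne; have ka : k \in a := Sa _ dS.
  have idxk : index k a < size a by rewrite index_mem.
  have [p [q [aE sp]]] := nthE k _ ka idxk erefl.
  move: dS; rewrite memS /contour => /andP[_]; case: b ne => /= ne.
    case: q aE => [|m q] aE.
      case/eqP: ne; rewrite /om; congr (_, _).
      have : last l1 a = last l1 (p ++ [:: k]) by rewrite aE.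
      by rewrite aE1 last_cat.
    have u' := ua; rewrite aE in u'.
    have -> : op (k, true) = (m, false) by rewrite /op aE (wopp_split u').1.
    have ma : m \in a by rewrite aE mem_cat !inE eqxx !orbT.
    have -> : nth k a (index k a).+1 = m.
      by rewrite -sp aE nth_cat ltnNge leqnSn /= subSn // subnn.
    have -> : (index k a).+1 < size a.
      by rewrite -sp aE size_cat /= !addnS !ltnS leq_addr.
    by rewrite memS /contour /= seen_all.
  case/lastP: p aE sp => [|p m] aE sp.
    case/negP; have k1 : k = l1 by have := aE; rewrite aE1 /= => -[].
    rewrite k1 /first_visit idx1 lt0n.
    by rewrite -idx1 index_star // aE1 mem_head.
  rewrite cat_rcons in aE; have u' := ua; rewrite aE in u'.
  have -> : op (k, false) = (m, true) by rewrite /op aE (wopp_split u').2.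
  have ma : m \in a by rewrite aE mem_cat !inE eqxx !orbT.
  have im : (index m a).+1 = index k a.
    rewrite -sp size_rcons aE index_cat /= eqxx addn0.
    by move: u'; rewrite cat_uniq /= negb_or => /and3P[_ /andP[/negPf -> _] _].
  rewrite memS /contour /= seen_all // im nth_index //.
  by move=> /negPf ->; rewrite andbF.
have card : size S + 3 <= 2 * size (gap_labels lab x S).
  case: labP => _ surj le.
  have h : #|R| <= size (gap_labels lab x S).
    rewrite cardE; apply: uniq_leq_size; first exact: enum_uniq.
    move=> y _; have [d da <-] := surj y; rewrite mem_undup; apply: labS.
    exact: seen_all da.
  rewrite sz take_size count_first_visit; move: le h.
  by move: (size a) #|R| (size _); clear; lia.
have [g' s'] := sweep_reduce sg_nm ga aE1 uS omS oomS Sa clS ch card gS.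
by split=> //; apply: wsame_trans gS sS s'.
Qed.

Lemma slide_fresh : good (a ++ (xn, ~~ o) :: e1 ++ (xn, o) :: e2) /\
  wsame start (a ++ (xn, ~~ o) :: e1 ++ (xn, o) :: e2).
Proof.
have [om [omE gE sE]] := sweep_end.
have stE : stage [:: om] = a ++ (nm om, ~~ o) :: e1 ++ (nm om, o) :: e2.
  have aL : a = rcons (belast l1 a') (last l1 a') by rewrite -lastI.
  have u' := ua; rewrite aL rcons_uniq in u'; case/andP: u' => ln ub.
  have plain s : last l1 a' \notin s -> dec [:: om] s = s.
    elim: s => //= k s IH; rewrite inE negb_or eq_sym => /andP[kn /IH].
    rewrite dec_cons => ->; rewrite dec1_plain // => b.
    by rewrite inE omE xpair_eqE (negPf kn).
  have decl : dec1 [:: om] (last l1 a') = [:: last l1 a'; (nm om, ~~ o)].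
    by rewrite /Sweep.dec1 !inE omE !xpair_eqE eqxx andbF.
  rewrite /Sweep.stage aL -cats1 dec_cat plain // dec_cons decl /=.
  by rewrite -!catA.
have [us _] := andP g_start.1.
have xnP q : q \in a ++ e1 ++ e2 -> q.1 != xn.
  move=> qr; have P : perm_eq start [:: (xn, o), (xn, ~~ o) & a ++ e1 ++ e2].
    apply/seq.permP => Q; have cc q' s : count Q (q' :: s) = Q q' + count Q s by [].
    rewrite !(cc, count_cat) /=.
    move: (Q (xn, o)) (Q (xn, ~~ o)) (count Q a) (count Q e1) (count Q e2).
    by clear; lia.
  move: us; rewrite (perm_uniq P) /= !inE !negb_or => /and3P[/andP[_ h1] h2 _].
  by apply/eqP => e; move: qr h1 h2; rewrite [q]surjective_pairing e; case: q.2; case: (o) => ->.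
pose g (c : C) := if c == nm om then xn else c.
have omP q : q \in a ++ e1 ++ e2 -> q.1 != nm om.
  by apply: contraTneq => e; rewrite [q]surjective_pairing e.
have gid s : {subset s <= a ++ e1 ++ e2} -> [seq (g q.1, q.2) | q <- s] = s.
  by move=> sr; apply: map_id_in => q /sr/omP ne; rewrite /g (negPf ne) -surjective_pairing.
have mapE : a ++ (xn, ~~ o) :: e1 ++ (xn, o) :: e2 = [seq (g q.1, q.2) | q <- stage [:: om]].
  rewrite stE !(map_cat, map_cons) /= !gid /g ?eqxx //;
    by move=> q h; rewrite !mem_cat h ?orbT.
have memst q : q \in stage [:: om] -> q.1 = nm om \/ q \in a ++ e1 ++ e2.
  rewrite stE !(mem_cat, inE) => /or4P[->|/eqP ->|->|/orP[/eqP ->|->]]; rewrite ?orbT; by auto.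
have ginj c b c' b' : (c, b) \in stage [:: om] -> (c', b') \in stage [:: om] -> g c = g c' -> c = c'.
  rewrite /g => h h'; case: eqP => [->|n]; case: eqP => [->|n'] //.
    by case/memst: h' => [//|/xnP /= ne] e; rewrite e eqxx in ne.
  by case/memst: h => [//|/xnP /= ne] e; rewrite e eqxx in ne.
have gsg c b : (c, b) \in stage [:: om] -> sg (g c) = sg c.
  by move=> _; rewrite /g; case: eqP => // ->; rewrite sg_xn sg_nm omE.
split; first by rewrite mapE; apply: good_map.
apply: (wsame_trans gE sE); apply: (wsame_map_rot (k := 0) ginj gsg).
by rewrite rot0.
Qed.

End Inv.

End SweepInvariant.
Import SweepInvariant.

(** * Sliding a crossing past a summand *)

Module Sliding.
(* A crossing is named by a number and its sign, so that fresh names of both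
   signs are always available. *)
Definition name : choiceType := (nat * bool)%type.
Definition nsg (c : name) : bool := c.2.
Local Notation good := (good nsg).
Local Notation wsame := (wsame nsg).

Definition bound (w : seq (name * bool)) : nat := (\max_(l <- w) l.1.1).+1.

Lemma boundP w (c : name) b : bound w <= c.1 -> (c, b) \notin w.
Proof.
by move=> le; apply/negP => h; move: le; rewrite ltnNge (leq_bigmax_seq (F := fun l : name * bool => l.1.1) _ h).
Qed.

(** One crossing and three regions, whence labels in [option bool]. *)
Lemma good_kink m : good [:: ((m, false), true); ((m, false), false)].
Proof.
split; first by rewrite /gword /= !inE !xpair_eqE eqxx.
right; exists (option bool), (fun d : wdart name => if d.1.2 then Some d.2 else None); split.
- have np (k k' : name * bool) : k != k' ->
      [/\ next [:: k; k'] k = k', next [:: k; k'] k' = k,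
          prev [:: k; k'] k = k' & prev [:: k; k'] k' = k].
    by move=> /negPf ne; rewrite /= ?eqxx ![k' == k]eq_sym ?ne ?eqxx.
  have [|n1 n2 p1 p2] := np ((m, false), true) ((m, false), false); first by rewrite xpair_eqE andbF.
  have lw (l : name * bool) : l \in [:: ((m, false), true); ((m, false), false)] ->
      l = ((m, false), true) \/ l = ((m, false), false).
    by rewrite !inE => /orP[] /eqP; auto.
  case=> l b /(lw l)[] ->; case: b; rewrite /wface.
  - by rewrite (congr1 (fun l => (l, false)) n1 : wopp _ (_, true) = _).
  - by rewrite (congr1 (fun l => (l, true)) p1 : wopp _ (_, false) = _).
  - by rewrite (congr1 (fun l => (l, false)) n2 : wopp _ (_, true) = _).
  by rewrite (congr1 (fun l => (l, true)) p2 : wopp _ (_, false) = _).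
- case=> [b|]; first by exists ((m, false), true, b); rewrite ?mem_head.
  by exists ((m, false), false, false); rewrite // !inE eqxx orbT.
by rewrite card_option card_bool.
Qed.

(** Up to rotation the longer word is a sum with the one-crossing diagram, hence planar. *)
Lemma kink (m : nat) (p q : seq (name * bool)) : 
  good (p ++ q) -> (forall b, ((m, false), b) \notin p ++ q) ->
  good (p ++ ((m, false), true) :: ((m, false), false) :: q) /\
  wsame (p ++ ((m, false), true) :: ((m, false), false) :: q) (p ++ q).
Proof.
move=> g nk; set k := (_, true); set k' := (_, false).
have gK : good (p ++ k :: k' :: q).
  have -> : p ++ k :: k' :: q = rot (size q) ((q ++ p) ++ [:: k; k']).
    by rewrite -catA rot_size_cat -catA.
  apply: good_rot; apply: good_cat; [exact: good_catC | exact: good_kink |].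
  move=> l l' lqp; rewrite !inE => h; have -> : l'.1 = (m, false) by case/orP: h => /eqP ->.
  apply: contraTneq lqp => e; rewrite [l]surjective_pairing e.
  by have := nk l.2; rewrite !mem_cat orbC.
split=> //; have [u _] := andP gK.1.
apply: (@R1_wsame _ _ _ _ (k, true)).
- by rewrite mem_cat mem_head orbT.
- by rewrite /wface (wopp_split u).1.
rewrite filter_cat /= !eqxx /=.
have fl s : {subset s <= p ++ q} -> [seq l <- s | l.1 != (m, false)] = s.
  move=> sub; apply/all_filterP/allP => l /sub; apply: contraTneq => e.
  by rewrite [l]surjective_pairing e.
by rewrite !fl // => l h; rewrite mem_cat h ?orbT.
Qed.

(** The side [r] is the one for which the sign of [xn] fits the sweep; the names [nm d] are numbered
    from [bound st] on and carry the signs imposed by their directions. *)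
Lemma slide_nonempty (xn : name) (o : bool) (a e1 e2 : seq (name * bool)) :
  e1 <> [::] -> good a -> good ((xn, ~~ o) :: a ++ e1 ++ (xn, o) :: e2) ->
  good (a ++ (xn, ~~ o) :: e1 ++ (xn, o) :: e2) /\
  wsame ((xn, ~~ o) :: a ++ e1 ++ (xn, o) :: e2) (a ++ (xn, ~~ o) :: e1 ++ (xn, o) :: e2).
Proof.
case: a => [|l1 a'] e1n ga gs; first by split=> //; apply: wsame_refl.
have [a aE] : exists a, a = l1 :: a' by exists (l1 :: a').
rewrite -aE in ga gs *; pose r := o != nsg xn.
set st := _ :: _ in gs.
have [|R [lab labP]] := iffLR (tlabelsP nsg r ga.1 _) ga.2; first by rewrite aE.
pose nm (d : wdart name) : name := (bound st + pickle d, o == (d.2 == ~~ r)).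
have nm_inj : injective nm.
  by move=> d d' [/addnI h _]; apply: (pcan_inj (@pickleK (wdart (nat * bool)%type))).
have nmst d b : (nm d, b) \notin st by apply: boundP; rewrite leq_addr.
apply: (@slide_fresh _ nsg r o nm a e1 e2 nm_inj _ _ ga e1n R lab labP l1 a' aE) => //.
- move=> d b; apply: contra (nmst d b); rewrite /st inE !mem_cat inE.
  by case/or3P => ->; rewrite ?orbT.
- by rewrite /r; case: (o); case: (nsg xn).
by move=> d; apply: contraNneq (nmst d (~~ o)) => ->; rewrite mem_head.
Qed.

Lemma slide (a e : seq (name * bool)) : good a -> good e ->
  (forall l l', l \in a -> l' \in e -> l.1 != l'.1) -> wsame (a ++ rot 1 e) (a ++ e).
Proof.
case: e => [|[xn p] e] ga ge dis; first exact: wsame_refl.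
have gae := good_cat ga ge dis; pose o := ~~ p.
have sgood e' : good ((xn, p) :: e') ->
    (forall l l', l \in a -> l' \in (xn, p) :: e' -> l.1 != l'.1) ->
    good ((xn, p) :: a ++ e').
  move=> g' dis'; have : good (a ++ rot 1 ((xn, p) :: e')).
    by apply: good_cat => // [|l l' la]; [exact: good_rot | rewrite mem_rot; apply: dis'].
  rewrite /rot /= take0 drop0 catA => /good_catC; exact.
have rotE e' : rot 1 ((xn, p) :: e') = e' ++ [:: (xn, p)] by rewrite /rot /= take0 drop0.
rewrite rotE catA; have gs := sgood _ ge dis.
apply: (wsame_trans gs); first exact: wsame_catC (a ++ e) [:: (xn, p)].
have oe : (xn, o) \in e.
  have [_ /allP /(_ (xn, p))] := andP ge.1; rewrite mem_head /= inE xpair_eqE eqxx /=.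
  by rewrite /o; case: (p) => /(_ isT).
have pE : p = ~~ o by rewrite /o negbK.
have [e1 [e2 eE]] : exists e1 e2, e = e1 ++ (xn, o) :: e2.
  by case/splitPr: oe => e1 e2; exists e1, e2.
move: ge dis gae gs sgood {oe rotE}; rewrite eE pE => ge dis gae gs sgood.
(* The sweep needs letters between the two passages of [xn]; if there are none, a kink is put there
   and removed afterwards. *)
case: e1 {eE} => [|y e1] in ge dis gae gs *; last by have [] := slide_nonempty _ ga gs.
set X := (xn, ~~ o) in ge dis gae gs sgood *; set X' := (xn, o) in ge dis gae gs sgood *.
pose m := bound (a ++ X :: X' :: e2).
have fm b : ((m, false), b) \notin a ++ X :: X' :: e2 by apply: boundP.
pose ks := [:: ((m, false) : name, true); ((m, false) : name, false)].
have [g1 s1] : good (X :: a ++ ks ++ X' :: e2) /\ wsame (X :: a ++ ks ++ X' :: e2) (X :: a ++ X' :: e2).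
  apply: (@kink m (X :: a) (X' :: e2)) => // b; have := fm b.
  by rewrite !(mem_cat, inE) !negb_or => /and4P[-> -> -> ->].
have [g2 s2] : good ((a ++ [:: X]) ++ ks ++ X' :: e2) /\
    wsame ((a ++ [:: X]) ++ ks ++ X' :: e2) ((a ++ [:: X]) ++ X' :: e2).
  by apply: (@kink m (a ++ [:: X]) (X' :: e2)); rewrite -?catA.
rewrite -!catA /= in g2 s2.
have [_ s3] := @slide_nonempty xn o a ks e2 (fun h => ltac:(discriminate h)) ga g1.
apply: (wsame_trans g1); first exact: wsame_sym.
exact: wsame_trans g2 s3 s2.
Qed.

End Sliding.
Import Sliding.

(** * Moves inside one summand of a connected sum *)

Module TrivialSummand.
Local Notation good := (good nsg).
Local Notation wsame := (wsame nsg).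
Local Notation realizes := (realizes nsg).
Local Notation wface := (wface nsg).
Implicit Types (a e : seq (name * bool)).

Definition apart a e : Prop := forall l l', l \in a -> l' \in e -> l.1 != l'.1.

Lemma apart_sub a e e' : {subset e' <= e} -> apart a e -> apart a e'.
Proof. by move=> sub ap l l' la /sub; apply: ap. Qed.

Lemma map_uniq_inj (T U : eqType) (f : T -> U) (s : seq T) :
  uniq (map f s) -> {in s &, injective f}.
Proof.
elim: s => //= x s IH /andP[fx us] y z; rewrite !inE.
case/predU1P=> [->|ys] /predU1P[->|zs] // e; last exact: IH.
  by rewrite e map_f in fx.
by rewrite -e map_f in fx.
Qed.

Lemma slide_rot a e k : good a -> good e -> apart a e -> wsame (a ++ rot k e) (a ++ e).
Proof.
move=> ga ge ap; have [le|lt] := leqP k (size e); last first.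
  by rewrite rot_oversize ?(ltnW lt) //; apply: wsame_refl.
elim: k le => [|k IH] lt; first by rewrite rot0; apply: wsame_refl.
have gk : good (rot k e) by apply: good_rot.
have apk : apart a (rot k e) by apply: apart_sub ap => l; rewrite mem_rot.
apply: (wsame_trans (good_cat ga gk apk)); last by apply: IH; apply: ltnW.
by rewrite -add1n rotD ?add1n //; apply: slide.
Qed.

(** Each dart lies on one edge of [e], named by [tail], and there are more edges than darts; a
    rotation makes an edge free of these darts the closing one. *)
Lemma base_off a e (ds : seq (wdart name)) : uniq (a ++ e) ->
  (forall d, d \in ds -> d.1 \in e) -> size ds < size e ->
  exists k, forall d, d \in ds -> wopp (a ++ rot k e) d = wopp e d.
Proof.
move=> uae dse lt; have ue : uniq e by move: uae; rewrite cat_uniq => /and3P[].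
pose tail (d : wdart name) := if d.2 then d.1 else prev e d.1.
have [l le lF] : exists2 l, l \in e & l \notin map tail ds.
  apply/hasP; rewrite has_predC; apply/negP => /allP sub.
  by have := uniq_leq_size ue sub; rewrite size_map leqNgt lt.
exists (index l e).+1 => d dds; have de := dse d dds.
have idx : index l e < size e by rewrite index_mem.
set ek := rot _ e.
have lastE : forall x0, last x0 ek = l.
  move=> x0; rewrite /ek /rot last_cat (take_nth l) // last_rcons nth_index //.
have uk : uniq (a ++ ek).
  rewrite (perm_uniq (s2 := a ++ e)) // perm_cat2l; apply: permEl; exact: perm_rot.
have dn : tail d != l by apply: contraNneq lF => <-; apply: map_f.
rewrite (@wopp_cat_r _ a ek d l) ?mem_rot //; first exact: wopp_rot.
  by rewrite lastE; apply: contraNneq dn => ->.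
apply: contraNneq dn => dE; rewrite /tail dE /= -(prev_rot (index l e).+1 ue) -/ek.
have : uniq ek by rewrite rot_uniq.
have : ek <> [::] by move=> e0; have := mem_rot (index l e).+1 e l; rewrite -/ek e0 le.
move: lastE; case: (ek) => // y s lE _ u; rewrite prev_head //.
exact/eqP/(lE y).
Qed.

Section Rename.
Variables (D : knot_diagram) (a : seq (name * bool)).
Hypothesis ga : good a.

Lemma naming_good (g : crossing D -> name) e : realizes g e -> good e.
Proof. exact: realizes_good. Qed.

(** The renaming of [e] is extended by the identity on [a]; [apart] keeps the extension
    injective. *)
Lemma rename_sum (g g' : crossing D -> name) e e' : realizes g e -> realizes g' e' ->
  apart a e -> apart a e' -> wsame (a ++ e) (a ++ e').
Proof.
move=> ge ge' ap ap'; have [ginj gsg eE] := ge; have [ginj' gsg' eE'] := ge'.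
pose h (c : name) := if [pick v | g v == c] is Some v then g' v else c.
have hg v : h (g v) = g' v.
  by rewrite /h; case: pickP => [v' /eqP /ginj ->|/(_ v)] //; rewrite eqxx.
have mem_g v : (g v, true) \in e.
  by rewrite -eE; apply/mapP; exists (v, true); rewrite ?code_full.
have mem_g' v : (g' v, true) \in e'.
  by rewrite -eE'; apply/mapP; exists (v, true); rewrite ?code_full.
have ha l : l \in a -> h l.1 = l.1.
  move=> la; rewrite /h; case: pickP => // v /eqP gv.
  by have := ap _ _ la (mem_g v); rewrite /= gv eqxx.
have he c b : (c, b) \in e -> exists2 v, c = g v & h c = g' v.
  by rewrite -eE => /mapP[[v q] _ [-> _]]; exists v.
apply: (wsame_map_rot (g := h) (k := 0)).
- move=> c b c' b'; rewrite !mem_cat => /orP[ca|ce] /orP[c'a|c'e].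
  + by rewrite (ha _ ca) (ha _ c'a).
  + have [v -> ->] := he _ _ c'e; rewrite (ha _ ca) /= => cE.
    by have := ap' _ _ ca (mem_g' v); rewrite /= cE eqxx.
  + have [v -> ->] := he _ _ ce; rewrite (ha _ c'a) /= => cE.
    by have := ap' _ _ c'a (mem_g' v); rewrite /= -cE eqxx.
  by have [v -> ->] := he _ _ ce; have [v' -> ->] := he _ _ c'e => /ginj' ->.
- move=> c b; rewrite mem_cat => /orP[ca|ce]; first by rewrite (ha _ ca).
  by have [v -> ->] := he _ _ ce; rewrite gsg gsg'.
rewrite rot0 map_cat; congr (_ ++ _).
  by rewrite map_id_in // => l la; rewrite ha // -surjective_pairing.
by rewrite -eE' -eE -map_comp; apply: eq_map => l /=; rewrite hg.
Qed.

Lemma fresh_naming : exists (g : crossing D -> name) e, realizes g e /\ apart a e.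
Proof.
pose g (v : crossing D) : name := (bound a + enum_rank v, positive v).
exists g, [seq (g l.1, l.2) | l <- code D]; split.
  split=> // v v' [/addnI h _]; exact: (enum_rank_inj (val_inj h)).
move=> l l' la /mapP[m _ ->]; apply: contraTneq la => e.
by rewrite [l]surjective_pairing e; apply: boundP; rewrite leq_addr.
Qed.

End Rename.

(** A spelling may rotate the word; beside [a] this changes the diagram, and [slide_rot] makes up
    for it. *)
Lemma spelled_sum (D D' : knot_diagram) a (g : crossing D -> name) (g' : crossing D' -> name)
    (s : seq (letter D)) e' :
  good a -> injective g -> (forall v, nsg (g v) = positive v) -> uniq s ->
  spelled_by D' s -> apart a [seq (g l.1, l.2) | l <- s] ->
  realizes g' e' -> apart a e' ->
  good [seq (g l.1, l.2) | l <- s] /\ wsame (a ++ [seq (g l.1, l.2) | l <- s]) (a ++ e').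
Proof.
move=> ga ginj gsg us [f [fsg [k fE]]] ap ge' ap'; set e1 := map _ s in ap *.
have us' : uniq [seq (f l.1, l.2) | l <- code D'] by rewrite fE rot_uniq.
have finj : injective f.
  move=> v v' fv; have : (v, true) = (v', true) by
    apply: (map_uniq_inj us'); rewrite ?code_full //= fv.
  by case.
have g1 : realizes (g \o f) (rot k e1).
  split=> [v v' /ginj/finj //|v|]; first by rewrite /= gsg fsg.
  by rewrite /e1 -map_rot -fE -map_comp.
have gk := naming_good g1; have ge1 : good e1.
  by have := good_rot (size (rot k e1) - k) gk; rewrite -/(rotr _ _) rotK.
have apk : apart a (rot k e1) by apply: apart_sub ap => l; rewrite mem_rot.
split=> //; apply: (wsame_trans (good_cat ga gk apk)).
  exact/wsame_sym/slide_rot.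
exact: rename_sum g1 ge' apk ap'.
Qed.

Lemma filter_rot (T : Type) (P : pred T) k (s : seq T) :
  exists k', filter P (rot k s) = rot k' (filter P s).
Proof.
have fE : filter P s = filter P (take k s) ++ filter P (drop k s).
  by rewrite -filter_cat cat_take_drop.
exists (size (filter P (take k s))).
by rewrite fE rot_size_cat /rot filter_cat.
Qed.

Section Lift.
Variables (D D' : knot_diagram) (a e e' : seq (name * bool)).
Variables (g : crossing D -> name) (g' : crossing D' -> name).
Hypotheses (ga : good a) (ge : realizes g e) (ge' : realizes g' e').
Hypotheses (ap : apart a e) (ap' : apart a e').

Let ginj : injective g. Proof. by case: ge. Qed.
Let gsg v : nsg (g v) = positive v. Proof. by case: ge. Qed.
Let eE : [seq (g l.1, l.2) | l <- code D] = e. Proof. by case: ge. Qed.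
Let gde : good e. Proof. exact: naming_good ge. Qed.
Let gae : good (a ++ e). Proof. exact: good_cat. Qed.
Let uae : uniq (a ++ e). Proof. by case/andP: gae.1. Qed.
Let W := wdart_of g.
Let glinj : injective (fun l : letter D => (g l.1, l.2)).
Proof. by move=> [v o] [v' o'] [/ginj -> ->]. Qed.

Let gdk k : good (a ++ rot k e) /\ wsame (a ++ e) (a ++ rot k e).
Proof.
split; last exact/wsame_sym/slide_rot.
by apply: good_cat; [|exact: good_rot|apply: apart_sub ap => l; rewrite mem_rot].
Qed.

Let memW d : (W d).1 \in e. Proof. exact: (mem_wdart_of ge (@code_full D)). Qed.
Let WwO d : wopp e (W d) = W (opp d). Proof. exact: wdart_of_opp ge (code_uniq D) d. Qed.
Let WwF d : wface e (W d) = W (face_next d). Proof. exact: wdart_of_face ge (code_uniq D) d. Qed.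

Let size_e : size e = 2 * #|crossing D|.
Proof. exact: realizes_size ge (code_uniq D) (@code_full D). Qed.

(* A move on e lifts to a ++ e after sliding the connecting edge off the edges
   that the move involves. *)
Let off (ds : seq (dart D)) : size ds < size e ->
  exists k, forall d, d \in ds -> wopp (a ++ rot k e) (W d) = W (opp d) /\
     wface (a ++ rot k e) (W d) = W (face_next d).
Proof.
move=> lt; have [||k kP] := base_off (ds := map W ds) uae.
- by move=> _ /mapP[d _ ->].
- by rewrite size_map.
exists k => d dds; have := kP (W d) (map_f _ dds) => h; split; first by rewrite h WwO.
by rewrite -WwF /Words.wface h.
Qed.

Let finish (s : seq (letter D)) k k' :
  uniq s -> spelled_by D' s -> apart a [seq (g l.1, l.2) | l <- s] ->
  wsame (a ++ rot k e) (a ++ rot k' [seq (g l.1, l.2) | l <- s]) ->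
  wsame (a ++ e) (a ++ e').
Proof.
move=> us sp aps h; have [gs ss] := spelled_sum ga ginj gsg us sp aps ge' ap'.
have [gk sk] := gdk k; apply: (wsame_trans gk sk).
have apk : apart a (rot k' [seq (g l.1, l.2) | l <- s]).
  by apply: apart_sub aps => l; rewrite mem_rot.
apply: (wsame_trans (good_cat ga (good_rot k' gs) apk) h).
apply: (wsame_trans (good_cat ga gs aps)) ss; exact: slide_rot.
Qed.

Let map_filter (P : pred (name * bool)) (Q : pred (letter D)) :
  (forall l, P (g l.1, l.2) = Q l) ->
  [seq (g l.1, l.2) | l <- filter Q (code D)] = filter P e.
Proof. by move=> PQ; rewrite -eE filter_map; congr map; apply: eq_filter => l /=. Qed.

Let lift_filter (P : pred (name * bool)) (S : {set crossing D}) k :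
  (forall v b, P (g v, b) = (v \notin S)) -> (forall l, l \in a -> P l) ->
  spelled_by D' (erase S) ->
  wsame (a ++ rot k e) [seq l <- a ++ rot k e | P l] -> wsame (a ++ e) (a ++ e').
Proof.
move=> PS Pa sp h; have [k' k'E] := filter_rot P k e.
have mE : [seq (g l.1, l.2) | l <- erase S] = filter P e by apply: map_filter => l.
apply: (finish (k := k) (k' := k')) sp _ _.
- by apply: filter_uniq; apply: code_uniq.
- by rewrite mE; apply: apart_sub ap => l; rewrite mem_filter => /andP[].
by rewrite mE -k'E; move: h; rewrite filter_cat (all_filterP _) //; apply/allP.
Qed.

Let away d l : l \in a -> l.1 != (W d).1.1.
Proof. by move=> la; apply: ap (memW d). Qed.

Lemma lift_R1 : reidemeister1 D D' -> wsame (a ++ e) (a ++ e').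
Proof.
case=> d [fd sp]; have v0 : 0 < #|crossing D| by apply/card_gt0P; exists (vertex d).
have [|k kP] := off (ds := [:: d]); first by rewrite size_e; apply: leq_trans (leq_mul (leqnn 2) v0).
have [_ fk] := kP d (mem_head _ _); rewrite fd in fk.
apply: (lift_filter (P := fun l => l.1 != (W d).1.1) (k := k)) sp _.
- by move=> v b; rewrite !inE /= (inj_eq ginj).
- by move=> l; apply: away.
apply: R1_wsame fk erefl; by rewrite mem_cat mem_rot memW orbT.
Qed.

Let card2 (d d1 : dart D) : vertex d != vertex d1 -> 1 < #|crossing D|.
Proof. by move=> ne; have := card2 (vertex d) (vertex d1); rewrite ne => <-; apply: max_card. Qed.

Lemma lift_R2 : reidemeister2 D D' -> wsame (a ++ e) (a ++ e').
Proof.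
case=> d [fd ne ov sp]; have v0 := card2 ne.
have [|k kP] := off (ds := [:: d; face_next d]).
  by rewrite size_e; apply: leq_trans (leq_mul (leqnn 2) v0).
have [ok fk] := kP d (mem_head _ _).
have [_ fk1] := kP (face_next d) (mem_last d [:: _]); rewrite fd in fk1.
apply: (lift_filter (P := fun l => (l.1 != (W d).1.1) && (l.1 != (W (face_next d)).1.1)) (k := k)) sp _.
- by move=> v b; rewrite !inE /= !(inj_eq ginj) negb_or.
- by move=> l la; rewrite !away.
apply: (R2_wsame (d := W d)); rewrite ?fk ?ok //.
- by rewrite mem_cat mem_rot memW orbT.
by rewrite /= (inj_eq ginj).
Qed.

Lemma lift_R3 : reidemeister3 D D' -> wsame (a ++ e) (a ++ e').
Proof.
case=> d; set d1 := face_next d; set d2 := face_next d1; case=> fd un ov sp.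
have v0 : 2 < #|crossing D|.
  by rewrite -[3]/(size [:: vertex d; vertex d1; vertex d2]) -(card_uniqP un) max_card.
have [|k kP] := off (ds := [:: d; d1; d2]).
  by rewrite size_e; apply: leq_trans (leq_mul (leqnn 2) v0).
have [ok fk] := kP d (mem_head _ _).
have [|ok1 fk1] := kP d1; first by rewrite !inE eqxx orbT.
have [|ok2 fk2] := kP d2; first by rewrite !inE eqxx !orbT.
rewrite fd in fk2; set w := a ++ rot k e in ok fk ok1 fk1 ok2 fk2 *.
pose sw (l : letter D) := swap_ends d (swap_ends d1 (swap_ends d2 l)).
have swinj : injective sw by move=> l l' /perm_inj/perm_inj/perm_inj.
pose ws l := wswap w (W d) (wswap w (W d1) (wswap w (W d2) l)).
have swapE y l : wopp w (W y) = W (opp y) ->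
    wswap w (W y) (g l.1, l.2) = (g (swap_ends y l).1, (swap_ends y l).2).
  move=> oy; rewrite /wswap oy /swap_ends.
  rewrite -[(W y).1]/((fun l : letter D => (g l.1, l.2)) (passage y)).
  rewrite -[(W (opp y)).1]/((fun l : letter D => (g l.1, l.2)) (passage (opp y))).
  rewrite -![(g l.1, l.2)]/((fun l : letter D => (g l.1, l.2)) l) !(inj_eq glinj).
  case: tpermP => [->|->|/eqP/negPf -> /eqP/negPf -> //]; rewrite ?eqxx //.
  by case: eqP => // ->.
have wsE l : ws (g l.1, l.2) = (g (sw l).1, (sw l).2) by rewrite /ws !swapE.
have wsa l y : l \in a -> wopp w (W y) = W (opp y) -> wswap w (W y) l = l.
  move=> la oy; rewrite /wswap oy; have n1 := away y la; have n2 := away (opp y) la.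
  by case: eqP => [e1|_]; [rewrite e1 eqxx in n1 | case: eqP => // e1; rewrite e1 eqxx in n2].
have mE : [seq (g l.1, l.2) | l <- map sw (code D)] = map ws e.
  by rewrite -eE -!map_comp; apply: eq_map => l; rewrite /= wsE.
apply: (finish (k := k) (k' := k)) sp _ _.
- by rewrite (map_inj_uniq swinj); apply: code_uniq.
- rewrite mE; apply: apart_sub ap => l /mapP[l' l'e ->].
  by move: l'e; rewrite -{1}eE => /mapP[m _ ->]; rewrite wsE -eE map_f ?code_full.
rewrite mE -map_rot; apply: (R3_wsame (d := W d)); rewrite ?fk ?fk1 ?fk2 ?ok //.
- by rewrite mem_cat mem_rot memW orbT.
- by move: un; rewrite /= !inE /= !(inj_eq ginj).
by rewrite map_cat; congr (_ ++ _); rewrite map_id_in // => l la; rewrite !wsa.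
Qed.

Lemma lift_move : reidemeister D D' -> wsame (a ++ e) (a ++ e').
Proof.
case; [move=> sp | exact: lift_R1 | exact: lift_R2 | exact: lift_R3].
by have := spelled_sum ga ginj gsg (code_uniq D) sp; rewrite eE => /(_ _ _ ap ge' ap')[].
Qed.

End Lift.

(** The knot of a sum with [a] depends only on the knot of the other summand. In the transitive case
    the intermediate diagram receives names apart from those of [a]. *)
Theorem sum_same (D D' : knot_diagram) a : good a -> same_knot D D' ->
  forall e e' (g : crossing D -> name) (g' : crossing D' -> name),
  realizes g e -> realizes g' e' -> apart a e -> apart a e' -> wsame (a ++ e) (a ++ e').
Proof.
move=> ga; elim=> {D D'} [D D' mv|D|D D' _ IH|D D1 D' _ IH1 _ IH2] e e' g g' ge ge' ap ap'.
- exact: lift_move ge ge' ap ap' mv.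
- exact: rename_sum ge ge' ap ap'.
- exact/wsame_sym/(IH _ _ _ _ ge' ge ap' ap).
have [g1 [e1 [ge1 ap1]]] := fresh_naming D1 a.
apply: (wsame_trans (good_cat ga (naming_good ge1) ap1)).
  exact: IH1 ge ge1 ap ap1.
exact: IH2 ge1 ge' ap1 ap'.
Qed.

End TrivialSummand.
Import TrivialSummand.

(** * Regions of a connected sum *)

Module Factors.
Record factors (D D1 D2 : knot_diagram) (f1 : crossing D1 -> crossing D)
    (f2 : crossing D2 -> crossing D) : Prop := Factors {
  factor1_inj : injective f1;
  factor2_inj : injective f2;
  factor1_sign : forall v, positive (f1 v) = positive v;
  factor2_sign : forall v, positive (f2 v) = positive v;
  factor1_nonempty : code D1 <> [::];
  factor2_nonempty : code D2 <> [::];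
  factor_code : exists k, rot k (code D) =
    [seq (f1 l.1, l.2) | l <- code D1] ++ [seq (f2 l.1, l.2) | l <- code D2] }.

Lemma factors_sym (D D1 D2 : knot_diagram) (f1 : crossing D1 -> crossing D) (f2 : crossing D2 -> crossing D) :
  factors f1 f2 -> factors f2 f1.
Proof.
case=> i1 i2 s1 s2 n1 n2 [k kE]; split=> //.
set a := map _ (code D1) in kE; set e := map _ (code D2) in kE.
have [k' k'E] : exists k', rot k' (code D) = rot (size a) (rot k (code D)).
  by rewrite rot_rot_add; eexists.
by exists k'; rewrite k'E kE rot_size_cat.
Qed.

Definition embed (D D' : gauss_code) (f : crossing D' -> crossing D) (d : dart D') : dart D :=
  wdart_of f d.

Section Factor.
Variables (D D1 D2 : knot_diagram).
Variables (f1 : crossing D1 -> crossing D) (f2 : crossing D2 -> crossing D).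
Hypothesis F : factors f1 f2.
Let Du := code_uniq D. Let Df := @code_full D. Let Dp := gauss_planar D.
Let Du1 := code_uniq D1. Let Df1 := @code_full D1.
Local Notation a := [seq (f1 l.1, l.2) | l <- code D1].
Local Notation e := [seq (f2 l.1, l.2) | l <- code D2].

Lemma factor_real1 : realizes (@positive D) f1 a.
Proof. by case: F => i1 _ s1 _ _ _ _; split. Qed.
Lemma factor_real2 : realizes (@positive D) f2 e.
Proof. by case: F => _ i2 _ s2 _ _ _; split. Qed.

Lemma factor_good : good (@positive D) (a ++ e).
Proof.
have [k <-] := factor_code F; apply: good_rot; apply: (@realizes_good _ _ D id).
by split=> //; rewrite map_id_in // => -[].
Qed.

Lemma factor_apart l l' : l \in a -> l' \in e -> l.1 != l'.1.
Proof.
move=> la /mapP[[w b'] _ ->]; apply: contraTneq la => /= le.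
have [/andP[u _] _] := factor_good; move: u; rewrite cat_uniq => /and3P[_ /hasPn h _].
apply: h; rewrite [l]surjective_pairing le; apply/mapP; exists (w, l.2) => //.
exact: code_full.
Qed.

Let an : a <> [::]. Proof. by move=> h; apply: (factor1_nonempty F); case: (code D1) h. Qed.
Let en : e <> [::]. Proof. by move=> h; apply: (factor2_nonempty F); case: (code D2) h. Qed.

Let inv (d : wdart (crossing D)) : d.1 \in a ++ e ->
  region (wface (@positive D) (a ++ e) d : dart D) = region (d : dart D).
Proof.
move=> _; have [k <-] := factor_code F; rewrite /wface wopp_rot //.
exact: (region_face Du d).
Qed.

Let l0 : letter D. Proof. by case: (a) an => // l. Qed.

Local Notation W := (embed f1).

Lemma embed1_inj : injective W. Proof. exact: wdart_of_inj factor_real1. Qed.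

Lemma embed1_cw d : W (cw d) = cw (W d).
Proof. by have := wdart_of_cw factor_real1 d. Qed.
Lemma embed1_ccw d : W (ccw d) = ccw (W d).
Proof. by have := wdart_of_ccw factor_real1 d. Qed.

(** This is [cat_label_restrict] for the labelling of [D] by its own regions: a region of [D1] stays
    inside one region of [D]. *)
Lemma embed1_face d : region (W (face_next d)) = region (W d).
Proof.
rewrite /W -(wdart_of_face factor_real1 Du1).
apply: (cat_label_restrict l0 factor_good factor_apart an en inv).
  exact: realizes_gword factor_real1 Du1 Df1.
exact: mem_wdart_of factor_real1 Df1 _.
Qed.

Lemma embed1_region d x : region d = region x -> region (W d) = region (W x).
Proof. exact: (region_invariant Du1 embed1_face). Qed.

Lemma embed1_opp d : region (W (opp d)) = region (opp (W d)).
Proof.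
rewrite -(region_cw Du (W d)) -embed1_cw; apply: embed1_region.
by rewrite (region_cw Du1). Qed.

(** [d1] and [d2] are the darts at which the two joining edges start; by [cat_base_labels] these
    edges border the same two regions, in opposite directions seen from the knot. *)
Lemma factor_base : exists (d1 : dart D1) (d2 : dart D2),
  region (W d1) = region (embed f2 d2) /\
  region (opp (W d1)) = region (opp (embed f2 d2)).
Proof.
have [la ha] := cat_base_labels l0 factor_good factor_apart an en inv.
have [/andP[u _] _] := factor_good.
have [b1 _ b3 _] := wopp_cat_base l0 u an en.
have [k kE] := factor_code F; rewrite -kE !wopp_rot // in b1 b3.
have [x xE] : exists x, (last l0 a, true) = W x.
  apply: (wdart_ofP factor_real1); case: (a) an => //= l s _; exact: mem_last.
have [y yE] : exists y, (last l0 e, true) = embed f2 y.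
  apply: (wdart_ofP factor_real2); case: (e) en => //= l s _; exact: mem_last.
exists x, y; rewrite -xE -yE; split=> //.
have -> : opp (last l0 a, true) = (head l0 e, false) by exact: b1.
have -> : opp (last l0 e, true) = (head l0 a, false) by exact: b3.
by symmetry.
Qed.

Definition sides1 : {set {set dart D}} := [set region (W d) | d : dart D1].

Lemma mem_sides1 d : region (W d) \in sides1. Proof. exact: imset_f. Qed.

Definition push1 (R : {set dart D1}) : {set dart D} :=
  if [pick d in R] is Some d then region (W d) else set0.

Lemma push1E d : push1 (region d) = region (W d).
Proof.
rewrite /push1; case: pickP => [x|/(_ d)]; last by rewrite region_id.
by rewrite -eq_region // => /eqP/embed1_region.
Qed.

Lemma sides1E : sides1 = [set push1 R | R in regions D1].
Proof.
apply/setP => R; apply/imsetP/imsetP => [[d _ ->]|[_ /imsetP[d _ ->] ->]].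
  by exists (region d); rewrite ?region_in_regions ?push1E.
by exists d; rewrite ?push1E.
Qed.

Lemma card_factor1 : 0 < #|crossing D1|.
Proof. by case: (code D1) (factor1_nonempty F) => // -[v b] s _; apply/card_gt0P; exists v. Qed.

Lemma card_regions1 : #|regions D1| = #|crossing D1| + 2.
Proof. by case: (gauss_planar D1) => // h; have := card_factor1; rewrite h. Qed.

Lemma card_sides1 : #|sides1| <= #|crossing D1| + 2.
Proof. by rewrite sides1E -card_regions1 leq_imset_card. Qed.

End Factor.

Section Sides.
Variables (D D1 D2 : knot_diagram).
Variables (f1 : crossing D1 -> crossing D) (f2 : crossing D2 -> crossing D).
Hypothesis F : factors f1 f2.
Let G := factors_sym F.
Let Du := code_uniq D. Let Df := @code_full D. Let Dp := gauss_planar D.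
Local Notation W1 := (embed f1).
Local Notation W2 := (embed f2).
Local Notation A := (sides1 f1).
Local Notation B := (sides1 f2).

Lemma factor_crossing : #|crossing D| = #|crossing D1| + #|crossing D2|.
Proof.
have [k kE] := factor_code F; have := congr1 size kE.
have szc (X : knot_diagram) : size (code X) = 2 * #|crossing X|.
  have r : realizes (@positive X) id (code X) by split=> //; rewrite map_id_in // => -[].
  exact: (realizes_size r (code_uniq X) (@code_full X)).
rewrite size_rot size_cat !size_map !szc.
by move: #|crossing D| #|crossing D1| #|crossing D2|; clear; lia.
Qed.

Lemma factor_dart (x : dart D) : (exists d, x = W1 d) \/ (exists d, x = W2 d).
Proof.
have [k kE] := factor_code F; have : x.1 \in rot k (code D) by rewrite mem_rot.
rewrite kE mem_cat => /orP[h|h]; [left|right].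
  exact: (wdart_ofP (factor_real1 F) h).
exact: (wdart_ofP (factor_real2 F) h).
Qed.

Lemma factor_vertex (v : crossing D) : (exists u, v = f1 u) \/ (exists u, v = f2 u).
Proof.
have [[d dE]|[d dE]] := factor_dart (v, true, true); [left|right];
by exists (vertex d); rewrite -[v]/((v, true, true).1.1) dE.
Qed.

Lemma factor_vertex_neq u w : f1 u <> f2 w.
Proof.
move=> e; have h1 : (f1 u, true) \in [seq (f1 l.1, l.2) | l <- code D1].
  by apply/mapP; exists (u, true); rewrite ?code_full.
have h2 : (f2 w, true) \in [seq (f2 l.1, l.2) | l <- code D2].
  by apply/mapP; exists (w, true); rewrite ?code_full.
by have := factor_apart F h1 h2; rewrite /= e eqxx.
Qed.

Lemma sidesU : A :|: B = regions D.
Proof.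
apply/setP => R; rewrite inE; apply/idP/imsetP.
  by case/orP => /imsetP[d _ ->]; [exists (W1 d) | exists (W2 d)].
case=> x _ ->; case: (factor_dart x) => -[d ->]; apply/orP; [left|right]; exact: imset_f.
Qed.

(* Euler's formula for D, D1 and D2 forces equality in
   |A| + |B| = |A :|: B| + |A :&: B|, where |A :&: B| >= 2. *)
Lemma sides_card : exists (d1 : dart D1) (d2 : dart D2),
  [/\ A :&: B = [set region (W1 d1); region (W1 (opp d1))],
      region (W1 d1) != region (W1 (opp d1)),
      A :&: B = [set region (W2 d2); region (W2 (opp d2))],
      #|A| = #|crossing D1| + 2 & #|B| = #|crossing D2| + 2].
Proof.
have [d1 [d2 [e1 e2]]] := factor_base F; exists d1, d2.
have o1 := embed1_opp F d1; have o2 := embed1_opp G d2.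
have ne : region (W1 d1) != region (W1 (opp d1)) by rewrite o1 region_opp_neq.
have sub : [set region (W1 d1); region (W1 (opp d1))] \subset A :&: B.
  apply/subsetP => R; rewrite !inE => /orP[] /eqP ->; rewrite mem_sides1 //=.
    by rewrite e1 mem_sides1.
  by rewrite o1 e2 -o2 mem_sides1.
have cD : #|regions D| = #|crossing D| + 2.
  case: Dp => // h; have := card_factor1 F.
  by move: h; rewrite factor_crossing => /eqP; rewrite addn_eq0 => /andP[/eqP -> _].
have c1 := card_sides1 F; have c2 := card_sides1 G.
have := cardsUI A B; rewrite sidesU cD factor_crossing => cUI.
have c3 := subset_leq_card sub; rewrite cards2 ne in c3.
have cI : #|A :&: B| = 2 /\ #|A| = #|crossing D1| + 2 /\ #|B| = #|crossing D2| + 2.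
  move: c1 c2 c3 cUI; move: #|A :&: B| #|A| #|B| #|crossing D1| #|crossing D2|.
  by clear; lia.
have AB : [set region (W1 d1); region (W1 (opp d1))] = A :&: B.
  by apply/eqP; rewrite eqEcard sub cards2 ne cI.1.
by split=> //; rewrite ?cI.2.1 ?cI.2.2 // -AB o1 e1 e2 -o2.
Qed.

(** [push1] maps [regions D1] onto [sides1 f1], and both have [#|crossing D1| + 2] elements. *)
Lemma embed1_regionK d x : region (W1 d) = region (W1 x) -> region d = region x.
Proof.
have [_ [_ [_ _ _ cA _]]] := sides_card; rewrite -!(push1E F) => h.
have /imset_injP inj : #|[set push1 f1 R | R in regions D1]| == #|regions D1|.
  by rewrite -(sides1E F) (card_regions1 F) cA.
by apply: inj h; apply: region_in_regions.
Qed.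

End Sides.

End Factors.
Import Factors.

(** * Restricting states and transpositions to a summand *)

Module Restriction.
Section Marks.
Variables (D D1 : knot_diagram) (f1 : crossing D1 -> crossing D).
Variables (Ri Rj : {set dart D}) (s : marking D).
Hypothesis state_s : is_state Ri Rj s.

Definition pull : marking D1 := [ffun v => (v, (s (f1 v)).1.2, (s (f1 v)).2)].

Lemma embed_pull v : embed f1 (pull v) = s (f1 v).
Proof.
have := state_vertex state_s (f1 v); rewrite ffunE /embed /wdart_of /vertex /=.
by case: (s (f1 v)) => [[w o] b] /= ->.
Qed.

Lemma mark_side v : region (s (f1 v)) \in sides1 f1.
Proof. by rewrite -embed_pull mem_sides1. Qed.

End Marks.

Section MarkSets.
Variables (D D1 D2 : knot_diagram).
Variables (f1 : crossing D1 -> crossing D) (f2 : crossing D2 -> crossing D).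
Hypothesis F : factors f1 f2.
Let Du := code_uniq D.
Variables (Ri Rj : {set dart D}).
Local Notation A := (sides1 f1).
Local Notation B := (sides1 f2).
Hypotheses (RiA : Ri \in A) (RjA : Rj \in A).

(** A region of [B] outside [A] is unstarred and can only be marked from [D2]; there are as many
    such regions as crossings of [D2]. *)
Lemma marks_other s : is_state Ri Rj s -> [set region (s (f2 w)) | w : crossing D2] = B :\: A.
Proof.
move=> st; have [d1 [d2 [AB1 ne _ _ cB]]] := sides_card F.
apply/esym/eqP; rewrite eqEcard; apply/andP; split; last first.
  rewrite card_imset => [|v w /(state_inj Du st)/(factor2_inj F) //].
  by rewrite cardsD setIC AB1 cards2 ne cB addnK.
apply/subsetP => R; rewrite inE => /andP[RA /imsetP[d _ RE]].
have [|v vE] := state_surj Du st (d := embed f2 d).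
  by rewrite /starred -RE; apply/negP => /orP[] /eqP h; move: RA; rewrite h ?RiA ?RjA.
case: (factor_vertex F v) vE => -[u ->] uE; last by rewrite RE -uE; apply/imsetP; exists u.
by case/negP: RA; rewrite RE -uE (mark_side _ st).
Qed.

Lemma marks_same s d : is_state Ri Rj s ->
  (exists v, region (s (f1 v)) = region (embed f1 d)) <->
  ~~ ((region (embed f1 d) == Ri) || (region (embed f1 d) == Rj)).
Proof.
move=> st; split=> [[v <-]|un]; first exact: (state_unstarred Du st).
have [v vE] := state_surj Du st un.
case: (factor_vertex F v) vE => -[u ->] uE; first by exists u.
have : region (s (f2 u)) \in [set region (s (f2 w)) | w : crossing D2] by apply: imset_f.
by rewrite (marks_other st) uE inE mem_sides1.
Qed.

End MarkSets.

Section Restrict.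
Variables (D D1 D2 : knot_diagram).
Variables (f1 : crossing D1 -> crossing D) (f2 : crossing D2 -> crossing D).
Hypothesis F : factors f1 f2.
Let G := factors_sym F.
Let Du := code_uniq D.
Let Du1 := code_uniq D1.
Variables (Ri Rj : {set dart D}).
Hypothesis adj : adjacent Ri Rj.
Local Notation W := (embed f1).

(** If the dart between the starred regions comes from [D1], it supplies the stars of [D1].
    Otherwise the two regions common to both summands are starred or marked from [D2], so the
    joining edge supplies them. The choice is the same for all states. *)
Lemma marks_stars : exists2 p : dart D1, region (W p) != region (W (opp p)) &
  forall s d, is_state Ri Rj s ->
    (exists v, region (s (f1 v)) = region (W d)) <->
    ~~ ((region (W d) == region (W p)) || (region (W d) == region (W (opp p)))).
Proof.
case: adj => /eqP ne [x [xi xj]]; case: (factor_dart F x) => -[p xE].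
  have e1 : region (W p) = Ri by rewrite -xE.
  have e2 : region (W (opp p)) = Rj by rewrite (embed1_opp F) -xE.
  exists p; rewrite e1 e2 // => s d st.
  by apply: (marks_same F) st; rewrite -?e1 -?e2 mem_sides1.
have [d1 [d2 [AB ne1 _ _ _]]] := sides_card F.
exists d1 => // s d st.
have RiB : Ri \in sides1 f2 by rewrite -xi xE mem_sides1.
have RjB : Rj \in sides1 f2 by rewrite -xj xE -(embed1_opp G) mem_sides1.
have := marks_other G RiB RjB st => M.
have inM R : (exists v, region (s (f1 v)) = R) <-> R \in [set region (s (f1 w)) | w : crossing D1].
  by split=> [[v <-]|/imsetP[v _ ->]]; [apply: imset_f | exists v].
rewrite inM M inE mem_sides1 andbT.
have /setP/(_ (region (W d))) := AB; rewrite !inE mem_sides1 /= => ->.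
by split.
Qed.

Section Stars.
Variable p : dart D1.
Hypothesis ne_p : region (W p) != region (W (opp p)).
Hypothesis marksP : forall s d, is_state Ri Rj s ->
    (exists v, region (s (f1 v)) = region (W d)) <->
    ~~ ((region (W d) == region (W p)) || (region (W d) == region (W (opp p)))).
Local Notation Pi := (region p).
Local Notation Pj := (region (opp p)).

Lemma pull_adjacent : adjacent Pi Pj.
Proof.
split; last by exists p.
by move=> h; move/eqP: ne_p; apply; apply: (embed1_region F).
Qed.

Let regE d x : (region d == region x) = (region (W d) == region (W x)).
Proof. by apply/eqP/eqP => [/(embed1_region F)|/(embed1_regionK F)]. Qed.

Lemma pull_state s : is_state Ri Rj s -> is_state Pi Pj (pull f1 s).
Proof.
move=> st; split=> [v|_ /imsetP[d _ ->]]; first by rewrite ffunE.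
have mE v : (pull f1 s v \in region d) = (region (s (f1 v)) == region (W d)).
  by rewrite -eq_region // eq_sym regE (embed_pull _ st).
rewrite (eq_card (B := [set v | region (s (f1 v)) == region (W d)])); last first.
  by move=> v; rewrite in_set mE in_set.
rewrite !regE; case: ifP => h.
  apply/eqP; rewrite cards_eq0; apply/eqP/setP => v; rewrite !inE.
  apply/negP => /eqP e; have /(marksP d st) : exists v, region (s (f1 v)) = region (W d) by exists v.
  by rewrite h.
have /(marksP d st)[v vE] : ~~ ((region (W d) == region (W p)) || (region (W d) == region (W (opp p)))) by rewrite h.
rewrite -(cards1 v); congr #|pred_of_set _|; apply/setP => u; rewrite !inE -vE.
by apply/eqP/eqP => [/(state_inj Du st)/(factor1_inj F)|->].
Qed.

(** The regions marked from [D1] are the same in all states, so no transposition exchanges a marker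
    of [D1] with one of [D2]. *)
Lemma no_mixing s t u u' : is_state Ri Rj s -> is_state Ri Rj t ->
  region (t (f1 u)) <> region (s (f2 u')).
Proof.
move=> ss st; rewrite -(embed_pull f1 st) => e.
have h : exists v, region (t (f1 v)) = region (W (pull f1 t u)).
  by exists u; rewrite (embed_pull f1 st).
have [y yE] := iffRL (marksP _ ss) (iffLR (marksP _ st) h).
by apply: (factor_vertex_neq F (u := y) (w := u')); apply: (state_inj Du ss); rewrite yE.
Qed.

Section Turn.
Variables (turn : dart D -> dart D) (turn1 : dart D1 -> dart D1).
Hypothesis turnE : forall d, W (turn1 d) = turn (W d).

Lemma pull_turn_at u u' s : is_state Ri Rj s ->
  is_state Ri Rj (turn_at turn (f1 u) (f1 u') s) ->
  pull f1 (turn_at turn (f1 u) (f1 u') s) = turn_at turn1 u u' (pull f1 s).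
Proof.
move=> ss st; apply/ffunP => y; apply: (embed1_inj F); rewrite (embed_pull f1 st).
rewrite [in LHS]ffunE !(inj_eq (factor1_inj F)) [in RHS]ffunE.
by case: (_ || _); rewrite ?turnE (embed_pull f1 ss).
Qed.

(** Both crossings belong to the same summand; if it is [D2], the restriction does not move. *)
Lemma pull_transposition s t :
  is_state Ri Rj s -> is_state Ri Rj t -> transposition turn s t ->
  pull f1 t = pull f1 s \/ transposition turn1 (pull f1 s) (pull f1 t).
Proof.
move=> ss st /existsP[v /existsP[w /and5P[vw ne r1 r2 /eqP tt]]].
have tv : t v = turn (s v) by rewrite tt ffunE eqxx.
have tw : t w = turn (s w) by rewrite tt ffunE eqxx orbT.
have P := embed_pull f1 ss.
case: (factor_vertex F v) => -[u vE]; case: (factor_vertex F w) => -[u' wE].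
- right; apply/existsP; exists u; apply/existsP; exists u'.
  rewrite vE wE in vw ne r1 r2 tt; rewrite !regE !turnE !P ne r1 r2 (contraNneq _ vw) => [|->] //=.
  by rewrite tt in st *; rewrite pull_turn_at.
- by case: (no_mixing (u := u) (u' := u') ss st); rewrite -vE -wE tv (eqP r1).
- by case: (no_mixing (u := u') (u' := u) ss st); rewrite -vE -wE tw (eqP r2).
left; apply/ffunP => y; apply: (embed1_inj F); rewrite (embed_pull f1 st) P tt ffunE.
have neq z : f1 y == f2 z = false by apply/eqP; exact: (factor_vertex_neq F (u := y) (w := z)).
by rewrite vE wE !neq.
Qed.

(** Distinct regions of [D1] lie in distinct regions of [D], so a transposition of the restriction
    is also possible in [s], at the same crossings. *)
Lemma pull_stuck s : is_state Ri Rj s ->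
  (forall t, ~~ transposition turn s t) -> forall t, ~~ transposition turn1 (pull f1 s) t.
Proof.
move=> ss stuck t; apply/existsP => -[u /existsP[u' /and5P[uu ne r1 r2 _]]].
case/negP: (stuck (turn_at turn (f1 u) (f1 u') s)).
apply/existsP; exists (f1 u); apply/existsP; exists (f1 u').
move: ne r1 r2; rewrite !regE !turnE !(embed_pull f1 ss) => -> -> ->.
by rewrite (inj_eq (factor1_inj F)) uu eqxx.
Qed.

End Turn.

Lemma pull_path s q : is_state Ri Rj s ->
  path (fun x y => clockwise x y || counterclockwise x y) s q ->
  is_state Ri Rj (last s q) /\
  exists q', [/\ path (fun x y => clockwise x y || counterclockwise x y) (pull f1 s) q',
    last (pull f1 s) q' = pull f1 (last s q) & size q' <= size q].
Proof.
elim: q s => [|t q IH] s ss /=; first by split=> //; exists [::].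
case/andP=> stt pq; have st : is_state Ri Rj t.
  by case/orP: stt => tr; apply: (transposition_state Du) ss tr => d; rewrite ?vertex_cw ?vertex_ccw.
have [sl [q' [pq' lq' sq']]] := IH t st pq; split=> //.
have : pull f1 t = pull f1 s \/ clockwise (pull f1 s) (pull f1 t) || counterclockwise (pull f1 s) (pull f1 t).
  case/orP: stt => tr.
    by case: (pull_transposition (embed1_cw F) ss st tr) => [->|h]; [left|right; apply/orP; left].
  by case: (pull_transposition (embed1_ccw F) ss st tr) => [->|h]; [left|right; apply/orP; right].
case=> [e|h]; first by exists q'; rewrite -e; split=> //; apply: leqW.
by exists (pull f1 t :: q'); rewrite /= h.
Qed.

End Stars.

Theorem restrict_path s q : clocked Ri Rj s -> counterclocked Ri Rj (last s q) ->
  path (fun x y => clockwise x y || counterclockwise x y) s q ->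
  exists (Pi Pj : {set dart D1}) (s' : marking D1) q',
    [/\ adjacent Pi Pj, clocked Pi Pj s', counterclocked Pi Pj (last s' q'),
        path (fun x y => clockwise x y || counterclockwise x y) s' q' &
        size q' <= size q].
Proof.
move=> [ss cs] [st ct] pq; have [p ne_p marksP] := marks_stars.
have [_ [q' [pq' lq' sq']]] := pull_path marksP ss pq.
exists (region p), (region (opp p)), (pull f1 s), q'; split=> //.
- exact: pull_adjacent.
- split; first exact: pull_state.
  move=> t; apply: (pull_stuck (embed1_ccw F) ss); exact: cs.
rewrite lq'; split; first exact: pull_state.
move=> t; apply: (pull_stuck (embed1_cw F) st); exact: ct.
Qed.

End Restrict.

End Restriction.
Import Restriction.

(** * Descent to an irreducible diagram of the same prime knot *)

Lemma realizes_id (D : gauss_code) : realizes (@positive D) id (code D).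
Proof. by split=> //; rewrite map_id_in // => -[]. Qed.

(** Each arc contains both letters of its crossings, and [good_cat_inv] makes both arcs planar. *)
Lemma splits_factors (D : knot_diagram) : splits D ->
  exists (D1 D2 : knot_diagram) (f1 : crossing D1 -> crossing D) (f2 : crossing D2 -> crossing D),
  factors f1 f2.
Proof.
case=> k [u [w [kE un wn dis]]].
have guw : good (@positive D) (u ++ w).
  by rewrite -kE; apply: good_rot; apply: realizes_good (realizes_id D).
have [uuw /allP cuw] := andP guw.1.
have [uu uw] : uniq u /\ uniq w by move: uuw; rewrite cat_uniq => /and3P[].
have gu : gword u.
  rewrite /gword uu; apply/allP => l lu; have := cuw l; rewrite !mem_cat lu => /(_ isT).
  by case/orP=> // h; have := dis _ _ lu h; rewrite eqxx.
have gw : gword w.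
  rewrite /gword uw; apply/allP => l lw; have := cuw l; rewrite !mem_cat lw orbT => /(_ isT).
  by case/orP=> // h; have := dis _ _ h lw; rewrite eqxx.
have [/good_realized[D1 [f1 [i1 s1 E1]]] /good_realized[D2 [f2 [i2 s2 E2]]]] :=
  good_cat_inv guw gu gw dis.
exists D1, D2, f1, f2; split=> //.
- by move=> h; apply: un; rewrite -E1 h.
- by move=> h; apply: wn; rewrite -E2 h.
by exists k; rewrite kE E1 E2.
Qed.

Definition knot_of (D : knot_diagram) : knot :=
  @Knot (same_knot D) (ex_intro _ D (fun E => iff_refl _)).

Lemma diagram_of_same (K : knot) (D E : knot_diagram) :
  diagram_of K D -> same_knot D E -> diagram_of K E.
Proof.
have [D0 P] := diagram_ofP K; move=> /P h1 h2; apply/P; exact: rst_trans h1 h2.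
Qed.

Section Sum.
Variables (D D1 D2 : knot_diagram).
Variables (f1 : crossing D1 -> crossing D) (f2 : crossing D2 -> crossing D).
Hypothesis F : factors f1 f2.

(** [diagram_sum] speaks of the code itself, so [D] is replaced by the isotopic diagram with the
    rotated code. *)
Lemma factors_sum (K : knot) : diagram_of K D ->
  connected_sum (knot_of D1) (knot_of D2) K.
Proof.
move=> KD; have [k kE] := factor_code F.
pose D' := GaussCode (rot k (code D)) (@positive D).
have r : realizes (@positive D) (id : crossing D' -> crossing D) (rot k (code D)) := realizes_id D'.
have u' : uniq (code D') by rewrite rot_uniq code_uniq.
have full' (l : letter D') : l \in code D' by rewrite mem_rot; apply: code_full.
have g' : good (@positive D) (rot k (code D)).
  by apply: good_rot; apply: realizes_good (realizes_id D).
pose E := KnotDiagram u' full' (iffLR (wplanarP r u' full') g'.2).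
exists D1, D2, E; split; [exact: (rst_refl _ _ D1) | exact: (rst_refl _ _ D2) | |].
  apply: (diagram_of_same KD); apply: rst_step; apply: Or41; exists id; split=> //.
  by exists k; rewrite map_id_in // => -[].
by exists f1, f2; split; [exact: factor1_sign F | exact: factor2_sign F | exact: kE].
Qed.

(** In [sum_same], the second summand is replaced by the empty word of the circle, which leaves the
    word of [D1]. *)
Lemma factors_trivial : trivial_knot (knot_of D2) -> same_knot D D1.
Proof.
case=> D0 [same0 /eqP D00].
pose g (v : crossing D) : name := (nat_of_ord (enum_rank v), positive v).
have ginj : injective g by move=> v v' [/val_inj/enum_rank_inj].
have [i1 i2 s1 s2 _ _ [k kE]] := F.
pose a := [seq (g (f1 l.1), l.2) | l <- code D1].
pose e := [seq (g (f2 l.1), l.2) | l <- code D2].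
have ra : realizes nsg (g \o f1) a by split=> [v v' /ginj/i1 //|v|//]; rewrite /nsg /= s1.
have re : realizes nsg (g \o f2) e by split=> [v v' /ginj/i2 //|v|//]; rewrite /nsg /= s2.
have rD : realizes nsg g [seq (g l.1, l.2) | l <- code D] by split.
have code0 : code D0 = [::].
  case: (code D0) => // -[v b] s; have := card0_eq (eqP D00) v.
  by rewrite inE.
have r0 : realizes nsg (fun _ : crossing D0 => (0, true)) [::].
  by split=> [v|v|]; rewrite ?code0 //; have := card0_eq (eqP D00) v; rewrite inE.
have ap : apart a e.
  move=> l l' /mapP[m _ ->] /mapP[m' _ ->] /=; rewrite (inj_eq ginj).
  by apply/eqP; apply: (factor_vertex_neq F).
have ga := realizes_good ra.
have ap0 : apart a [::] by [].
have h := sum_same ga same0 re r0 ap ap0; rewrite cats0 in h.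
have rotE : rot k [seq (g l.1, l.2) | l <- code D] = a ++ e.
  by rewrite -map_rot kE map_cat -!map_comp.
have gae : good nsg (a ++ e) by rewrite -rotE; apply: good_rot; apply: realizes_good rD.
have hD : wsame nsg [seq (g l.1, l.2) | l <- code D] a.
  by apply: (wsame_trans gae) h; rewrite -rotE; apply: wsame_rot.
exact: hD rD ra.
Qed.

End Sum.

Lemma clock_bound (K : knot) (D : knot_diagram) (Ri Rj : {set dart D}) s q :
  prime_knot K -> diagram_of K D -> adjacent Ri Rj ->
  clocked Ri Rj s -> counterclocked Ri Rj (last s q) ->
  path (fun x y => clockwise x y || counterclockwise x y) s q ->
  exists E : knot_diagram, diagram_of K E /\ #|crossing E| <= (size q).+1.
Proof.
move=> [_ pr]; have [n] := ubnP #|crossing D|; elim: n D Ri Rj s q => // n IH D Ri Rj s q.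
rewrite ltnS => leD KD adj cs ct pq.
case: (classic (splits D)) => [sp|irr]; last first.
  exists D; split=> //.
  by have := irreducible_bound (code_uniq D) (@code_full D) (gauss_planar D) irr adj cs ct pq.
have [D1 [D2 [f1 [f2 F]]]] := splits_factors sp.
have step (X Y : knot_diagram) (fX : crossing X -> crossing D) (fY : crossing Y -> crossing D) :
    factors fX fY -> trivial_knot (knot_of Y) ->
    exists E : knot_diagram, diagram_of K E /\ #|crossing E| <= (size q).+1.
  move=> FX tY; have [Pi [Pj [s' [q' [adj' cs' ct' pq' sq']]]]] := restrict_path FX adj cs ct pq.
  have KX := diagram_of_same KD (factors_trivial FX tY).
  have lt : #|crossing X| < n.
    apply: leq_trans leD; rewrite (factor_crossing FX) -addn1 leq_add2l.
    exact: card_factor1 (factors_sym FX).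
  have [E [KE cE]] := IH X Pi Pj s' q' lt KX adj' cs' ct' pq'.
  by exists E; split=> //; apply: leq_trans cE _; rewrite ltnS.
case: (pr _ _ (factors_sum F KD)) => tr; last exact: step F tr.
exact: step (factors_sym F) tr.
Qed.

Theorem theorem4p1 (K : knot) (p c : nat) :
  prime_knot K -> clock_number K p -> crossing_number K c -> c <= p.
Proof.
move=> prK [[D [Ri [Rj [KD adj [[s [t [q [cs ct pq lE ->]]]] _]]]]] _] [_ least].
rewrite -lE in ct.
have [E [KE cE]] := clock_bound prK KD adj cs ct pq.
by apply: leq_trans cE; apply: least; exists E.
Qed.
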